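(* Let $k$ be a field of characteristic $0$, $\widetilde{W}$ a finite reflection group on a graded finite-dimensional $k$-vector space $\widetilde V$, $G$ a good normal subgroup of $\widetilde W$, $W=\widetilde W/G$, $V$ the tangent space to $Z=\widetilde V/G$ at $0$, and $p:\widetilde V\to Z\hookrightarrow V$. Put $B=k[\widetilde V]$, $A=k[V]$ and let $I$ be the ideal of $Z$ in $A$, so that $A/I=B^G$. Then: (i) $G$ is generated by reflections and double reflections. (ii) The morphism $\widetilde W\to W$ is a morphism of reflection groups. The image of a reflection $s$ of order $r$ with hyperplane $\widetilde H$ is a reflection of order $r/\gcd(r,e_{\widetilde H})$ if $r\nmid e_{\widetilde H}$; its determinant is then $\det(s)^{e_{\widetilde H}}$. (iii) Let $\widetilde H\in\mathcal{A}'(\widetilde W)$. There is a unique reflecting hyperplane $\phi(\widetilde H)$ of $W$ containing $p(\widetilde H)$. The map $\phi$ induces a bijection $\overline{\mathcal{A}'}(\widetilde W)\xrightarrow{\sim}\mathcal{A}(W)$. For $H\in\mathcal{A}(W)$, the set $\phi^{-1}(H)$ consists of the irreducible components of $p^{-1}(H\cap Z)$. (iv) For $H\in\mathcal{A}(W)$, there is a linear form $\alpha_H\in A$ defining $H$ whose image in $A/I$ is $\alpha_{\phi^{-1}(H)}$. The algebra $B^G$ is generated by $\{\alpha_{\phi^{-1}(H)}\}_{H\in\mathcal{A}(W)}$ and $B^{\widetilde W}$. (v) Let $H$ be a reflecting hyperplane of $W$ and let $H_1,H_2$ be two distinct irreducible components of $p^{-1}(H\cap Z)$. Then $H_1\cap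 H_2$ is contained in the ramification locus of $G$.
   Context: A grading on a finite-dimensional $k$-vector space is an algebraic action of $k^\times$ with strictly positive weights; $GL_{grad}(\widetilde V)$ is the group of elements of $GL(\widetilde V)$ commuting with this action, and $\widetilde W\subset GL_{grad}(\widetilde V)$. A reflection (resp. double reflection) is an automorphism $g$ of finite order with $\ker(g-1)$ of codimension $1$ (resp. $2$); a finite linear group is a reflection group if generated by its reflections. For a vector space $V$, $k[V]$ is the symmetric algebra of $V^*$. $\widetilde V/G=\operatorname{Spec}B^G$, $B^G_+$ is the ideal of $B^G$ spanned by homogeneous elements of positive degree, and $V=(B^G_+/(B^G_+)^2)^*$. Let $N(G)$ be the normalizer of $G$ in $GL_{grad}(\widetilde V)$. Fix a graded $N(G)$-equivariant splitting $V^*\to B^G_+$; it induces a surjection $A=k[V]\to B^G$ with kernel $I$, i.e. a closed immersion $\widetilde V/G\hookrightarrow V$. $A_+$ is the ideal of positive-degree elements of $A$. $G$ is called good in $\widetilde W$ if $G$ is of complete intersection (the minimal number of generators of $I$ is $\dim V-\dim\widetilde V$) and $W$ acts trivially on $I/A_+I$; in that case $W$ is a reflection group on $V$. A morphism of reflection groups is a group homomorphism sending each reflection to $1$ or to a reflection. For a reflection group $W$, $\mathcal{A}(W)$ is the set of hyperplanes of its reflections. For a hyperplane $H$, $\widetilde W_H$ and $G_H$ are the pointwise stabilizers of $H$ in $\widetilde W$ and $G$, and $e_H=|G_H|$. $\mathcal{A}'(\widetilde W)$ is the set of $H\in\mathcal{A}(\widetilde W)$ with $\widetilde W_H\neq G_H$,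 and $\overline{\mathcal{A}'}(\widetilde W)$ is its quotient by the equivalence relation: $H\sim H'$ iff $\widetilde W_H$ and $\widetilde W_{H'}$ have the same image in $W$; elements of $\overline{\mathcal{A}'}(\widetilde W)$ are regarded as subsets of $\mathcal{A}(\widetilde W)$. For each $H\in\mathcal{A}(\widetilde W)$ fix a linear form $\alpha_H\in B$ defining $H$, and for $C\subseteq\mathcal{A}(\widetilde W)$ put $\alpha_C=\prod_{H\in C}\alpha_H^{e_H}$. The ramification locus of $G$ is the set of points of $\widetilde V$ with non-trivial inertia group in $G$. *)

(* Defs.v *)
From HB Require Import structures.
From mathcomp Require Export all_boot all_order all_algebra all_fingroup.
From mathcomp Require Export mxrepresentation.
From mathcomp Require Export mpoly.

Set Implicit Arguments.
Unset Strict Implicit.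
Unset Printing Implicit Defensive.

Import GRing.Theory.
Local Open Scope ring_scope.

(* A finite linear group is a finite group with a faithful representation.
   Following mxrepresentation, g acts on the row vector v by v *m rG g, and
   subspaces are row spaces of square matrices. *)

Section PolynomialAction.
Variables (k : fieldType) (n : nat).
Implicit Types (M : 'M[k]_n) (b : {mpoly k[n]}).

(* The function v |-> b (v *m M). Since v |-> v *m rG g is a right action,
   g |-> mxact (rG g) is a left action on {mpoly k[n]}. *)
Definition mxact M b : {mpoly k[n]} :=
  b \mPo [tuple \sum_(j < n) M j i *: 'X_j | i < n].

(* Elements of the dual space are the 1-homogeneous polynomials. *)
Definition linform_vanishing (U : 'M[k]_n) b : Prop :=
  b \is 1.-homog /\ forall v : 'rV[k]_n, (v <= U)%MS -> b.@[v 0] = 0.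

Definition linform_defining (U : 'M[k]_n) b : Prop :=
  b \is 1.-homog /\ forall v : 'rV[k]_n, (v <= U)%MS = (b.@[v 0] == 0).

End PolynomialAction.

(* A grading is given in a homogeneous basis: k^* acts diagonally, by t ^+ d i
   on the i-th coordinate. *)
Section Grading.
Variables (k : fieldType) (n : nat) (d : 'I_n -> nat).

Definition grading_mx (t : k) : 'M[k]_n := diag_mx (\row_i t ^+ d i).

Definition in_GLgrad (x : 'M[k]_n) : Prop :=
  x \in unitmx /\ forall t : k, t != 0 -> x *m grading_mx t = grading_mx t *m x.

Definition weight (mon : 'X_{1..n}) : nat := (\sum_(i < n) mon i * d i)%N.

Definition whomog (e : nat) (b : {mpoly k[n]}) : Prop :=
  {in msupp b, forall mon, weight mon = e}.

Definition positive_part (b : {mpoly k[n]}) : Prop :=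
  {in msupp b, forall mon, (0 < weight mon)%N}.

End Grading.

Section IdealsAndSubalgebras.

Definition generates_ideal (R : comNzRingType) (r : nat) (s : r.-tuple R)
    (J : R -> Prop) : Prop :=
  forall x, J x <-> exists c : 'I_r -> R, x = \sum_(i < r) c i * tnth s i.

Definition min_generators (R : comNzRingType) (J : R -> Prop) (r : nat) : Prop :=
  (exists s : r.-tuple R, generates_ideal s J) /\
  (forall r' (s : r'.-tuple R), generates_ideal s J -> (r <= r')%N).

Definition prod_span (R : comNzRingType) (J K : R -> Prop) (x : R) : Prop :=
  exists2 s : seq (R * R), {in s, forall u, J u.1 /\ K u.2}
                         & x = \sum_(u <- s) u.1 * u.2.

Definition in_generated_algebra (k : fieldType) (n : nat)
    (S : {mpoly k[n]} -> Prop) (b : {mpoly k[n]}) : Prop :=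
  exists r (t : r.-tuple {mpoly k[n]}) (q : {mpoly k[r]}),
    (forall i, S (tnth t i)) /\ b = q \mPo t.

End IdealsAndSubalgebras.

(* Points of Spec R are prime ideals, of type prime_idealr R. *)
Section Spectrum.
Variable R : comNzRingType.
Implicit Types (T X : prime_idealr R -> Prop).

Definition zariski_closed T : Prop :=
  exists S : R -> Prop, forall P, T P <-> (forall b, S b -> b \in P).

Definition zariski_irreducible T : Prop :=
  (exists P, T P) /\
  forall T1 T2, zariski_closed T1 -> zariski_closed T2 ->
    (forall P, T P -> T1 P \/ T2 P) ->
    (forall P, T P -> T1 P) \/ (forall P, T P -> T2 P).

Definition irreducible_component X T : Prop :=
  [/\ zariski_irreducible T, forall P, T P -> X P &
      forall T', zariski_irreducible T' -> (forall P, T' P -> X P) ->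
        (forall P, T P -> T' P) -> forall P, T' P -> T P].

End Spectrum.

Definition linear_locus (k : fieldType) (n : nat) (U : 'M[k]_n)
    (P : prime_idealr {mpoly k[n]}) : Prop :=
  forall b, linform_vanishing U b -> b \in P.

(* f : m.-tuple {mpoly k[n]} gives the morphism A = k[V] -> B, a |-> a \mPo f,
   and so the morphism p : Spec B -> Spec A. *)
Section Embedding.
Variables (k : fieldType) (n m : nat) (f : m.-tuple {mpoly k[n]}).
Local Notation A := {mpoly k[m]}.
Local Notation B := {mpoly k[n]}.

Definition ideal_of_image (a : A) : Prop := a \mPo f = 0.

Section Comap.
Variable P : prime_idealr B.

Definition comap : A -> bool := fun a => a \mPo f \in P.

Fact comapE a : (a \in comap) = (a \mPo f \in P).
Proof. by []. Qed.

Fact comap_idealr_closed : idealr_closed comap.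
Proof.
split=> [||a x y]; rewrite !comapE ?comp_mpoly0 ?comp_mpoly1 ?rpred0 ?idealr1 //.
by move=> xP yP; rewrite rmorphD rmorphM rpredD ?idealMr.
Qed.

Fact comap_prime : prime_idealr_closed comap.
Proof. by move=> u v; rewrite !comapE rmorphM prime_idealrM. Qed.

HB.instance Definition _ := isIdealr.Build A comap comap_idealr_closed.
HB.instance Definition _ := isPrimeIdealrClosed.Build A comap comap_prime.

Definition spec_map : prime_idealr A := comap.
End Comap.

Definition image_locus (Q : prime_idealr A) : Prop :=
  forall a, ideal_of_image a -> a \in Q.

Definition maps_into (Ht : 'M[k]_n) (H : 'M[k]_m) : Prop :=
  forall P, linear_locus Ht P -> linear_locus H (spec_map P).

Definition preim_hyperplane (H : 'M[k]_m) (P : prime_idealr B) : Prop :=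
  linear_locus H (spec_map P) /\ image_locus (spec_map P).

End Embedding.

Section Reflections.
Variables (k : fieldType) (gT : finGroupType) (W : {group gT}) (n : nat).
Variable rW : mx_representation k W n.

Definition fix_codim (s : gT) : nat := (n - \rank (eigenspace (rW s) 1))%N.
Definition reflection (s : gT) : bool := fix_codim s == 1%N.
Definition double_reflection (s : gT) : bool := fix_codim s == 2.

(* genmx makes equality of matrices coincide with equality of subspaces. *)
Definition fix_space (s : gT) : 'M[k]_n := <<eigenspace (rW s) 1>>%MS.

Definition arrangement : seq 'M[k]_n :=
  undup [seq fix_space s | s <- enum W & reflection s].

Definition reflection_group : Prop :=
  mx_faithful rW /\ <<[set s in W | reflection s]>>%g = W.

End Reflections.

Definition reflection_morphism (k : fieldType)
    (gT hT : finGroupType) (W : {group gT}) (W' : {group hT}) (n n' : nat)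
    (rW : mx_representation k W n) (rW' : mx_representation k W' n')
    (h : gT -> hT) : Prop :=
  [/\ reflection_group rW, reflection_group rW',
      {in W, forall x, h x \in W'},
      {in W &, {morph h : x y / (x * y)%g}} &
      {in W, forall s, reflection rW s ->
         h s = 1%g \/ reflection rW' (h s)}].

(* Below Wt acts on the source space by rV, and G is a normal subgroup of Wt. *)
Section NormalSubgroup.
Variables (k : fieldType) (gT : finGroupType) (Wt G : {group gT}) (n : nat).
Variable rV : mx_representation k Wt n.
Local Notation B := {mpoly k[n]}.

Definition invariant (D : {group gT}) (b : B) : Prop :=
  {in D, forall g, mxact (rV g) b = b}.

(* The inertia group of a prime P consists of the g acting trivially on B / P. *)
Definition ramified (P : prime_idealr B) : Prop :=
  exists2 g, g \in G & g != 1%g /\ forall b, mxact (rV g) b - b \in P.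

Definition ram_index (H : 'M[k]_n) : nat := #|G :&: rstab rV H|.

Definition arrangement' : seq 'M[k]_n :=
  [seq H <- arrangement rV | rstab rV H != G :&: rstab rV H].

Definition hyp_equiv (H H' : 'M[k]_n) : Prop :=
  (rstab rV H / G = rstab rV H' / G)%g.

Definition alpha_prod (alpha : 'M[k]_n -> B) (C : seq 'M[k]_n) : B :=
  \prod_(H <- C) alpha H ^+ ram_index H.

Variable d : 'I_n -> nat.

Definition in_normalizer (x : 'M[k]_n) : Prop :=
  in_GLgrad d x /\
  [seq invmx x *m rV g *m x | g in G] =i [seq rV g | g in G].

Definition inv_pos (b : B) : Prop := invariant G b /\ positive_part d b.

(* f is a homogeneous basis, with degrees e, of the image of a graded
   N(G)-equivariant section of B^G_+ -> B^G_+ / (B^G_+)^2 = V^*; a section is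
   equivariant exactly when its image is N(G)-stable. *)
Record equivariant_splitting (m : nat) (e : 'I_m -> nat) (f : m.-tuple B)
    : Prop := {
  splitting_inv_pos : forall i, inv_pos (tnth f i);
  splitting_homog : forall i, whomog d (e i) (tnth f i);
  splitting_free : forall c : 'I_m -> k,
    prod_span inv_pos inv_pos (\sum_(i < m) c i *: tnth f i) ->
    forall i, c i = 0;
  splitting_span : forall b, inv_pos b -> exists c : 'I_m -> k,
    prod_span inv_pos inv_pos (b - \sum_(i < m) c i *: tnth f i);
  splitting_stable : forall x, in_normalizer x -> forall i,
    exists c : 'I_m -> k,
      mxact x (tnth f i) = \sum_(j < m) c j *: tnth f j }.

(* The action of Wt / G on V making p equivariant. It exists and is unique for
   an equivariant_splitting f: the matrix of w is given by the coordinates of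
   w.f_i on the f_j, as Wt lies in the normalizer of G and f is free. *)
Definition induced_action (m : nat) (f : m.-tuple B)
    (rW : mx_representation k (Wt / G)%g m) : Prop :=
  {in Wt, forall w, forall a : {mpoly k[m]},
    mxact (rW (coset G w)) a \mPo f = mxact (rV w) (a \mPo f)}.

Definition complete_intersection (m : nat) (f : m.-tuple B) : Prop :=
  exists2 r, min_generators (ideal_of_image f) r & (r + n = m)%N.

Definition good (m : nat) (e : 'I_m -> nat) (f : m.-tuple B)
    (rW : mx_representation k (Wt / G)%g m) : Prop :=
  complete_intersection f /\
  {in (Wt / G)%g, forall x, forall a, ideal_of_image f a ->
     prod_span (positive_part e) (ideal_of_image f) (mxact (rW x) a - a)}.

End NormalSubgroup.

(* Main.v *)
From HB Require Import structures.
From mathcomp Require Import cyclic ring.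
Require Import Defs.

(* Write R for the ring of G-invariants in B. Since R is a complete intersection, the
   matrix rho of differentials of the relations and the Jacobian J of f form an exact
   sequence of B-modules with rho injective. This rests on an identity
   disc^3 = P X + M rho, obtained by extending the universal derivation of R to the
   elements of B fixed by the stabilizer of some y in B, along the Lagrange interpolation
   polynomials on the orbit of y.
   (i) Let D be generated by the reflections and double reflections of G. The elements of
   G outside D fix subspaces of codimension at least 3, so the differential of a
   D-invariant is multiplied into the rows of J by three independent linear forms; the
   exact sequence puts it into the rows of J, and Euler's identity shows that f generates
   the D-invariants. Hence D = G.
   (ii) At a generic point of the hyperplane of s, the differentials of the relations are
   fixed by the image S of s, because W acts trivially on I / A_+ I. By the identity
   above, S^T - 1 then factors through the partial derivatives of f in coordinates where
   s acts by the single scalar det(s)^e, so S is trivial or a reflection.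
   (iii)-(v) If w lifts a reflection of W, the equation of its hyperplane pulls back to a
   divisor of prod_(g in G) (w y - g y), which is a product of linear forms when y is
   linear; so this pullback is a product of linear forms, which define the hyperplanes over
   the given one, with the multiplicities given by (ii). A coordinate of V minus its
   average over W is a combination of equations of reflecting hyperplanes, which gives the
   generation of R. Two hyperplanes over the same one have stabilizers with the same image
   in W, and a quotient of two reflections with this image lies in G and fixes their
   intersection. *)

Set Implicit Arguments.
Unset Strict Implicit.
Unset Printing Implicit Defensive.

Import GRing.Theory.
Local Open Scope ring_scope.

(** * Polynomials and linear substitutions *)

(** Exactness is obtained without depth theory. The identity gives it after multiplication by a
    discriminant, so everything depends on the choice of y. For a generic linear y the stabilizer is
    trivial and the discriminant is a product of linear forms. For each of these forms there is
    another y, whose stabilizer in G is the pointwise stabilizer of the hyperplane and whose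
    discriminant does not vanish at some point of it; the invariants of this cyclic stabilizer form
    a polynomial ring with explicit generators. The second choice cancels, one by one, the linear
    factors produced by the first. The complete intersection hypothesis c + n = m acts through
    ranks: where the discriminant is nonzero, the ranks of the two matrices of the identity add up
    to at least m, while they are at most n and c, so both are maximal. The cube is a common
    denominator: interpolation writes b as a quotient over chi'(y), the quotient rule squares this
    denominator, and making the derivation kill chi costs one more factor. *)

Lemma mul_sub_mul (R : comNzRingType) (p1 q1 p2 q2 : R) :
  p1 * q1 - p2 * q2 = p1 * (q1 - q2) + q2 * (p1 - p2).
Proof. by rewrite !mulrBr addrA (mulrC q2 p1) subrK (mulrC q2). Qed.

(** Substitutions and derivations are determined by constants and variables, so identities between
    them reduce to these two cases. *)
Lemma mpoly_alg_ind (R : comNzRingType) (n : nat) (P : {mpoly R[n]} -> Prop) :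
  (forall c, P c%:MP) -> (forall i, P 'X_i) ->
  (forall p q, P p -> P q -> P (p + q)) ->
  (forall p q, P p -> P q -> P (p * q)) -> forall p, P p.
Proof.
move=> PC PX PD PM p; rewrite (mpolyE p).
apply: big_ind => [|p1 p2 P1 P2|mon _]; [by rewrite -mpolyC0 | exact: PD |].
rewrite -mul_mpolyC; apply: (PM) => //; rewrite mpolyXE_id.
apply: big_ind => [|p1 p2 P1 P2|i _]; [by rewrite -mpolyC1 | exact: PM |].
by elim: (mon i) => [|j IHj]; rewrite ?expr0 -?mpolyC1 // exprS; apply: PM.
Qed.

Section Composition.
Variables (R : comNzRingType).

Lemma comp_mpolyXt n k (t : n.-tuple {mpoly R[k]}) i : 'X_i \mPo t = tnth t i.
Proof. by rewrite comp_mpolyXU -tnth_nth. Qed.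

Lemma comp_mpolyA n k l (t : n.-tuple {mpoly R[k]}) (u : k.-tuple {mpoly R[l]})
    (a : {mpoly R[n]}) :
  (a \mPo t) \mPo u = a \mPo [tuple tnth t i \mPo u | i < n].
Proof.
elim/mpoly_alg_ind: a => [c|i|p q IHp IHq|p q IHp IHq].
- by rewrite !comp_mpolyC.
- by rewrite !comp_mpolyXt tnth_mktuple.
- by rewrite !rmorphD /= IHp IHq.
by rewrite !rmorphM /= IHp IHq.
Qed.

Lemma eq_comp_mpoly n k (t u : n.-tuple {mpoly R[k]}) (a : {mpoly R[n]}) :
  (forall i, tnth t i = tnth u i) -> a \mPo t = a \mPo u.
Proof. by move=> /eq_from_tnth ->. Qed.

(** Polynomials respect congruence modulo an ideal. [J] is a bare predicate because it is later the
    span of several forms, the multiples of a variable, or the inverse image of a principal ideal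
    under substitution of [f]. *)
Lemma comp_mpoly_congr n k (J : {mpoly R[k]} -> Prop)
    (t u : n.-tuple {mpoly R[k]}) (a : {mpoly R[n]}) :
  (forall x y, J x -> J y -> J (x + y)) -> (forall b x, J x -> J (b * x)) ->
  J 0 -> (forall i, J (tnth t i - tnth u i)) -> J ((a \mPo t) - (a \mPo u)).
Proof.
move=> JD JM J0 Jtu; elim/mpoly_alg_ind: a => [c|i|p q IHp IHq|p q IHp IHq].
- by rewrite !comp_mpolyC subrr.
- by rewrite !comp_mpolyXt.
- by rewrite !rmorphD /= opprD addrACA; apply: JD.
rewrite !rmorphM /=.
rewrite mul_sub_mul.
by apply: JD; apply: JM.
Qed.

Lemma mderiv_comp n k (t : n.-tuple {mpoly R[k]}) (a : {mpoly R[n]}) i :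
  (a \mPo t)^`M(i) = \sum_(l < n) (a^`M(l) \mPo t) * (tnth t l)^`M(i).
Proof.
elim/mpoly_alg_ind: a => [c|j|p q IHp IHq|p q IHp IHq].
- rewrite comp_mpolyC mderivC big1 // => l _.
  by rewrite mderivC comp_mpoly0 mul0r.
- rewrite comp_mpolyXt (bigD1 j) //= big1 => [|l neq_lj].
    rewrite mderivX mnm1E eqxx -[X in (X - _)%MM]add0m addmK mpolyX0 scale1r.
    by rewrite comp_mpoly1 mul1r addr0.
  by rewrite mderivX mnm1E eq_sym (negPf neq_lj) scale0r comp_mpoly0 mul0r.
- rewrite rmorphD mderivD IHp IHq -big_split /=; apply: eq_bigr => l _.
  by rewrite mderivD rmorphD mulrDl.
rewrite rmorphM mderivM IHp IHq mulr_suml mulr_sumr -big_split /=.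
apply: eq_bigr => l _; rewrite mderivM rmorphD !rmorphM /= mulrDl.
by rewrite -!mulrA (mulrC (q \mPo t)).
Qed.

End Composition.

Section LinearSubstitution.
Variables (k : fieldType) (n : nat).
Implicit Types (M : 'M[k]_n) (b : {mpoly k[n]}) (c : 'cV[k]_n).

Definition lf c : {mpoly k[n]} := \sum_(i < n) c i 0 *: 'X_i.

Lemma lf_linear a c c' : lf (a *: c + c') = a *: lf c + lf c'.
Proof.
rewrite /lf scaler_sumr -big_split /=; apply: eq_bigr => i _.
by rewrite !mxE scalerDl scalerA.
Qed.
HB.instance Definition _ := GRing.isLinear.Build k 'cV[k]_n {mpoly k[n]} _ lf
  lf_linear.

HB.instance Definition _ M := GRing.RMorphism.copy (mxact M)
  (comp_mpoly [tuple \sum_(j < n) M j i *: 'X_j | i < n]).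
HB.instance Definition _ M := GRing.Linear.copy (mxact M)
  (comp_mpoly [tuple \sum_(j < n) M j i *: 'X_j | i < n]).

Lemma lfE_col c : lf c = \sum_(i < n) c i 0 *: 'X_i.
Proof. by []. Qed.

Lemma mxactX M i : mxact M 'X_i = lf (col i M).
Proof.
rewrite /mxact comp_mpolyXt tnth_mktuple /lf.
by apply: eq_bigr => j _; rewrite mxE.
Qed.

Lemma mpolyC_mxact M x : mxact M x%:MP = x%:MP.
Proof. exact: comp_mpolyC. Qed.

Lemma mxact_lf M c : mxact M (lf c) = lf (M *m c).
Proof.
rewrite lfE_col raddf_sum /=.
transitivity (\sum_(i < n) lf (c i 0 *: col i M)).
  by apply: eq_bigr => i _; rewrite !linearZ /= mxactX.
rewrite -raddf_sum; congr lf; apply/colP=> j; rewrite summxE mxE.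
by apply: eq_bigr => i _; rewrite !mxE mulrC.
Qed.

Lemma mxactM M N b : mxact (M *m N) b = mxact M (mxact N b).
Proof.
rewrite /mxact comp_mpolyA; apply: eq_comp_mpoly => i; rewrite !tnth_mktuple.
have eN (A : 'M[k]_n) : \sum_(j < n) A j i *: 'X_j = lf (col i A).
  by apply: eq_bigr => j _; rewrite mxE.
by rewrite !eN -/(mxact M _) mxact_lf !colE mulmxA.
Qed.

Lemma mxact1 b : mxact 1%:M b = b.
Proof.
rewrite -[RHS]comp_mpoly_id; apply: eq_comp_mpoly => i; rewrite !tnth_mktuple.
rewrite (bigD1 i) //= mxE eqxx scale1r big1 ?addr0 // => j neq_ji.
by rewrite mxE (negPf neq_ji) scale0r.
Qed.

Lemma lf_eval c (v : 'rV[k]_n) : (lf c).@[v 0] = (v *m c) 0 0.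
Proof.
rewrite raddf_sum mxE; apply: eq_bigr => i _.
by rewrite /= mevalZ mevalXU mulrC.
Qed.

Lemma mxact_eval M b (v : 'rV[k]_n) : (mxact M b).@[v 0] = b.@[(v *m M) 0].
Proof.
rewrite comp_mpoly_meval; apply: meval_eq => i; rewrite tnth_mktuple.
rewrite raddf_sum mxE; apply: eq_bigr => j _.
by rewrite /= mevalZ mevalXU mulrC.
Qed.

Lemma lf_eq0 c : (lf c == 0) = (c == 0).
Proof.
apply/eqP/eqP=> [lf0|->]; last by rewrite linear0.
apply/colP=> i; rewrite mxE; have := congr1 (mcoeff U_(i)) lf0.
rewrite mcoeff0 raddf_sum (bigD1 i) //= mcoeffZ mcoeffXU eqxx mulr1 big1 ?addr0 //.
by move=> j neq_ji; rewrite mcoeffZ mcoeffXU (negPf neq_ji) mulr0.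
Qed.

(** The substitution moves each variable by a combination of the forms in the columns of [C], hence
    each polynomial by an element of the ideal they generate. *)
Lemma mxact_proj q (C : 'M[k]_(n, q)) (K : 'M[k]_(q, n)) b :
  exists u : 'I_q -> {mpoly k[n]},
    b - mxact (1%:M - C *m K) b = \sum_(j < q) u j * lf (col j C).
Proof.
rewrite -{1}[b]mxact1 /mxact.
apply: (comp_mpoly_congr (J := fun x => exists u : 'I_q -> {mpoly k[n]},
  x = \sum_(j < q) u j * lf (col j C))) => [x y|c x||i].
- move=> [u ->] [w ->]; exists (fun j => u j + w j); rewrite -big_split /=.
  by apply: eq_bigr => j _; rewrite mulrDl.
- by move=> [u ->]; exists (fun j => c * u j); rewrite mulr_sumr; under eq_bigr do rewrite mulrA.
- by exists (fun=> 0); rewrite big1 // => j _; rewrite mul0r.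
exists (fun j => (K j i)%:MP); rewrite -[LHS]opprB.
rewrite !tnth_mktuple -sumrB -sumrN.
transitivity (lf (col i (C *m K))).
  by apply: eq_bigr => j _; rewrite -scalerBl -scaleNr !mxE opprB opprB addrC subrK.
transitivity (lf (\sum_(j < q) K j i *: col j C)).
  by congr lf; apply/colP=> j; rewrite summxE !mxE; apply: eq_bigr => l _; rewrite !mxE mulrC.
by rewrite raddf_sum /=; apply: eq_bigr => j _; rewrite linearZ mul_mpolyC.
Qed.

End LinearSubstitution.

Section LinearPrimes.
Variables (k : fieldType) (n : nat).
Local Notation B := {mpoly k[n]}.
Implicit Types (a c : 'cV[k]_n) (b x y : B).

Definition dvdmp (p b : B) : Prop := exists q, b = q * p.

Lemma dvdmpD p x y : dvdmp p x -> dvdmp p y -> dvdmp p (x + y).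
Proof. by move=> [q ->] [q' ->]; exists (q + q'); rewrite mulrDl. Qed.

Lemma dvdmp_mull p x y : dvdmp p x -> dvdmp p (y * x).
Proof. by move=> [q ->]; exists (y * q); rewrite mulrA. Qed.

Lemma dvdmp0 p : dvdmp p 0.
Proof. by exists 0; rewrite mul0r. Qed.

Lemma col_left_inv a : a != 0 -> exists K : 'M[k]_(1, n), K *m a = 1%:M.
Proof.
move=> a0; have /row_fullP// : row_full a.
rewrite /row_full eqn_leq rank_leq_col lt0n mxrank_eq0 //.
Qed.

Lemma mxact_proj_lf q (C : 'M[k]_(n, q)) (K : 'M[k]_(q, n)) j :
  K *m C = 1%:M -> mxact (1%:M - C *m K) (lf (col j C)) = 0.
Proof.
move=> KC; rewrite mxact_lf mulmxBl mul1mx colE mulmxA -(mulmxA C) KC mulmx1.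
by rewrite subrr linear0.
Qed.

(** When [K *m C] is the identity, [1%:M - C *m K] projects onto the common zeros of the forms in
    [C], and substituting it is restriction to this subspace. The ideal of these forms is thus the
    kernel of a morphism to a domain, which is how primality is obtained below. *)
Lemma proj_kill q (C : 'M[k]_(n, q)) (K : 'M[k]_(q, n)) x :
  K *m C = 1%:M -> mxact (1%:M - C *m K) x = 0 <->
  exists u : 'I_q -> B, x = \sum_(j < q) u j * lf (col j C).
Proof.
move=> KC; split=> [x0|[u ->]].
  by have [u] := mxact_proj C K x; rewrite x0 subr0 => ->; exists u.
rewrite rmorph_sum big1 // => j _; rewrite rmorphM /=.
by rewrite mxact_proj_lf // mulr0.
Qed.

Lemma dvd_lfP a (K : 'M[k]_(1, n)) x :
  K *m a = 1%:M -> (dvdmp (lf a) x <-> mxact (1%:M - a *m K) x = 0).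
Proof.
move=> Ka; have cola : col 0 a = a by apply/colP=> i; rewrite mxE.
rewrite proj_kill //; split=> [[q ->]|[u ->]].
  by exists (fun=> q); rewrite big_ord1 cola.
by exists (u 0); rewrite big_ord1 cola.
Qed.

Lemma lf_prime a x y : a != 0 ->
  dvdmp (lf a) (x * y) -> dvdmp (lf a) x \/ dvdmp (lf a) y.
Proof.
move=> /col_left_inv[K Ka]; rewrite !(dvd_lfP _ Ka) rmorphM /=.
by move/eqP; rewrite mulf_eq0 => /orP[] /eqP; [left|right].
Qed.

Lemma lf_prime_prod (I : eqType) (s : seq I) (F : I -> B) a : a != 0 ->
  dvdmp (lf a) (\prod_(i <- s) F i) ->
  exists2 i, i \in s & dvdmp (lf a) (F i).
Proof.
move=> a0; elim: s => [|i s IHs]; rewrite ?big_nil ?big_cons.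
  have [K Ka] := col_left_inv a0; rewrite (dvd_lfP _ Ka) rmorph1.
  by move/eqP; rewrite oner_eq0.
case/(lf_prime a0) => [?|/IHs[j js ?]]; first by exists i => //; rewrite mem_head.
by exists j => //; rewrite in_cons js orbT.
Qed.

Lemma dvd_lf_lf a c : a != 0 -> dvdmp (lf a) (lf c) -> exists t, c = t *: a.
Proof.
move=> /col_left_inv[K Ka]; rewrite (dvd_lfP _ Ka) mxact_lf => /eqP.
rewrite lf_eq0 mulmxBl mul1mx subr_eq0 => /eqP ->; exists ((K *m c) 0 0).
by rewrite -mulmxA {1}[K *m c]mx11_scalar mul_mx_scalar.
Qed.

Lemma dvd_lf_eval a b (v : 'rV[k]_n) :
  dvdmp (lf a) b -> v *m a = 0 -> b.@[v 0] = 0.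
Proof. by move=> [q ->] va0; rewrite mevalM lf_eval va0 mxE mulr0. Qed.

Lemma lf_coprime a c x :
  a != 0 -> ~ dvdmp (lf a) (lf c) -> dvdmp (lf a) (lf c * x) -> dvdmp (lf a) x.
Proof. by move=> a0 Nac /(lf_prime a0)[]. Qed.

Lemma row_full_pair a1 a2 : row_full (row_mx a1 a2) ->
  a1 != 0 /\ ~ dvdmp (lf a1) (lf a2).
Proof.
move=> /row_fullP[K]; rewrite mul_mx_row scalar_mx_block -[K]vsubmxK !mul_col_mx.
rewrite block_mxEh => /eq_row_mx[/eq_col_mx[E1 E2] /eq_col_mx[E3 E4]].
have a10 : a1 != 0.
  by apply: contraTneq isT => a10; move/eqP: E1; rewrite a10 mulmx0 eq_sym oner_eq0.
split=> // /(dvd_lf_lf a10)[t a2E]; move/eqP: E4; rewrite a2E -scalemxAr E2.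
by rewrite scaler0 eq_sym oner_eq0.
Qed.

(* With three independent linear forms, the first two generate a prime ideal
   which does not contain the third. *)
Lemma row_full_triple a1 a2 a3 x y z : row_full (row_mx (row_mx a1 a2) a3) ->
  lf a3 * x = y * lf a1 + z * lf a2 ->
  exists u w, x = u * lf a1 + w * lf a2.
Proof.
move=> /row_fullP[K]; rewrite mul_mx_row scalar_mx_block -[K]vsubmxK !mul_col_mx.
rewrite block_mxEh => /eq_row_mx[/eq_col_mx[E1 E2] /eq_col_mx[E3 E4]].
set C := row_mx a1 a2 in E1 E2; set K1 := usubmx K in E1 E3.
have a30 : a3 != 0.
  by apply: contraTneq isT => a30; move/eqP: E4; rewrite a30 mulmx0 eq_sym oner_eq0.
have sumC (u : 'I_(1 + 1) -> B) : \sum_(j < 1 + 1) u j * lf (col j C)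
    = u 0 * lf a1 + u (rshift 1 0) * lf a2.
  rewrite big_split_ord !big_ord1 /=; congr (_ * lf _ + _ * lf _).
  - by congr u; apply: val_inj.
  - by apply/colP=> i; rewrite mxE row_mxEl.
  by apply/colP=> i; rewrite mxE row_mxEr.
move=> eqx; have : mxact (1%:M - C *m K1) (lf a3 * x) = 0.
  apply/(proj_kill _ E1); exists (fun j => if j == 0 then y else z).
  by rewrite sumC /= eqx.
rewrite rmorphM /= mxact_lf mulmxBl mul1mx -mulmxA E3 mulmx0 subr0.
move/eqP; rewrite mulf_eq0 lf_eq0 (negPf a30) /= => /eqP/(proj_kill _ E1)[u ->].
by rewrite sumC; exists (u 0), (u (rshift 1 0)).
Qed.

End LinearPrimes.

(** * Generic vectors outside finitely many subspaces *)

Section Avoidance.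
Variables (k : fieldType) (hk : [pchar k] =i pred0).

Lemma natr_neq0 j : (j.+1%:R : k) != 0.
Proof. by move/pcharf0P: hk => ->. Qed.

Lemma natr_inj : injective (fun j : nat => j%:R : k).
Proof.
move=> i j /eqP; wlog le_ij : i j / (i <= j)%N => [H|].
  by case/orP: (leq_total i j) => le /eqP E; [apply: H|apply/esym/H] => //; rewrite E.
rewrite eq_sym -subr_eq0 -natrB //; move/pcharf0P: hk => -> /eqP ji0.
by apply/eqP; rewrite eqn_leq le_ij -subn_eq0 ji0.
Qed.

Lemma poly_nonroot (p : {poly k}) : p != 0 -> exists x, ~~ root p x.
Proof.
move=> p0; have [/allP rs|/allPn[x _ Nx]] := boolP (all (root p)
    [seq i%:R : k | i <- iota 0 (size p)]); last by exists x.
have := max_poly_roots p0 (introT allP rs).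
rewrite map_inj_uniq; last exact: natr_inj.
by rewrite iota_uniq size_map size_iota ltnn => /(_ isT).
Qed.

(* A vector (1, t, .., t^(n-1)) avoids finitely many proper subspaces for some
   value of t, as each of them excludes only the roots of a polynomial. *)
Lemma avoid_col n (T : finType) (p : T -> nat) (N : forall i, 'M[k]_(p i, n)) :
  (forall i, N i != 0) -> exists c : 'cV[k]_n, forall i, N i *m c != 0.
Proof.
move=> N0.
pose P i j := \poly_(l < n) (if insub l is Some l' then N i j l' else 0).
have /fin_all_exists[j Pj] i : exists j, P i j != 0.
  have /existsP[j /existsP[l Nil]] : [exists j, exists l, N i j l != 0].
    apply: contraNT (N0 i) => /existsPn H; apply/eqP/matrixP=> j l.
    by move/existsPn/(_ l)/negPn/eqP: (H j) => ->; rewrite mxE.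
  exists j; apply: contraNneq Nil => /(congr1 (fun q : {poly k} => q`_l)).
  by rewrite coef0 coef_poly ltn_ord valK => ->.
have /poly_nonroot[x Nx] : \prod_i P i (j i) != 0 by apply/prodf_neq0.
exists (\col_l x ^+ l) => i; apply: contraNneq Nx => Nx0.
rewrite rootE horner_prod; apply/eqP; rewrite (bigD1 i) //= [X in X * _](_ : _ = 0) ?mul0r //.
have := congr1 (fun A : 'cV[k]__ => A (j i) 0) Nx0; rewrite !mxE => <-.
rewrite horner_poly; apply: eq_bigr => l _.
by rewrite mxE valK.
Qed.

Lemma avoid_row n (T : finType) (p : T -> nat) (N : forall i, 'M[k]_(n, p i)) :
  (forall i, N i != 0) -> exists v : 'rV[k]_n, forall i, v *m N i != 0.
Proof.
move=> N0; have [i|c Hc] := avoid_col (N := fun i => (N i)^T).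
  by rewrite trmx_eq0.
exists c^T => i; rewrite -trmx_eq0 trmx_mul trmxK; exact: Hc.
Qed.

End Avoidance.

(** * Differentials and Lagrange interpolation on orbits *)

Section Gradient.
Variables (k : fieldType).

Definition grad n (b : {mpoly k[n]}) : 'rV[{mpoly k[n]}]_n := \row_i b^`M(i).

Definition jacobian n m (t : m.-tuple {mpoly k[n]}) : 'M[{mpoly k[n]}]_(m, n) :=
  \matrix_(l, i) (tnth t l)^`M(i).

Variable n : nat.
Implicit Types (b : {mpoly k[n]}).

Lemma grad_is_additive : additive (@grad n).
Proof. by move=> b b'; apply/rowP=> i; rewrite !mxE mderivB. Qed.
HB.instance Definition _ := GRing.isAdditive.Build {mpoly k[n]}
  'rV[{mpoly k[n]}]_n (@grad n) grad_is_additive.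

Lemma gradM b b' : grad (b * b') = b *: grad b' + b' *: grad b.
Proof.
by apply/rowP=> i; rewrite !mxE mderivM addrC; congr (_ + _); rewrite mulrC.
Qed.

Lemma gradC (x : k) : grad (x%:MP : {mpoly k[n]}) = 0.
Proof. by apply/rowP=> i; rewrite !mxE mderivC. Qed.

Lemma gradX i : grad ('X_i : {mpoly k[n]}) = delta_mx 0 i.
Proof.
apply/rowP=> j; rewrite !mxE eqxx mderivX mnm1E eq_sym /=.
have [->|] := eqVneq; last by rewrite scale0r.
by rewrite -[X in (X - _)%MM]add0m addmK mpolyX0 scale1r.
Qed.

Lemma grad_comp m (t : m.-tuple {mpoly k[n]}) (a : {mpoly k[m]}) :
  grad (a \mPo t) = map_mx (comp_mpoly t) (grad a) *m jacobian t.
Proof.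
apply/rowP=> i; rewrite !mxE mderiv_comp; apply: eq_bigr => l _.
by rewrite !mxE.
Qed.

Lemma grad_lf c : grad (lf c) = map_mx (@mpolyC n k) c^T.
Proof.
rewrite /lf raddf_sum /=; apply/rowP=> i; rewrite summxE !mxE (bigD1 i) //=.
rewrite big1 => [|j ji]; rewrite -mul_mpolyC gradM gradC scaler0 addr0 gradX !mxE eqxx /=.
  by rewrite eqxx mulr1 addr0.
by rewrite eq_sym (negPf ji) mulr0.
Qed.

Lemma grad_mxact M b :
  grad (mxact M b) = map_mx (mxact M) (grad b) *m (map_mx (@mpolyC n k) M)^T.
Proof.
rewrite grad_comp; congr (_ *m _); apply/matrixP=> l i; rewrite !mxE tnth_mktuple.
rewrite raddf_sum (bigD1 i) //= big1 => [|j ji]; rewrite linearZ /= mderivX mnm1E.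
  rewrite eqxx -[X in (X - _)%MM]add0m addmK mpolyX0 scale1r addr0.
  by rewrite -mul_mpolyC mulr1.
by rewrite (negPf ji) scale0r scaler0.
Qed.

End Gradient.

Section RootsFactor.

Lemma prod_roots_factor (R : idomainType) (s : seq R) (P : {poly R}) :
  uniq s -> {in s, forall z, root P z} ->
  exists q, P = q * \prod_(z <- s) ('X - z%:P).
Proof.
elim: s P => [|z s IHs] P; first by exists P; rewrite big_nil mulr1.
rewrite cons_uniq => /andP[Nz Us] rP.
have /factor_theorem[P1 eqP1] : root P z by apply: rP; rewrite mem_head.
have [z' z's|q eqq] := IHs P1 Us; last first.
  by exists q; rewrite big_cons eqP1 eqq mulrC mulrCA.
have := rP z'; rewrite in_cons z's orbT eqP1 rootM root_XsubC => /(_ isT).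
by case/orP=> // /eqP zz'; rewrite -zz' z's in Nz.
Qed.

Lemma map_prod_XsubC (R : idomainType) (sigma : {rmorphism R -> R}) (s : seq R)
    (p p' : pred R) : perm_eq [seq sigma z | z <- s] s ->
  (forall z, p' (sigma z) = p z) ->
  map_poly sigma (\prod_(z <- s | p z) ('X - z%:P)) =
  \prod_(z <- s | p' z) ('X - z%:P).
Proof.
move=> ps pp'; rewrite rmorph_prod -[RHS](perm_big _ ps) big_map /=.
by apply: eq_big => // x _; rewrite rmorphB /= map_polyX map_polyC.
Qed.

End RootsFactor.

Section Lagrange.
Variables (B : idomainType) (gT : finGroupType) (G : {group gT}).
Variable act : gT -> {rmorphism B -> B}.
Hypothesis act1 : act 1%g =1 id.
Hypothesis actM : {in G &, forall g h b, act (g * h)%g b = act g (act h b)}.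

Lemma actK g : g \in G -> cancel (act g) (act g^-1%g).
Proof. by move=> gG b; rewrite -actM ?groupV // mulVg act1. Qed.

Lemma act_inj g : g \in G -> injective (act g).
Proof. by move=> gG; apply: can_inj (actK gG). Qed.

Variable y : B.

(** Duplicates are removed so that [orbit_poly] has simple roots, and [orbit_disc] is nonzero, even
    when y has a nontrivial stabilizer. *)
Definition orbit_seq : seq B := undup [seq act g y | g <- enum G].
Local Notation orb := orbit_seq.

Lemma orbitP z : reflect (exists2 g, g \in G & z = act g y) (z \in orb).
Proof.
rewrite mem_undup; apply: (iffP mapP) => -[g gG ->]; exists g => //.
  by rewrite -mem_enum.
by rewrite mem_enum.
Qed.

Lemma mem_orbit_seq : y \in orb.
Proof. by apply/orbitP; exists 1%g; rewrite ?group1 ?act1. Qed.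

Lemma orbit_act h : h \in G -> perm_eq [seq act h z | z <- orb] orb.
Proof.
move=> hG; apply: uniq_perm; rewrite ?undup_uniq //.
  by rewrite map_inj_uniq ?undup_uniq //; apply: act_inj.
move=> z; apply/mapP/orbitP => [[_ /orbitP[g gG ->] ->]|[g gG ->]].
  by exists (h * g)%g; rewrite ?groupM // actM.
exists (act (h^-1 * g)%g y); last by rewrite -actM ?groupM ?groupV // mulKVg.
by apply/orbitP; exists (h^-1 * g)%g; rewrite ?groupM ?groupV.
Qed.

Definition orbit_poly : {poly B} := \prod_(z <- orb) ('X - z%:P).
Definition orbit_poly_at x : {poly B} := \prod_(z <- orb | z != x) ('X - z%:P).
Definition orbit_disc : B := \prod_(z <- orb | z != y) (y - z).

(* Up to the order of the stabilizer, [lagrange b] interpolates the map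
   g y |-> (g b) chi'(g y), where chi is [orbit_poly]. *)
Definition lagrange b : {poly B} :=
  \sum_(g in G) (act g b)%:P * orbit_poly_at (act g y).

Definition stab_mult : nat := #|[set g in G | act g y == y]|.

Definition fixed_by_stab b : Prop := {in G, forall g, act g y = y -> act g b = b}.

Definition invariant_poly (P : {poly B}) : Prop :=
  {in G, forall g, map_poly (act g) P = P}.

Lemma orbit_poly_inv : invariant_poly orbit_poly.
Proof. by move=> g gG; apply: map_prod_XsubC; rewrite ?orbit_act. Qed.

Lemma lagrange_inv b : invariant_poly (lagrange b).
Proof.
move=> h hG; rewrite rmorph_sum /= [RHS](reindex_inj (mulgI h)) /=.
apply: eq_big => [g|g gG]; first by rewrite groupMl.
rewrite rmorphM /= map_polyC !actM //; congr (_ * _).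
apply: map_prod_XsubC => [|z]; first exact: orbit_act.
by rewrite (inj_eq (act_inj hG)).
Qed.

Lemma orbit_poly_at_eval x : (orbit_poly_at x).[x] = \prod_(z <- orb | z != x) (x - z).
Proof. by rewrite horner_prod; apply: eq_bigr => z _; rewrite !hornerE. Qed.

Lemma orbit_poly_at_root x z : z \in orb -> z != x -> (orbit_poly_at x).[z] = 0.
Proof.
move=> zo zx; rewrite horner_prod (big_rem z) //= zx !hornerE.
by rewrite subrr mul0r.
Qed.

Lemma orbit_poly_root z : z \in orb -> orbit_poly.[z] = 0.
Proof.
move=> zo; rewrite horner_prod (big_rem z) //= !hornerE.
by rewrite subrr mul0r.
Qed.

Lemma orbit_poly_deriv : orbit_poly^`().[y] = orbit_disc.
Proof.
have -> : orbit_poly = ('X - y%:P) * orbit_poly_at y.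
  rewrite /orbit_poly (bigID (fun z => z == y)) /=; congr (_ * _).
  rewrite -big_filter (_ : [seq _ <- _ | _] = [:: y]) ?big_seq1 //.
  exact: (filter_pred1_uniq (undup_uniq _) mem_orbit_seq).
by rewrite derivM derivXsubC mul1r !hornerE subrr mul0r addr0 orbit_poly_at_eval.
Qed.

(** At g0 y only the terms with g y = g0 y survive. They form a coset of the stabilizer of y, on
    which g b is constant. *)
Lemma lagrange_eval b g0 : fixed_by_stab b -> g0 \in G ->
  (lagrange b).[act g0 y] = act g0 b *
     ((orbit_poly_at (act g0 y)).[act g0 y] *+ #|[set g in G | act g y == act g0 y]|).
Proof.
move=> bD g0G; rewrite horner_sum.
rewrite (bigID (fun g => act g y == act g0 y)) /= [X in _ + X]big1 => [|g]; last first.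
  case/andP=> gG ne; rewrite hornerM orbit_poly_at_root ?mulr0 //.
    by apply/orbitP; exists g0.
  by rewrite eq_sym.
rewrite addr0 mulrnAr -sumr_const; apply: eq_big => [g|g]; first by rewrite inE.
case/andP=> gG /eqP eqg; rewrite hornerM hornerC eqg; congr (_ * _).
rewrite -[in LHS](mulKVg g0 g) actM ?groupM ?groupV //; congr (act g0 _).
by apply: bD; rewrite ?groupM ?groupV // actM ?groupV // eqg actK.
Qed.

Lemma lagrange_eval1 b : fixed_by_stab b ->
  (lagrange b).[y] = b * (orbit_disc *+ stab_mult).
Proof.
move=> bD; have := lagrange_eval bD (group1 G).
by rewrite !act1 orbit_poly_at_eval.
Qed.

Lemma fixed_by_stab1 : fixed_by_stab 1.
Proof. by move=> g gG _; rewrite rmorph1. Qed.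

Lemma fixed_by_stabM b b' :
  fixed_by_stab b -> fixed_by_stab b' -> fixed_by_stab (b * b').
Proof. by move=> bD b'D g gG gy; rewrite rmorphM /= bD ?b'D. Qed.

Lemma lagrangeM b b' : fixed_by_stab b -> fixed_by_stab b' ->
  exists2 q, invariant_poly q &
    lagrange b * lagrange b' = lagrange 1 * lagrange (b * b') + q * orbit_poly.
Proof.
move=> bD b'D.
have [|z /orbitP[g gG ->]|q eqq] := @prod_roots_factor _ orb
    (lagrange b * lagrange b' - lagrange 1 * lagrange (b * b')).
- exact: undup_uniq.
- have bb'D := fixed_by_stabM bD b'D.
  have eval1 := lagrange_eval fixed_by_stab1 gG; rewrite rmorph1 mul1r in eval1.
  rewrite rootE hornerD hornerN !hornerM eval1 !lagrange_eval // rmorphM /=.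
  move: (_ *+ _) (act g b) (act g b') => u x x'; apply/eqP; ring.
exists q; last by rewrite -[RHS]addrC -/orbit_poly -eqq subrK.
move=> g gG; apply: (@mulIf _ orbit_poly).
  by apply: monic_neq0; apply: monic_prod_XsubC.
rewrite -{1}(orbit_poly_inv gG) -rmorphM /= -/orbit_poly in eqq *.
by rewrite -eqq rmorphB !rmorphM /= !lagrange_inv.
Qed.

Lemma lagrange_invariant b : {in G, forall g, act g b = b} ->
  lagrange b = b%:P * lagrange 1.
Proof.
move=> bG; rewrite mulr_sumr; apply: eq_bigr => g gG.
by rewrite bG // rmorph1 mul1r.
Qed.

End Lagrange.

(** * Extension of a derivation along interpolation polynomials *)

Section DerivationExtension.
Variables (A : comNzRingType) (B : idomainType) (cf : {rmorphism A -> B}).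
Variables (m c : nat) (dl : 'I_m -> {additive A -> B}) (rho : 'M[B]_(c, m)).
Hypothesis dlM : forall l a b, dl l (a * b) = cf a * dl l b + cf b * dl l a.

Definition in_rows (w : 'rV[B]_m) : Prop := exists u : 'rV_c, w = u *m rho.

Lemma in_rowsD w w' : in_rows w -> in_rows w' -> in_rows (w + w').
Proof. by move=> [u ->] [u' ->]; exists (u + u'); rewrite mulmxDl. Qed.

Lemma in_rowsZ b w : in_rows w -> in_rows (b *: w).
Proof. by move=> [u ->]; exists (b *: u); rewrite scalemxAl. Qed.

Lemma in_rowsN w : in_rows w -> in_rows (- w).
Proof. by move=> H; rewrite -scaleN1r; apply: in_rowsZ. Qed.

Lemma in_rows0 : in_rows 0.
Proof. by exists 0; rewrite mul0mx. Qed.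

Lemma in_rows_sum (I : Type) (r : seq I) (P : pred I) (F : I -> 'rV[B]_m) :
  (forall i, P i -> in_rows (F i)) -> in_rows (\sum_(i <- r | P i) F i).
Proof. by move=> FP; apply: big_ind => //; [exact: in_rows0|exact: in_rowsD]. Qed.

Definition dvec a : 'rV[B]_m := \row_l dl l a.
Hypothesis rho_ker : forall a, cf a = 0 -> in_rows (dvec a).

Variables (gT : finGroupType) (G : {group gT}).
Variable act : gT -> {rmorphism B -> B}.
Hypothesis act1 : act 1%g =1 id.
Hypothesis actM : {in G &, forall g h b, act (g * h)%g b = act g (act h b)}.
Hypothesis lift : forall b, {in G, forall g, act g b = b} -> exists a, cf a = b.

Lemma lift_poly (P : {poly B}) : invariant_poly G act P ->
  exists Pt : {poly A}, map_poly cf Pt = P.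
Proof.
move=> PG.
have /fin_all_exists[a aP] (i : 'I_(size P)) : exists a, cf a = P`_i.
  by apply: lift => g gG; have := congr1 (fun Q : {poly B} => Q`_i) (PG g gG); rewrite coef_map.
exists (\poly_(i < size P) (if insub i is Some j then a j else 0)).
apply/polyP=> i; rewrite coef_map coef_poly; case: ltnP => [lt_i|le_i].
  by rewrite insubT /= aP.
by rewrite raddf0 nth_default.
Qed.

Variable y : B.
Local Notation disc := (orbit_disc G act y).
Local Notation lam := (lagrange G act y).
Local Notation chi := (orbit_poly G act y).

Definition pev (P : {poly A}) : B := (map_poly cf P).[y].
Definition pevd (P : {poly A}) : B := (map_poly cf P)^`().[y].
Definition pdvec (P : {poly A}) : 'rV[B]_m := \row_l (map_poly (dl l) P).[y].

Lemma map_dlM l (P Q : {poly A}) : map_poly (dl l) (P * Q) =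
  map_poly cf P * map_poly (dl l) Q + map_poly cf Q * map_poly (dl l) P.
Proof.
apply/polyP=> i; rewrite coefD coef_map coefM raddf_sum.
rewrite [(map_poly cf P * _)`_i]coefM [(map_poly cf Q * _)`_i]coefMr -big_split /=.
by apply: eq_bigr => j _; rewrite !coef_map dlM.
Qed.

Lemma pevdM P Q : pevd (P * Q) = pev P * pevd Q + pev Q * pevd P.
Proof. by rewrite /pevd rmorphM derivM hornerD !hornerM addrC mulrC [_ * pev Q]mulrC. Qed.

Lemma pdvecM P Q : pdvec (P * Q) = pev P *: pdvec Q + pev Q *: pdvec P.
Proof. by apply/rowP=> l; rewrite !mxE map_dlM hornerD !hornerM. Qed.

Variables (chiA lam1A : {poly A}).
Hypotheses (chiAE : map_poly cf chiA = chi) (lam1AE : map_poly cf lam1A = lam 1).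

(* The derivation on R[T], over evaluation at y, which extends the given one on
   R (up to the factor chi'(y)) and kills chi; here R is the image of A. *)
Definition ext (P : {poly A}) : 'rV[B]_m := disc *: pdvec P - pevd P *: pdvec chiA.

Lemma extD P Q : ext (P + Q) = ext P + ext Q.
Proof.
rewrite /ext; have -> : pdvec (P + Q) = pdvec P + pdvec Q.
  by apply/rowP=> l; rewrite !mxE raddfD hornerD.
have -> : pevd (P + Q) = pevd P + pevd Q.
  by rewrite /pevd raddfD derivD hornerD.
by rewrite scalerDl scalerDr opprD addrACA.
Qed.

Lemma extM P Q : ext (P * Q) = pev P *: ext Q + pev Q *: ext P.
Proof.
apply/rowP=> l; rewrite /ext pdvecM pevdM !mxE.
move: (pev P) (pev Q) (pevd P) (pevd Q) => a b a' b'.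
by move: (horner _ _) (horner _ _) (horner _ _) disc => *; ring.
Qed.

Lemma ext_chi : ext chiA = 0.
Proof. by rewrite /ext /pevd chiAE orbit_poly_deriv // subrr. Qed.

Lemma pev_chi : pev chiA = 0.
Proof. by rewrite /pev chiAE orbit_poly_root // mem_orbit_seq. Qed.

Lemma pdvec_ker P : map_poly cf P = 0 -> in_rows (pdvec P).
Proof.
move=> P0; have -> : pdvec P = \sum_(i < size P) y ^+ i *: dvec P`_i.
  apply/rowP=> l; rewrite summxE mxE (@horner_coef_wide _ (size P)).
    by apply: eq_bigr => i _; rewrite coef_map !mxE mulrC.
  exact: size_poly.
apply: in_rows_sum => i _; apply/in_rowsZ/rho_ker.
by rewrite -coef_map P0 coef0.
Qed.

(** Lifts of coefficients to A are determined only modulo the kernel of [cf]; this lemma measures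
    the ambiguity and is the reason for working modulo the rows of [rho]. *)
Lemma ext_ker P : map_poly cf P = 0 -> in_rows (ext P).
Proof.
move=> P0; rewrite /ext {1}/pevd P0 deriv0 horner0 scale0r subr0.
exact/in_rowsZ/pdvec_ker.
Qed.

(* [w] is a value at [b] of the extended derivation, computed on an interpolation
   polynomial of [b]; it is defined up to the rows of rho. *)
Definition ext_rel (b : B) (w : 'rV[B]_m) : Prop :=
  exists2 L, map_poly cf L = lam b &
    in_rows (w - (disc *+ stab_mult G act y) *: (ext L - b *: ext lam1A)).

Local Notation t1 := (disc *+ stab_mult G act y).
Local Notation fixed := (fixed_by_stab G act y).

Lemma extB P Q : ext (P - Q) = ext P - ext Q.
Proof. by apply/eqP; rewrite eq_sym subr_eq -extD subrK. Qed.

Lemma ext_rel_uniq b w w' : ext_rel b w -> ext_rel b w' -> in_rows (w - w').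
Proof.
move=> [L LE Lw] [L' L'E Lw'].
have LL' : in_rows (t1 *: ext (L - L')).
  by apply/in_rowsZ/ext_ker; rewrite raddfB /= LE L'E subrr.
have -> : w - w' = (w - t1 *: (ext L - b *: ext lam1A)) -
     (w' - t1 *: (ext L' - b *: ext lam1A)) + t1 *: ext (L - L').
  rewrite extB; apply/rowP=> l; rewrite !mxE; ring.
by apply: in_rowsD => //; apply: in_rowsD => //; apply: in_rowsN.
Qed.

Lemma ext_rel_exists b : exists w, ext_rel b w.
Proof.
have [L LE] := lift_poly (lagrange_inv act1 actM y b).
exists (t1 *: (ext L - b *: ext lam1A)), L => //.
by rewrite subrr; apply: in_rows0.
Qed.

Lemma ext_relD b b' w w' : ext_rel b w -> ext_rel b' w' -> ext_rel (b + b') (w + w').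
Proof.
move=> [L LE Lw] [L' L'E Lw']; exists (L + L').
  rewrite raddfD /= LE L'E /lagrange -big_split; apply: eq_bigr => g _ /=.
  by rewrite rmorphD rmorphD mulrDl.
rewrite extD.
have -> : w + w' - t1 *: (ext L + ext L' - (b + b') *: ext lam1A) =
  (w - t1 *: (ext L - b *: ext lam1A)) + (w' - t1 *: (ext L' - b' *: ext lam1A)).
  apply/rowP=> l; rewrite !mxE; ring.
exact: in_rowsD.
Qed.

Lemma pev_lift L b : fixed b -> map_poly cf L = lam b -> pev L = b * t1.
Proof. by move=> bD LE; rewrite /pev LE lagrange_eval1. Qed.

(** Leibniz rule: apply [ext] to the congruence of [lagrangeM]. The multiple of chi disappears
    because both [ext] and evaluation at y kill chi. *)
Lemma ext_relM b b' w w' : fixed b -> fixed b' ->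
  ext_rel b w -> ext_rel b' w' -> ext_rel (b * b') (b *: w' + b' *: w).
Proof.
move=> bD b'D [L LE Lw] [L' L'E Lw'].
have [L2 L2E] := lift_poly (lagrange_inv act1 actM y (b * b')).
have [q qinv eqq] := lagrangeM act1 actM bD b'D.
have [qA qAE] := lift_poly qinv.
exists L2 => //.
have: in_rows (ext (L * L' - (lam1A * L2 + qA * chiA))).
  apply: ext_ker; rewrite rmorphB rmorphD !rmorphM /= LE L'E lam1AE L2E qAE chiAE.
  by rewrite eqq subrr.
rewrite extB extD !extM ext_chi pev_chi (pev_lift bD LE) (pev_lift b'D L'E).
rewrite (pev_lift (fixed_by_stabM bD b'D) L2E).
rewrite (pev_lift (@fixed_by_stab1 _ _ G act y) lam1AE).
set H := (X in in_rows X); move=> HX.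
have -> : b *: w' + b' *: w - t1 *: (ext L2 - (b * b') *: ext lam1A) =
   b *: (w' - t1 *: (ext L' - b' *: ext lam1A)) +
   b' *: (w - t1 *: (ext L - b *: ext lam1A)) + H.
  rewrite /H; apply/rowP=> l; rewrite !mxE; ring.
by apply: in_rowsD => //; apply: in_rowsD; apply: in_rowsZ.
Qed.

(** The scalar is the denominator that [ext_rel] has cleared: b is the quotient of the values at y
    of [lam b] and [lam 1], the latter being [t1], so the quotient rule contributes [t1] twice, and
    [ext] contributes [disc]. *)
Lemma ext_rel_base a : {in G, forall g, act g (cf a) = cf a} ->
  ext_rel (cf a) ((t1 * t1 * disc) *: dvec a).
Proof.
move=> aG; have PA : map_poly cf (a%:P * lam1A) = lam (cf a).
  by rewrite rmorphM /= map_polyC lam1AE [RHS]lagrange_invariant.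
exists (a%:P * lam1A) => //.
rewrite extM (pev_lift (@fixed_by_stab1 _ _ G act y) lam1AE).
have -> : pev a%:P = cf a by rewrite /pev map_polyC hornerC.
have -> : ext a%:P = disc *: dvec a.
  rewrite /ext /pevd map_polyC derivC horner0 scale0r subr0.
  by congr (_ *: _); apply/rowP=> l; rewrite !mxE map_polyC hornerC.
set H := (X in in_rows X); suff -> : H = 0 by apply: in_rows0.
by rewrite /H; apply/rowP=> l; rewrite !mxE; ring.
Qed.

End DerivationExtension.

Section Action.
Variables (k : fieldType) (gT : finGroupType) (Wt : {group gT}) (n : nat).
Variable rV : mx_representation k Wt n.
Local Notation B := {mpoly k[n]}.

Definition act (g : gT) : {rmorphism B -> B} := mxact (rV g).

Lemma actE g b : act g b = mxact (rV g) b.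
Proof. by []. Qed.

Lemma act_id : act 1%g =1 id.
Proof. by move=> b; rewrite actE repr_mx1 mxact1. Qed.

Lemma act_mul : {in Wt &, forall g h b, act (g * h)%g b = act g (act h b)}.
Proof. by move=> g h gW hW b; rewrite !actE (repr_mxM rV gW hW); apply: mxactM. Qed.

Variable D : {group gT}.

Lemma invariantD (b b' : B) :
  invariant rV D b -> invariant rV D b' -> invariant rV D (b + b').
Proof. by move=> bD b'D g gD; rewrite rmorphD /= bD ?b'D. Qed.

Lemma invariantM (b b' : B) :
  invariant rV D b -> invariant rV D b' -> invariant rV D (b * b').
Proof. by move=> bD b'D g gD; rewrite rmorphM /= bD ?b'D. Qed.

Lemma invariantC x : invariant rV D (x%:MP : B).
Proof. by move=> g gD; rewrite mpolyC_mxact. Qed.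

Lemma invariantB (b b' : B) :
  invariant rV D b -> invariant rV D b' -> invariant rV D (b - b').
Proof. by move=> bD b'D g gD; rewrite rmorphB /= bD ?b'D. Qed.

Lemma invariant_comp m (t : m.-tuple B) (a : {mpoly k[m]}) :
  (forall l, invariant rV D (tnth t l)) -> invariant rV D (a \mPo t).
Proof.
move=> tD; elim/mpoly_alg_ind: a => [c|i|p q IHp IHq|p q IHp IHq].
- by rewrite comp_mpolyC; apply: invariantC.
- by rewrite comp_mpolyXt.
- by rewrite rmorphD; apply: invariantD.
by rewrite rmorphM; apply: invariantM.
Qed.

End Action.

Section KeyIdentity.
Variables (k : fieldType) (hk : [pchar k] =i pred0).
Variables (gT : finGroupType) (Wt G : {group gT}) (n : nat).
Variable rV : mx_representation k Wt n.
Hypothesis sGW : G \subset Wt.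
Local Notation B := {mpoly k[n]}.
Variables (m c : nat) (f : m.-tuple B) (r : c.-tuple {mpoly k[m]}).
Hypothesis f_inv : forall l, invariant rV G (tnth f l).
Hypothesis f_gen : forall b, invariant rV G b -> exists a, a \mPo f = b.
Hypothesis r_rel : forall j, tnth r j \mPo f = 0.
Hypothesis r_gen : forall a, a \mPo f = 0 ->
  exists u : 'I_c -> {mpoly k[m]}, a = \sum_(j < c) u j * tnth r j.

Definition relation_mx : 'M[B]_(c, m) := \matrix_(j, l) ((tnth r j)^`M(l) \mPo f).

Definition pull_deriv l : {additive {mpoly k[m]} -> B} := comp_mpoly f \o mderiv l.

Lemma pull_derivM l a b :
  pull_deriv l (a * b) = (a \mPo f) * pull_deriv l b + (b \mPo f) * pull_deriv l a.
Proof. by rewrite /= mderivM rmorphD !rmorphM /= addrC; congr (_ + _); rewrite mulrC. Qed.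

Lemma dvec_relation a : a \mPo f = 0 -> in_rows relation_mx (dvec pull_deriv a).
Proof.
move=> /r_gen[u ->]; exists (\row_j (u j \mPo f)); apply/rowP=> l.
rewrite !mxE raddf_sum; apply: eq_bigr => j _.
by rewrite pull_derivM r_rel mul0r addr0 !mxE.
Qed.

Variables (y : B) (N : nat) (t : N.-tuple B) (F : m.-tuple {mpoly k[N]}).
Hypothesis t_fixed : forall i, fixed_by_stab G (act rV) y (tnth t i).
Hypothesis fF : forall l, tnth f l = tnth F l \mPo t.

Definition partial_mx : 'M[B]_(m, N) := \matrix_(l, a) ((tnth F l)^`M(a) \mPo t).

Local Notation disc := (orbit_disc G (act rV) y).

(** The derivative of [tnth f l] is computed twice: as the image of a variable it is a multiple of
    the l-th unit vector, and by the chain rule it is a combination of the derivatives of the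
    entries of [t]. Both agree modulo the rows of [relation_mx]. The rows of [X] are, up to a
    scalar, the derivatives of the entries of [t]. *)
Lemma key_identity : exists X M,
  (disc ^+ 3)%:M = partial_mx *m X + M *m relation_mx.
Proof.
have actM : {in G &, forall g h b, act rV (g * h)%g b = act rV g (act rV h b)}.
  by move=> g h gG hG b; apply: act_mul; apply: (subsetP sGW).
have lift b : {in G, forall g, act rV g b = b} -> exists a, comp_mpoly f a = b.
  exact: f_gen.
have [chiA chiAE] := lift_poly lift (orbit_poly_inv (@act_id _ _ _ _ rV) actM y).
have [lamA lamAE] := lift_poly lift (lagrange_inv (@act_id _ _ _ _ rV) actM y 1).
pose E := ext_rel (comp_mpoly f) pull_deriv relation_mx G (act rV) y chiA lamA.
have /fin_all_exists[w Ew] a : exists w, E (tnth t a) w.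
  exact: (ext_rel_exists _ _ (@act_id _ _ _ _ rV) actM lift).
have EC x : E x%:MP 0.
  suff <- : (disc *+ stab_mult G (act rV) y * (disc *+ stab_mult G (act rV) y) * disc)
      *: dvec pull_deriv x%:MP = 0.
    rewrite -(comp_mpolyC x f).
    apply: (@ext_rel_base _ _ (comp_mpoly f) m c pull_deriv relation_mx pull_derivM
      gT G (act rV) (@act_id _ _ _ _ rV) actM y chiA lamA lamAE x%:MP) => g gG.
    by rewrite /= comp_mpolyC mpolyC_mxact.
  by apply/rowP=> l; rewrite !mxE /= mderivC comp_mpoly0 mulr0.
have EX l : E (tnth f l) ((disc *+ stab_mult G (act rV) y *
    (disc *+ stab_mult G (act rV) y) * disc) *: dvec pull_deriv 'X_l).
  rewrite -(comp_mpolyXt f l).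
  apply: (@ext_rel_base _ _ (comp_mpoly f) m c pull_deriv relation_mx pull_derivM
      gT G (act rV) (@act_id _ _ _ _ rV) actM y chiA lamA lamAE 'X_l) => g gG.
  by rewrite /= comp_mpolyXt; apply: f_inv.
have ED b b' v v' : E b v -> E b' v' -> E (b + b') (v + v').
  exact: ext_relD.
have EM b b' v v' : fixed_by_stab G (act rV) y b -> fixed_by_stab G (act rV) y b' ->
    E b v -> E b' v' -> E (b * b') (b *: v' + b' *: v).
  exact: (ext_relM pull_derivM dvec_relation (@act_id _ _ _ _ rV) actM lift chiAE lamAE).
have EU b v v' : E b v -> E b v' -> in_rows relation_mx (v - v').
  exact: (ext_rel_uniq dvec_relation).
(* From here on only additivity, the Leibniz rule, the values on constants and on [f], and
   uniqueness modulo the rows of [relation_mx] matter. *)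
clearbody E.
have chain p : E (p \mPo t) (\sum_a (p^`M(a) \mPo t) *: w a).
  elim/mpoly_alg_ind: p => [x|a|p q IHp IHq|p q IHp IHq].
  - rewrite comp_mpolyC big1 // => a _.
    by rewrite mderivC comp_mpoly0 scale0r.
  - rewrite comp_mpolyXt (bigD1 a) //= big1 => [|b ba].
      rewrite mderivX mnm1E eqxx -[X in (X - _)%MM]add0m addmK mpolyX0 scale1r.
      by rewrite comp_mpoly1 scale1r addr0.
    by rewrite mderivX mnm1E eq_sym (negPf ba) scale0r comp_mpoly0 scale0r.
  - rewrite rmorphD /=; under eq_bigr do rewrite mderivD rmorphD scalerDl /=.
    by rewrite big_split /=; apply: ED.
  have -> : \sum_a ((p * q)^`M(a) \mPo t) *: w a =
      (p \mPo t) *: (\sum_a (q^`M(a) \mPo t) *: w a) +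
      (q \mPo t) *: (\sum_a (p^`M(a) \mPo t) *: w a).
    rewrite !scaler_sumr -big_split; apply: eq_bigr => a _ /=.
    rewrite mderivM rmorphD scalerDl !scalerA addrC rmorphM; congr (_ + _ *: _).
    by rewrite rmorphM mulrC.
  rewrite rmorphM.
  have fx (a : {mpoly k[N]}) : fixed_by_stab G (act rV) y (a \mPo t).
    move=> g gG gy; elim/mpoly_alg_ind: a => [x|i|a b IHa IHb|a b IHa IHb].
    - by rewrite /= comp_mpolyC mpolyC_mxact.
    - by rewrite /= comp_mpolyXt; apply: t_fixed.
    - by rewrite !rmorphD IHa IHb.
    by rewrite !rmorphM IHa IHb.
  exact: (EM _ _ _ _ (fx p) (fx q) IHp IHq).
set s := stab_mult G (act rV) y in chain *.
have s0 : (s%:R : k) != 0.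
  rewrite /s; case Es: (stab_mult _ _ _) => [|j]; last exact: natr_neq0.
  have := cards0_eq Es => /setP/(_ 1%g); rewrite !inE group1 /=.
  by rewrite repr_mx1 mxact1 eqxx.
(* Characteristic 0 allows division by the square of the order of the stabilizer, leaving the pure
   cube of [disc]. *)
pose z : B := ((s%:R ^- 2 : k))%:MP.
have zs : z * ((disc *+ s) * (disc *+ s) * disc) = disc ^+ 3.
  have -> : (disc *+ s) * (disc *+ s) * disc = (s%:R ^+ 2 : k)%:MP * disc ^+ 3.
    rewrite rmorphXn /= rmorph_nat -!(mulr_natl disc).
    by move: (s%:R : B) => u; move: disc => v; ring.
  by rewrite mulrA -mpolyCM mulVf ?expf_neq0 // mul1r.
have chain' l : E (tnth f l) (\sum_a ((tnth F l)^`M(a) \mPo t) *: w a).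
  by rewrite fF; apply: chain.
have row_l l : exists u, disc ^+ 3 *: delta_mx 0 l =
      row l partial_mx *m \matrix_a (z *: w a) + u *m relation_mx.
  have [u Eu] := EU _ _ _ (EX l) (chain' l).
  exists (z *: u); rewrite -scalemxAl -Eu scalerBr scalerA zs mulmx_sum_row.
  have -> : dvec pull_deriv 'X_l = delta_mx 0 l.
    apply/rowP=> j; rewrite !mxE eqxx /= mderivX mnm1E eq_sym.
    have [->|_] := eqVneq; last by rewrite scale0r comp_mpoly0.
    by rewrite -[X in (X - _)%MM]add0m addmK mpolyX0 scale1r comp_mpoly1.
  have -> : \sum_a row l partial_mx 0 a *: row a (\matrix_b (z *: w b)) =
      z *: (\sum_a ((tnth F l)^`M(a) \mPo t) *: w a).
    by rewrite scaler_sumr; apply: eq_bigr => a _; rewrite rowK !mxE !scalerA mulrC.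
  by rewrite addrCA subrr addr0.
have /fin_all_exists[u uP] := row_l.
exists (\matrix_a (z *: w a)), (\matrix_l u l).
apply/row_matrixP=> l; rewrite [RHS]linearD /= !row_mul rowK -uP.
by rewrite rowE mul_mx_scalar.
Qed.

End KeyIdentity.

(** Two triangular factorizations of one block matrix are compared. *)
Lemma det_1_addMrank1 (R : comNzRingType) n (u : 'cV[R]_n) (v : 'rV[R]_n) :
  \det (1%:M + u *m v) = 1 + (v *m u) 0 0.
Proof.
have E1 : block_mx 1%:M v (- u) 1%:M =
   block_mx (1%:M : 'M_1) 0 (- u) 1%:M *m block_mx 1%:M v 0 (1%:M + u *m v).
  by rewrite mulmx_block !(mul1mx, mul0mx, mulmx1, mulmx0, addr0, add0r) mulNmx addrCA addNr addr0.
have E2 : block_mx 1%:M v (- u) 1%:M =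
   block_mx (1%:M : 'M_1) v 0 1%:M *m block_mx (1%:M + v *m u) 0 (- u) 1%:M.
  by rewrite mulmx_block !(mul1mx, mul0mx, mulmx1, mulmx0, addr0, add0r) mulmxN addrK.
have := congr1 determinant E1; rewrite E2 !det_mulmx !(det_ublock, det_lblock).
by rewrite !det1 !mul1r !mulr1 det_mx11 !mxE eqxx => <-.
Qed.

(** * Invariants and hyperplane stabilizers *)

Section Separation.
Variables (k : fieldType) (hk : [pchar k] =i pred0).
Variables (gT : finGroupType) (Wt : {group gT}) (n : nat).
Variable rV : mx_representation k Wt n.
Local Notation B := {mpoly k[n]}.
Implicit Types (D E : {group gT}) (U : 'M[k]_n).

Definition orbit_prod D (b : B) : B := \prod_(h in D) mxact (rV h) b.

Lemma orbit_prod_inv D b : D \subset Wt -> invariant rV D (orbit_prod D b).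
Proof.
move=> sDW g gD; rewrite rmorph_prod [RHS](reindex_inj (mulgI g)) /=.
apply: eq_big => [h|h hD]; first by rewrite groupMl.
exact: (esym (act_mul rV (subsetP sDW _ gD) (subsetP sDW _ hD) b)).
Qed.

Lemma orbit_prod_eval D b (v : 'rV[k]_n) :
  (orbit_prod D b).@[v 0] = \prod_(h in D) b.@[(v *m rV h) 0].
Proof. by rewrite rmorph_prod; apply: eq_bigr => h _; rewrite /= mxact_eval. Qed.

(* Invariants separate orbits: if w v and the points g v all differ, then
   prod_h (h l - l (v w)) vanishes at v w and not at v, for a generic form l. *)
Lemma invariants_separate D U w : D \subset Wt -> w \in Wt ->
  (forall b, invariant rV D b -> forall v : 'rV_n, (v <= U)%MS ->
     b.@[(v *m rV w) 0] = b.@[v 0]) ->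
  exists2 g, g \in D & U *m rV w = U *m rV g.
Proof.
move=> sDW wW sep; apply/exists_eq_inP; apply: contraT => /exists_inPn Nex.
have [i|x xP] := @avoid_row k hk n {g | g \in D} (fun=> n)
    (fun i => U *m (rV w - rV (val i))).
  by rewrite mulmxBr subr_eq0; apply: Nex (valP i).
pose v := x *m U.
have [i|l lP] := @avoid_col k hk n {g | g \in D} (fun=> 1%N)
    (fun i => v *m rV (val i) - v *m rV w).
  have := xP i; apply: contraNneq; rewrite mulmxA mulmxBr => /subr0_eq ->.
  by rewrite subrr.
pose b0 : B := lf l - ((v *m rV w *m l) 0 0)%:MP.
have b0E (u : 'rV[k]_n) : b0.@[u 0] = (u *m l) 0 0 - (v *m rV w *m l) 0 0.
  by rewrite mevalB mevalC lf_eval.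
have := sep _ (orbit_prod_inv b0 sDW) v (submxMl _ _).
rewrite !orbit_prod_eval (bigD1 1%g) //= b0E repr_mx1 mulmx1 subrr mul0r.
move/esym/eqP/prodf_eq0 => [h hD]; rewrite b0E => /eqP b00.
have /negP[] := lP (exist _ h hD); rewrite mulmxBl subr_eq0 /=; apply/eqP.
apply/matrixP=> i j; rewrite !ord1; exact: subr0_eq b00.
Qed.

Lemma rstabP U g : reflect (g \in Wt /\ U *m rV g = U) (g \in rstab rV U).
Proof. by rewrite inE; apply: (iffP andP) => -[gW /eqP]. Qed.

Lemma rstab_sub_Wt U : rstab rV U \subset Wt.
Proof. by apply/subsetP=> g /rstabP[]. Qed.

(** v is a point of U moved by every element of G outside E, and y is the product of the
    E-conjugates of an affine form vanishing at v. Its conjugates by elements outside E do not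
    vanish at v, which gives both the stabilizer of y and the value of the discriminant. *)
Lemma generic_point (G : {group gT}) U : G \subset Wt ->
  exists (v : 'rV[k]_n) (y : B), let E := (G :&: rstab rV U)%G in
  [/\ (v <= U)%MS, invariant rV E y,
      {in G, forall g, mxact (rV g) y = y -> g \in E} &
      (orbit_disc G (act rV) y).@[v 0] != 0].
Proof.
move=> sGW; set E := (G :&: rstab rV U)%G.
have sEW : E \subset Wt by apply: subset_trans sGW; apply: subsetIl.
have [i|x xP] := @avoid_row k hk n {g | g \in G :\: E} (fun=> n)
    (fun i => U *m (rV (val i) - 1%:M)).
  rewrite mulmxBr mulmx1 subr_eq0; have := valP i; rewrite !inE => /andP[].
  by move=> /[swap] gG; rewrite gG (subsetP sGW).
pose v := x *m U.
have vE g : g \in E -> v *m rV g = v.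
  by case/setIP=> _ /rstabP[_ Ug]; rewrite /v -mulmxA Ug.
have [i|l lP] := @avoid_col k hk n {g | g \in G :\: E} (fun=> 1%N)
    (fun i => v *m rV (val i) - v).
  by have := xP i; rewrite mulmxA mulmxBr mulmx1.
pose b0 : B := lf l - ((v *m l) 0 0)%:MP.
have b0E (u : 'rV[k]_n) : b0.@[u 0] = (u *m l) 0 0 - (v *m l) 0 0.
  by rewrite mevalB mevalC lf_eval.
pose y := orbit_prod E b0.
have yv : y.@[v 0] = 0.
  by rewrite orbit_prod_eval (bigD1 1%g) //= b0E repr_mx1 mulmx1 subrr mul0r.
have yvg g : g \in G -> g \notin E -> (mxact (rV g) y).@[v 0] != 0.
  move=> gG NgE; rewrite mxact_eval orbit_prod_eval; apply/prodf_neq0 => h hE.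
  have ghGE : (g * h)%g \in G :\: E.
    by rewrite inE groupMr // NgE groupM //; case/setIP: hE.
  rewrite b0E -(mulmxA v) -repr_mxM ?(subsetP sGW _ gG) ?(subsetP sEW) //.
  have := lP (exist (fun x => x \in G :\: E) (g * h)%g ghGE).
  rewrite mulmxBl; apply: contraNneq => /subr0_eq E0.
  by rewrite subr_eq0; apply/eqP/matrixP=> i j; rewrite !ord1.
exists v, y; split; first exact: submxMl.
- exact: orbit_prod_inv.
- move=> g gG gy; apply: contraT => NgE; have := yvg _ gG NgE.
  by rewrite gy yv eqxx.
rewrite rmorph_prod prodf_seq_neq0; apply/allP => _ /orbitP[g gG ->].
apply/implyP=> ne.
rewrite /= mevalB yv sub0r oppr_eq0; apply: yvg => //.
apply: contra ne => gE; apply/eqP; have /= := orbit_prod_inv b0 sEW gE.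
by [].
Qed.

End Separation.

Lemma mderiv_exp (R : comNzRingType) n (p : {mpoly R[n]}) j i :
  (p ^+ j.+1)^`M(i) = (p ^+ j *+ j.+1) * p^`M(i).
Proof.
elim: j => [|j IHj]; first by rewrite expr1 expr0 mul1r.
rewrite exprS mderivM IHj [in RHS]mulrS mulrDl mulrC mulrA mulrnAr -exprS.
by rewrite [_ * p^`M(i)]mulrC.
Qed.

Section HyperplaneStabilizer.
Variables (k : fieldType) (hk : [pchar k] =i pred0).
Variables (gT : finGroupType) (Wt : {group gT}) (n : nat).
Variable rV : mx_representation k Wt n.
Hypothesis rV_faithful : mx_faithful rV.

Lemma repr_inj g h : g \in Wt -> h \in Wt -> rV g = rV h -> g = h.
Proof. by move=> gW hW /(mx_faithful_inj rV_faithful gW hW). Qed.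

(** The j-th power of g is 1 + j ab; in characteristic 0 finite order forces ab = 0. *)
Lemma unipotent_rank1 (a : 'cV[k]_n) (b : 'rV[k]_n) g : g \in Wt ->
  rV g = 1%:M + a *m b -> b *m a = 0 -> g = 1%g.
Proof.
move=> gW gE ba; apply: repr_inj; rewrite // repr_mx1 gE.
have gX j : rV (g ^+ j)%g = 1%:M + (a *m b) *+ j.
  elim: j => [|j IHj]; first by rewrite repr_mx1 mulr0n addr0.
  rewrite expgS repr_mxM ?groupX // IHj gE mulmxDl mul1mx mulmxDr mulmx1.
  rewrite -scaler_nat -scalemxAr mulmxA -(mulmxA a) ba mulmx0 mul0mx scaler0 addr0.
  by rewrite mulrS scaler_nat -addrA [a *m b + _]addrC.
have := gX #[g]%g; rewrite expg_order repr_mx1 -[LHS]addr0 => /addrI/esym/eqP.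
rewrite -scaler_nat scaler_eq0 -(prednK (order_gt0 g)) (negPf (natr_neq0 hk _)) /=.
by move=> /eqP ->; rewrite addr0.
Qed.

Variables (a : 'cV[k]_n) (E : {group gT}).
Hypothesis a0 : a != 0.
Hypothesis sEW : E \subset Wt.
Hypothesis E_fix : {in E, forall g (v : 'rV_n), v *m a = 0 -> v *m rV g = v}.

Lemma rank1_of_fix (K : 'rV[k]_n) g : K *m a = 1%:M -> g \in E ->
  rV g = 1%:M + a *m (K *m (rV g - 1%:M)).
Proof.
move=> Ka gE; apply/eqP; rewrite addrC -subr_eq mulmxA -subr_eq0.
rewrite -[X in X - _]mul1mx -mulmxBl mulmxBr mulmx1 subr_eq0; apply/eqP.
apply/row_matrixP=> i; rewrite row_mul E_fix //.
by rewrite -row_mul mulmxBl mul1mx -mulmxA Ka mulmx1 subrr row0.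
Qed.

(** Each g in E is 1 + a b(g), and g |-> 1 + b(g) a is a character, injective by [unipotent_rank1].
    Hence E is commutative; comparing b(gh) with b(hg) makes all the rows b(g) proportional, and any
    nontrivial g0 supplies the common row [K]. *)
Lemma hyperplane_stab_structure : exists (K : 'rV[k]_n) (zeta : gT -> k),
  K *m a = 1%:M /\ {in E, forall g, rV g = 1%:M + (zeta g - 1) *: (a *m K)}.
Proof.
have [K0 K0a] := col_left_inv a0.
pose b g := K0 *m (rV g - 1%:M); pose beta g := (b g *m a) 0 0.
have bE g : g \in E -> rV g = 1%:M + a *m b g by move=> gE; apply: rank1_of_fix.
have baE g : b g *m a = (beta g)%:M by rewrite /beta -mx11_scalar.
have bM : {in E &, forall g h, b (g * h)%g = b g + b h + beta g *: b h}.
  move=> g h gE hE; rewrite {1}/b.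
  have -> : rV (g * h)%g = 1%:M + a *m (b g + b h + beta g *: b h).
    rewrite repr_mxM ?(subsetP sEW) // (bE g) // (bE h) //.
    rewrite mulmxDl mul1mx (mulmxDr (a *m b g)) mulmx1 mulmxA -(mulmxA a (b g)) baE.
    rewrite mul_mx_scalar -scalemxAl !(mulmxDr a) -scalemxAr !addrA; congr (_ + _).
    by rewrite -!addrA [a *m b h + _]addrC.
  by rewrite addrAC subrr add0r mulmxA K0a mul1mx.
have betaM : {in E &, forall g h, 1 + beta (g * h)%g = (1 + beta g) * (1 + beta h)}.
  move=> g h gE hE; rewrite /beta bM // !mulmxDl -scalemxAl !baE !mxE eqxx /= !mulr1n.
  ring.
have beta1 : beta 1%g = 0.
  by rewrite /beta /b repr_mx1 subrr mulmx0 mul0mx mxE.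
have betaV g : g \in E -> (1 + beta g) * (1 + beta g^-1%g) = 1.
  by move=> gE; rewrite -betaM ?groupV // mulgV beta1 addr0.
have inj g : g \in E -> beta g = 0 -> g = 1%g.
  move=> gE g0; apply: (unipotent_rank1 (subsetP sEW _ gE) (bE _ gE)).
  by rewrite baE g0 raddf0.
have comm : {in E &, forall g h, (g * h = h * g)%g}.
  move=> g h gE hE; apply: (mulIg (h * g)^-1%g); rewrite mulgV; apply: inj.
    by rewrite !(groupM, groupV).
  apply: (addrI 1); rewrite addr0 betaM ?(groupM, groupV) // betaM // mulrC.
  by rewrite [(1 + beta g) * _]mulrC -betaM // mulrC betaV ?groupM.
have prop : {in E &, forall g h, beta g *: b h = beta h *: b g}.
  move=> g h gE hE; have := congr1 b (comm g h gE hE); rewrite !bM //.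
  by rewrite [b h + b g]addrC => /addrI.
have [[g0 g0E ne]|all0] : (exists2 g, g \in E & beta g != 0) \/ {in E, forall g, beta g = 0}.
  have [/existsP[g /andP[gE g0]]|/existsPn H] := boolP [exists g, (g \in E) && (beta g != 0)].
    by left; exists g.
  by right=> g gE; have := H g; rewrite gE negbK => /eqP.
- exists ((beta g0)^-1 *: b g0), (fun g => 1 + beta g); split.
    by rewrite -scalemxAl baE scale_scalar_mx mulVf.
  move=> g gE; rewrite addrAC subrr add0r {1}bE // -!scalemxAr scalerA.
  by rewrite mulrC -scalerA (scalemxAr (beta g)) prop // -scalemxAr scalerA mulVf // scale1r.
exists K0, (fun=> 1); split=> // g gE.
by rewrite subrr scale0r addr0 (inj g) ?repr_mx1 ?all0.
Qed.

Variables (K : 'rV[k]_n) (zeta : gT -> k).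
Hypothesis Ka : K *m a = 1%:M.
Hypothesis rVE : {in E, forall g, rV g = 1%:M + (zeta g - 1) *: (a *m K)}.

Lemma zeta_det g : g \in E -> \det (rV g) = zeta g.
Proof.
move=> gE; rewrite rVE // scalemxAr det_1_addMrank1 -scalemxAl Ka !mxE mulr1.
by rewrite addrC subrK.
Qed.

Lemma zetaM : {in E &, {morph zeta : g h / (g * h)%g >-> g * h}}.
Proof.
by move=> g h gE hE; rewrite -!zeta_det ?groupM // repr_mxM ?(subsetP sEW) ?det_mulmx.
Qed.

Lemma zetaX g j : g \in E -> zeta (g ^+ j)%g = zeta g ^+ j.
Proof.
move=> gE; elim: j => [|j IHj].
  by rewrite expr0 -zeta_det ?group1 // repr_mx1 det1.
by rewrite expgS zetaM ?groupX // IHj exprS.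
Qed.

Lemma zeta_inj g : g \in E -> (zeta g == 1) = (g == 1%g).
Proof.
move=> gE; apply/eqP/eqP=> [z1|->]; last by rewrite -zeta_det ?group1 // repr_mx1 det1.
apply: repr_inj; rewrite ?group1 ?(subsetP sEW) //.
by rewrite repr_mx1 rVE // z1 subrr scale0r addr0.
Qed.

Lemma hyperplane_stab_cyclic (D : {group gT}) : D \subset E -> cyclic D.
Proof.
move=> sDE; have inD := subsetP sDE.
apply: (@field_mul_group_cyclic gT D k zeta) => [g h gD hD|g gD].
  by apply: zetaM; apply: inD.
by split=> [/eqP|->]; [rewrite zeta_inj ?inD // => /eqP | apply/eqP; rewrite zeta_inj ?group1].
Qed.

Variable i0 : 'I_n.
Hypothesis ai0 : a i0 0 != 0.

(** The columns are linear coordinates diagonalizing E: [a] itself at [i0], and elsewhere forms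
    killed by [K], which E fixes. They form a basis because [a i0 0] is nonzero. *)
Definition adapted_basis : 'M[k]_n :=
  \matrix_(i, j) if j == i0 then a i 0 else (i == j)%:R - a i 0 * K 0 j.
Local Notation Q := adapted_basis.

Definition adapted_basis_inv : 'M[k]_n :=
  \matrix_(i, j) if i == i0 then K 0 j else (i == j)%:R - a i 0 / a i0 0 * (i0 == j)%:R.

Lemma col_adapted_i0 : col i0 Q = a.
Proof. by apply/colP=> i; rewrite !mxE eqxx. Qed.

Lemma col_adapted j : j != i0 -> col j Q = delta_mx j 0 - K 0 j *: a.
Proof.
by move=> ne; apply/colP=> i; rewrite !mxE (negPf ne) eqxx andbT mulrC.
Qed.

Lemma K_col j : j != i0 -> K *m col j Q = 0.
Proof.
move=> ne; rewrite col_adapted // mulmxBr -scalemxAr Ka -colE.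
by apply/matrixP=> i i'; rewrite !ord1 !mxE eqxx mulr1 subrr.
Qed.

Lemma row_adapted_inv_i0 : row i0 adapted_basis_inv = K.
Proof. by apply/rowP=> j; rewrite !mxE eqxx. Qed.

Lemma row_adapted_inv i : i != i0 -> row i adapted_basis_inv =
  delta_mx 0 i - (a i 0 / a i0 0) *: delta_mx 0 i0.
Proof.
by move=> ne; apply/rowP=> j; rewrite !mxE (negPf ne) !eqxx /= ![_ == j]eq_sym.
Qed.

Lemma adapted_basisK : adapted_basis_inv *m Q = 1%:M.
Proof.
apply/matrixP=> i j.
have -> : (adapted_basis_inv *m Q) i j = (row i adapted_basis_inv *m col j Q) 0 0.
  by rewrite -row_mul !mxE; apply: eq_bigr => l _; rewrite !mxE.
have [->|ni] := eqVneq i i0; have [->|nj] := eqVneq j i0.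
- by rewrite row_adapted_inv_i0 col_adapted_i0 Ka !mxE !eqxx.
- by rewrite row_adapted_inv_i0 K_col // !mxE eq_sym (negPf nj).
- rewrite row_adapted_inv // col_adapted_i0 mulmxBl -scalemxAl -!rowE !mxE (negPf ni).
  by rewrite divfK // subrr.
rewrite row_adapted_inv // mulmxBl -scalemxAl -!rowE !mxE (negPf nj).
rewrite [i0 == j]eq_sym (negPf nj) sub0r mulrN opprK mulrA divfK //.
by rewrite subrK.
Qed.

Definition semi_diag (x : k) : 'M[k]_n :=
  diag_mx (\row_i if i == i0 then x else 1).

Lemma repr_adapted g : g \in E -> rV g *m Q = Q *m semi_diag (zeta g).
Proof.
move=> gE; apply/matrixP=> i j; rewrite mul_mx_diag [RHS]mxE.
have -> : (rV g *m Q) i j = (rV g *m col j Q) i 0.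
  by rewrite [in RHS]colE mulmxA -colE [RHS]mxE.
rewrite rVE // mulmxDl mul1mx -scalemxAl -mulmxA.
have [->|nj] := eqVneq j i0.
  by rewrite col_adapted_i0 Ka mulmx1 !mxE !eqxx; ring.
by rewrite K_col // mulmx0 scaler0 addr0 !mxE (negPf nj) mulr1.
Qed.

Variable D : {group gT}.
Hypothesis sDE : D \subset E.
Local Notation e := #|D|.

Definition adapted_invariants : n.-tuple {mpoly k[n]} :=
  [tuple lf (col i Q) ^+ (if i == i0 then e else 1%N) | i < n].

Lemma act_lf_adapted g i : g \in E ->
  mxact (rV g) (lf (col i Q)) = (if i == i0 then zeta g else 1) *: lf (col i Q).
Proof.
move=> gE; rewrite mxact_lf -linearZ; congr lf.
rewrite [in LHS]colE mulmxA repr_adapted // -mulmxA -colE; apply/colP=> j.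
rewrite mxE (bigD1 i) //= big1 => [|l li]; rewrite !mxE ?eqxx ?(negPf li) ?mulr0n ?mulr0 //.
by rewrite mulr1n addr0 mulrC.
Qed.

Lemma act_adapted_invariants g i : g \in E ->
  mxact (rV g) (tnth adapted_invariants i) =
  (if i == i0 then zeta g ^+ e else 1) *: tnth adapted_invariants i.
Proof.
move=> gE; rewrite tnth_mktuple rmorphXn /= act_lf_adapted // exprZn.
by case: eqP => // _; rewrite expr1n.
Qed.

Lemma zeta_card g : g \in D -> zeta g ^+ e = 1.
Proof.
move=> gD; rewrite -zetaX ?(subsetP sDE) //.
apply/eqP; rewrite zeta_inj ?groupX ?(subsetP sDE) //.
by rewrite -order_dvdn order_dvdG.
Qed.

Lemma adapted_invariants_inv i : invariant rV D (tnth adapted_invariants i).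
Proof.
move=> g gD; rewrite act_adapted_invariants ?(subsetP sDE) // zeta_card //.
by rewrite if_same scale1r.
Qed.

Lemma mxact_diagX (l : 'rV[k]_n) mon :
  mxact (diag_mx l) 'X_[mon] = (\prod_i l 0 i ^+ mon i) *: 'X_[mon].
Proof.
rewrite [in LHS]mpolyXE_id rmorph_prod [in RHS]mpolyXE_id -scaler_prod.
apply: eq_bigr => i _ /=; rewrite rmorphXn /= mxactX -exprZn; congr (_ ^+ _).
rewrite /lf (bigD1 i) //= big1 => [|j ji]; rewrite !mxE ?eqxx ?mulr1n ?addr0 //.
by rewrite (negPf ji) mulr0n scale0r.
Qed.

Lemma semi_diagX x mon : mxact (semi_diag x) 'X_[mon] = x ^+ mon i0 *: 'X_[mon].
Proof.
rewrite mxact_diagX; congr (_ *: _); rewrite (bigD1 i0) //= big1 ?mulr1.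
  by rewrite mxE eqxx.
by move=> i ni; rewrite mxE (negPf ni) expr1n.
Qed.

Lemma mcoeff_semi_diag x b mon : (mxact (semi_diag x) b)@_mon = b@_mon * x ^+ mon i0.
Proof.
rewrite [in LHS](mpolyE b) rmorph_sum raddf_sum [in RHS](mpolyE b) raddf_sum /=.
rewrite mulr_suml; apply: eq_bigr => l _; rewrite linearZ /= semi_diagX !mcoeffZ mcoeffX.
have [->|_] := eqVneq l mon; last by rewrite !(mulr0, mul0r).
by rewrite !mulr1.
Qed.

(* In the adapted coordinates, D-invariance means that the exponent of the
   i0-th variable is a multiple of the order of D. *)
Lemma adapted_invariants_gen b : invariant rV D b ->
  exists F, b = F \mPo adapted_invariants.
Proof.
move=> bD; pose b' := mxact adapted_basis_inv b.
have QV : Q *m adapted_basis_inv = 1%:M by apply/mulmx1C/adapted_basisK.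
have bE : b = mxact Q b' by rewrite -mxactM QV mxact1.
have [g gD genD] : exists2 g, g \in D & <[g]>%g = D.
  have /cyclicP[g Dg] := hyperplane_stab_cyclic sDE.
  by exists g => //; rewrite Dg cycle_id.
have gE := subsetP sDE _ gD.
have b'g : mxact (semi_diag (zeta g)) b' = b'.
  apply: (can_inj (g := mxact adapted_basis_inv) (f := mxact Q)) => [c|].
    by rewrite -mxactM adapted_basisK mxact1.
  by rewrite -mxactM -repr_adapted // mxactM -bE bD.
have ord_g : #[g]%g = e by rewrite /order genD.
have dvd_e mon : mon \in msupp b' -> (e %| mon i0)%N.
  rewrite mcoeff_msupp => mon0; have := congr1 (mcoeff mon) b'g.
  rewrite mcoeff_semi_diag -[RHS]mulr1 => /(mulfI mon0)/eqP.
  by rewrite -zetaX // zeta_inj ?groupX // -order_dvdn ord_g.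
pose sh (mon : 'X_{1..n}) : 'X_{1..n} :=
  [multinom if i == i0 then (mon i %/ e)%N else mon i | i < n].
exists (\sum_(mon <- msupp b') b'@_mon *: 'X_[sh mon]).
rewrite {1}bE {1}(mpolyE b') !raddf_sum /= big_seq [RHS]big_seq.
apply: eq_bigr => mon mon_b'; rewrite !linearZ /=; congr (_ *: _).
rewrite comp_mpolyX mpolyXE_id rmorph_prod; apply: eq_bigr => i _.
rewrite /= rmorphXn /= mxactX tnth_mktuple -exprM mnmE.
have [->|_] := eqVneq i i0; last by rewrite mul1n.
by rewrite mulnC divnK // dvd_e.
Qed.

(** Up to an invertible constant matrix the Jacobian is diagonal, with the single nonconstant entry
    e a^(e-1), nonzero in characteristic 0. *)
Lemma jacobian_adapted_inj p (w : 'M[{mpoly k[n]}]_(p, n)) :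
  w *m jacobian adapted_invariants = 0 -> w = 0.
Proof.
have -> : jacobian adapted_invariants =
   diag_mx (\row_i if i == i0 then lf a ^+ e.-1 *+ e else 1) *m
     (map_mx (@mpolyC n k) Q)^T.
  apply/matrixP=> l i; rewrite mul_diag_mx !mxE tnth_mktuple.
  have gradE c : (lf c)^`M(i) = (c i 0)%:MP.
    by have := congr1 (fun v : 'rV__ => v 0 i) (grad_lf c); rewrite !mxE.
  have [->|nl] := eqVneq l i0; last by rewrite expr1 gradE mxE !mxE (negPf nl) mul1r.
  have e1 : e = e.-1.+1 by rewrite (prednK (cardG_gt0 D)).
  by rewrite [in LHS]e1 mderiv_exp gradE -e1 col_adapted_i0.
rewrite mulmxA => H.
have QQ : (map_mx (@mpolyC n k) Q)^T *m (map_mx (@mpolyC n k) adapted_basis_inv)^T = 1%:M.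
  by rewrite -trmx_mul -map_mxM adapted_basisK map_mx1 trmx1.
have := congr1 (mulmxr (map_mx (@mpolyC n k) adapted_basis_inv)^T) H.
rewrite /= mul0mx -mulmxA QQ mulmx1 => H'.
apply/matrixP=> i j; have := congr1 (fun A : 'M__ => A i j) H'.
rewrite /= mul_mx_diag !mxE => /eqP; rewrite mulf_eq0 => /orP[/eqP //|].
case: (j == i0); last by rewrite oner_eq0.
rewrite -mulr_natl mulf_eq0 expf_eq0 lf_eq0 (negPf a0) andbF orbF.
by rewrite -mpolyC_nat mpolyC_eq0 -(prednK (cardG_gt0 D)) (negPf (natr_neq0 hk _)).
Qed.

End HyperplaneStabilizer.

(** * Exactness of the sequence of differentials *)

Definition mx_at (k : fieldType) n p q (v : 'rV[k]_n) (A : 'M[{mpoly k[n]}]_(p, q)) :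
  'M[k]_(p, q) := map_mx (meval (v 0)) A.

Section Exactness.
Variables (k : fieldType) (hk : [pchar k] =i pred0).
Variables (gT : finGroupType) (Wt G : {group gT}) (n : nat).
Variable rV : mx_representation k Wt n.
Hypothesis rV_faithful : mx_faithful rV.
Hypothesis sGW : G \subset Wt.
Local Notation B := {mpoly k[n]}.
Variables (m c : nat) (f : m.-tuple B) (r : c.-tuple {mpoly k[m]}).
Hypothesis f_inv : forall l, invariant rV G (tnth f l).
Hypothesis f_gen : forall b, invariant rV G b -> exists a, a \mPo f = b.
Hypothesis r_rel : forall j, tnth r j \mPo f = 0.
Hypothesis r_gen : forall a, a \mPo f = 0 ->
  exists u : 'I_c -> {mpoly k[m]}, a = \sum_(j < c) u j * tnth r j.
Hypothesis cnm : (c + n = m)%N.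

Local Notation rho := (relation_mx f r).

Lemma jacobian_partial N (t : N.-tuple B) (F : m.-tuple {mpoly k[N]}) :
  (forall l, tnth f l = tnth F l \mPo t) ->
  jacobian f = partial_mx t F *m jacobian t.
Proof.
move=> fF; apply/matrixP=> l i; rewrite !mxE fF mderiv_comp.
by apply: eq_bigr => j _; rewrite !mxE.
Qed.

Lemma relation_jacobian : rho *m jacobian f = 0.
Proof.
apply/matrixP=> j i; rewrite !mxE.
transitivity ((tnth r j \mPo f)^`M(i)); last by rewrite r_rel mderiv0.
by rewrite mderiv_comp; apply: eq_bigr => l _; rewrite !mxE.
Qed.

Lemma key_rank p q (P : 'M[B]_(m, p)) X (M : 'M[B]_(m, c)) (v : 'rV[k]_n) :
  q%:M = P *m X + M *m rho -> q.@[v 0] != 0 ->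
  (m <= \rank (mx_at v P) + \rank (mx_at v rho))%N.
Proof.
move=> eqq qv; have := congr1 (mx_at v) eqq.
rewrite /mx_at map_scalar_mx /= map_mxD !map_mxM /= => eqv.
have rk : \rank ((q.@[v 0])%:M : 'M[k]_m) = m.
  by rewrite -scalemx1 mxrank_scale_nz // mxrank1.
rewrite -[X in (X <= _)%N]rk eqv; apply: leq_trans (mxrank_add _ _) _; apply: leq_add.
  exact: mxrankM_maxl.
exact: mxrankM_maxr.
Qed.

(** This is [key_identity] for the y of [generic_point] on the hyperplane: its stabilizer in G is
    [G :&: E], so the basic invariants of that group are admissible as [t], and [f] is polynomial in
    them. *)
Lemma adapted_key (a : 'cV[k]_n) (K : 'rV[k]_n) zeta i0 (E : {group gT}) :
    a != 0 -> K *m a = 1%:M -> a i0 0 != 0 -> E \subset Wt ->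
    {in E, forall g, rV g = 1%:M + (zeta g - 1) *: (a *m K)} ->
    (forall g, (g \in E) = (g \in rstab rV (kermx a))) ->
  let t := adapted_invariants a K i0 (G :&: E)%G in
  exists (v : 'rV[k]_n) (F : m.-tuple {mpoly k[n]}) q X M,
    [/\ v *m a = 0, forall l, tnth f l = tnth F l \mPo t, q.@[v 0] != 0 &
        q%:M = partial_mx t F *m X + M *m rho].
Proof.
move=> a0 Ka ai0 sEW rVE EU t; have sDE : G :&: E \subset E by apply: subsetIr.
have [v [y [vU yE stab_y disc0]]] := generic_point hk rV (kermx a) sGW.
have va : v *m a = 0 by apply/sub_kermxP.
have /fin_all_exists[F FE] l : exists F, tnth f l = F \mPo t.
  apply: (adapted_invariants_gen rV_faithful sEW Ka rVE ai0 sDE) => g /setIP[gG _].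
  exact: f_inv.
pose Ft := [tuple F l | l < m].
have FtE l : tnth f l = tnth Ft l \mPo t by rewrite tnth_mktuple.
have tfix i : fixed_by_stab G (act rV) y (tnth t i).
  move=> g gG gy; apply: (adapted_invariants_inv rV_faithful sEW Ka rVE i0 sDE i).
  by have := stab_y g gG gy; rewrite !inE EU inE.
have [X [M eqq]] := key_identity hk sGW f_inv f_gen r_rel r_gen tfix FtE.
exists v, Ft, (orbit_disc G (act rV) y ^+ 3), X, M; split=> //.
by rewrite rmorphXn /= expf_neq0.
Qed.

(** Since [jacobian f] is the partial matrix times the injective Jacobian of the adapted invariants,
    u kills the partial matrix, and the identity leaves q u = u M rho. *)
Lemma hyperplane_key (a : 'cV[k]_n) : a != 0 ->
  exists (v : 'rV[k]_n) (q : B), [/\ v *m a = 0, q.@[v 0] != 0 &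
    forall u : 'rV_m, u *m jacobian f = 0 -> in_rows rho (q *: u)].
Proof.
move=> a0; pose E := [group of rstab rV (kermx a)].
have sEW : E \subset Wt by apply: rstab_sub_Wt.
have E_fix : {in E, forall g (v : 'rV_n), v *m a = 0 -> v *m rV g = v}.
  move=> g /rstabP[gW gU] v /sub_kermxP/submxP[x ->].
  by rewrite -mulmxA gU.
have [K [zeta [Ka rVE]]] := hyperplane_stab_structure hk rV_faithful a0 sEW E_fix.
have [i0 ai0] : exists i0, a i0 0 != 0 by apply/cV0Pn.
have EU g : (g \in E) = (g \in rstab rV (kermx a)) by [].
have [v [F [q [X [M [va fF qv eqq]]]]]] := adapted_key a0 Ka ai0 sEW rVE EU.
exists v, q; split=> // u uJ.
have uP : u *m partial_mx (adapted_invariants a K i0 (G :&: E)%G) F = 0.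
  have sDE : G :&: E \subset E by apply: subsetIr.
  apply: (@jacobian_adapted_inj k hk gT n a a0 K Ka i0 ai0 (G :&: E)%G).
  by rewrite -mulmxA -jacobian_partial.
exists (u *m M).
by rewrite -mul_mx_scalar eqq mulmxDr mulmxA uP mul0mx add0r mulmxA.
Qed.

(** A generic linear form l has trivial stabilizer in G, so the variables themselves can serve as
    [t], and the discriminant is the product of the forms l - g l. *)
Lemma generic_linear_key : exists (l : 'cV[k]_n) (s : seq 'cV[k]_n) (v : 'rV[k]_n),
  let q := (\prod_(a <- s) lf a) ^+ 3 in
  [/\ {in s, forall a, a != 0}, q.@[v 0] != 0 &
      exists (X : 'M_(n, m)) M, q%:M = jacobian f *m X + M *m rho].
Proof.
have [i|l lP] := @avoid_col k hk n {g | g \in G^#%g} (fun=> n)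
    (fun i => 1%:M - rV (val i)).
  have := valP i; rewrite !inE => /andP[i1 iG]; rewrite subr_eq0.
  apply: contraNneq i1 => i1; apply/eqP/(repr_inj rV_faithful).
  - exact: (subsetP sGW).
  - exact: group1.
  by rewrite repr_mx1 -i1.
pose y := lf l.
have [i|v vP] := @avoid_row k hk n {g | g \in G^#%g} (fun=> 1%N)
    (fun i => (1%:M - rV (val i)) *m l); first exact: lP.
have stab1 g : g \in G -> mxact (rV g) y = y -> g = 1%g.
  move=> gG; rewrite mxact_lf => /eqP; rewrite -subr_eq0 -raddfB lf_eq0 => /eqP E0.
  apply/eqP; apply: contraT => g1; have gG1 : g \in G^#%g by rewrite !inE g1.
  have /negP[] := lP (exist (fun g => g \in G^#%g) g gG1).
  by rewrite /= mulmxBl mul1mx -opprB E0 oppr0.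
(* The orbit is a list of polynomials, not of group elements; [cl] recovers the column of each
   linear form. *)
pose cl (z : B) := \col_i z@_U_(i).
have clK a : cl (lf a) = a.
  apply/colP=> i; rewrite mxE raddf_sum (bigD1 i) //= mcoeffZ mcoeffXU eqxx mulr1.
  by rewrite big1 ?addr0 // => j ji; rewrite mcoeffZ mcoeffXU (negPf ji) mulr0.
pose s := [seq l - cl z | z <- orbit_seq G (act rV) y & z != y].
have sP a : a \in s -> exists2 g, g \in G^#%g & a = (1%:M - rV g) *m l.
  case/mapP=> z; rewrite mem_filter => /andP[zy /orbitP[g gG zE]] ->.
  exists g; last by rewrite zE /= mxact_lf clK mulmxBl mul1mx.
  rewrite !inE gG andbT; apply: contraNneq zy => g1.
  by rewrite zE g1 /= repr_mx1 mxact1.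
have disc_s : orbit_disc G (act rV) y = \prod_(a <- s) lf a.
  rewrite /s big_map big_filter /orbit_disc big_seq_cond [RHS]big_seq_cond.
  apply: eq_bigr => z /andP[/orbitP[g gG ->] _].
  by rewrite /= mxact_lf clK raddfB.
exists l, s, v; split.
- by move=> a /sP[g gG ->]; apply: (lP (exist (fun g => g \in G^#%g) g gG)).
- rewrite rmorphXn /= expf_neq0 // rmorph_prod prodf_seq_neq0.
  apply/allP=> _ /sP[g gG ->] /=; rewrite lf_eval.
  have := vP (exist (fun g => g \in G^#%g) g gG); apply: contraNneq => v0.
  by apply/eqP/matrixP=> i j; rewrite !ord1 /= v0 mxE.
pose t := [tuple 'X_i : B | i < n].
have tfix i : fixed_by_stab G (act rV) y (tnth t i).
  by move=> g gG /= /(stab1 g gG) ->; rewrite repr_mx1 mxact1.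
have fF l' : tnth f l' = tnth f l' \mPo t by rewrite comp_mpoly_id.
have pJ : partial_mx t f = jacobian f.
  by apply/matrixP=> i j; rewrite !mxE comp_mpoly_id.
have [X [M]] := key_identity hk sGW f_inv f_gen r_rel r_gen tfix fF.
by rewrite pJ disc_s => eqq; exists X, M.
Qed.

(** At v the Jacobian has rank at most n, so [key_rank] and c + n = m force the relation matrix to
    have rank c there. A right inverse of its value produces a square matrix with nonzero
    determinant. *)
Lemma relation_mx_free p (b : 'M[B]_(p, c)) : b *m rho = 0 -> b = 0.
Proof.
have [l [s [v [_ qv [X [M eqq]]]]]] := generic_linear_key.
have rk := key_rank eqq qv; have rk_rho : (c <= \rank (mx_at v rho))%N.
  rewrite -(leq_add2r n) cnm addnC (leq_trans rk) // leq_add2r.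
  exact: rank_leq_col.
have /row_freeP[N rhoN] : row_free (mx_at v rho).
  by rewrite /row_free eqn_leq rank_leq_row.
pose S := rho *m map_mx (@mpolyC n k) N.
have detS : \det S != 0.
  apply: contra_eq_neq (congr1 determinant rhoN) => dS.
  have -> : mx_at v rho *m N = mx_at v S.
    rewrite /mx_at map_mxM; congr (_ *m _).
    by apply/matrixP=> i j; rewrite !mxE /= mevalC.
  by rewrite /mx_at det_map_mx dS rmorph0 det1 eq_sym oner_eq0.
move=> bR; have : b *m S = 0 by rewrite mulmxA bR mul0mx.
move/(congr1 (mulmxr (\adj S))); rewrite /= -mulmxA mul_mx_adj mul0mx mul_mx_scalar.
move=> bS; apply/matrixP=> i j; have := congr1 (fun A : 'M__ => A i j) bS.
by rewrite !mxE => /eqP; rewrite mulf_eq0 (negPf detS) => /eqP.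
Qed.

(** If lf a w = b rho and q w = b' rho, freeness gives q b = lf a b'. The form [lf a] is prime and
    does not divide q, which is nonzero at a point of the hyperplane, so it divides b. *)
Lemma relation_cancel (a : 'cV[k]_n) (w : 'rV[B]_m) : a != 0 ->
  w *m jacobian f = 0 -> in_rows rho (lf a *: w) -> in_rows rho w.
Proof.
move=> a0 wJ [b awE]; have [v [q [va qv qP]]] := hyperplane_key a0.
have [b' qwE] := qP w wJ.
have : (q *: b - lf a *: b') *m rho = 0.
  by rewrite mulmxBl -!scalemxAl -awE -qwE !scalerA mulrC subrr.
move/relation_mx_free/subr0_eq => qb.
have /fin_all_exists[b2 b2E] i : exists x, b 0 i = x * lf a.
  have [||//] := @lf_prime k n a q (b 0 i) a0.
    exists (b' 0 i); have := congr1 (fun A : 'M__ => A 0 i) qb.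
    by rewrite !mxE => ->; rewrite mulrC.
  by move/dvd_lf_eval/(_ va)/eqP; rewrite (negPf qv).
exists (\row_i b2 i); have lfa0 : lf a != 0 by rewrite lf_eq0.
apply/rowP=> j; apply: (mulfI lfa0); have := congr1 (fun A : 'M__ => A 0 j) awE.
rewrite !mxE => ->; rewrite mulr_sumr; apply: eq_bigr => i _.
by rewrite !mxE b2E mulrA [lf a * _]mulrC.
Qed.

Theorem relation_exact (u : 'rV[B]_m) : u *m jacobian f = 0 -> in_rows rho u.
Proof.
move=> uJ; have [l [s [v [s0 _ [X [M eqq]]]]]] := generic_linear_key.
have qu : in_rows rho ((\prod_(a <- s ++ s ++ s) lf a) *: u).
  exists (u *m M); rewrite !big_cat /=.
  rewrite -[X in X *: _](_ : (\prod_(a <- s) lf a) ^+ 3 = _); last first.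
    by rewrite !exprS expr0 mulr1.
  by rewrite -mul_mx_scalar eqq mulmxDr mulmxA uJ mul0mx add0r mulmxA.
have : {in s ++ s ++ s, forall a, a != 0}.
  by move=> a; rewrite !mem_cat !orbb; apply: s0.
move: (s ++ s ++ s) qu => {s s0 eqq M}; elim=> [|a s IHs].
  by rewrite big_nil scale1r.
rewrite big_cons -scalerA => /relation_cancel H nz; apply: IHs.
  by apply: H; [apply: nz; rewrite mem_head | rewrite -scalemxAl uJ scaler0].
by move=> b bs; apply: nz; rewrite in_cons bs orbT.
Qed.

End Exactness.

(** * Differentials of invariants of a subgroup *)

Lemma koszul_solve (R : comNzRingType) (x y z p q s : R) :
  z * p - y * q + x * s = 0 -> z * p = - s * x + q * y.
Proof. by move=> H; apply/eqP; rewrite -subr_eq0 -H; apply/eqP; ring. Qed.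

Lemma koszul_cycle (R : comNzRingType) (V : lmodType R) (x y z : R) (u1 u2 u3 : V) :
  z *: (y *: u1 - x *: u2) - y *: (z *: u1 - x *: u3) + x *: (z *: u2 - y *: u3) = 0.
Proof.
rewrite !scalerBr !scalerA (mulrC z y) (mulrC z x) (mulrC y x) opprB.
by rewrite [X in X + _]addrC !subrKA subrr.
Qed.

(** One multiplication by t leaves - v d in the second component where t = 0; a second one clears
    it. This is why squares of linear forms appear below. *)
Lemma square_step0 (R : comNzRingType) (V : lmodType R) (v t : R) (w d : V) :
  t = 0 \/ v = 0 /\ w = 0 ->
  v * t * t = 0 /\ t *: (t *: w - v *: d) - (v * t) *: d = 0.
Proof.
case=> [->|[-> ->]]; first by rewrite !mulr0 !scale0r subrr.
by rewrite !mul0r !scale0r scaler0 subrr scaler0 subrr.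
Qed.

Section GenericTriple.
Variables (k : fieldType) (hk : [pchar k] =i pred0) (n : nat).

Lemma row_full_col q (C : 'M[k]_(n, q)) (a : 'cV[k]_n) :
  row_full (row_mx C a) -> row_full C.
Proof.
move=> /row_fullP[K]; rewrite mul_mx_row scalar_mx_block -[K]vsubmxK !mul_col_mx.
rewrite block_mxEh => /eq_row_mx[/eq_col_mx[E1 _] _].
by apply/row_fullP; exists (usubmx K).
Qed.

(** The rank of [M] exceeds the number of columns of [C], so [M] stays nonzero after the projection
    that kills these columns. *)
Lemma row_full_extend q (C : 'M[k]_(n, q)) (M : 'M[k]_n) :
  row_full C -> (q < \rank M)%N ->
  exists2 N : 'M[k]_n, N != 0 & forall c : 'cV_n, N *m c != 0 -> row_full (row_mx C (M *m c)).
Proof.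
move=> /row_fullP[K KC] rkM; pose P := 1%:M - C *m K.
exists (P *m M).
  apply: contraTneq rkM => PM0; rewrite -leqNgt.
  have -> : M = C *m (K *m M).
    by apply/eqP; rewrite -subr_eq0 mulmxA -[X in X - _]mul1mx -mulmxBl PM0.
  by apply: leq_trans (mxrankM_maxl _ _) (rank_leq_col _).
move=> c; rewrite -mulmxA; set x := M *m c => /col_left_inv[L LPx].
have PC : P *m C = 0 by rewrite mulmxBl mul1mx -mulmxA KC mulmx1 subrr.
apply/row_fullP; exists (col_mx (K - K *m x *m L *m P) (L *m P)).
rewrite mul_mx_row !mul_col_mx scalar_mx_block block_mxEh !mulmxBl.
by rewrite -!mulmxA PC LPx !mulmx0 mulmx1 KC subr0 subrr.
Qed.

Lemma generic_extend (T : finType) q (C : T -> 'M[k]_(n, q)) (M : T -> 'M[k]_n) :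
  (forall i, row_full (C i)) -> (forall i, q < \rank (M i))%N ->
  exists c : 'cV_n, forall i, row_full (row_mx (C i) (M i *m c)).
Proof.
move=> fC rM.
have /fin_all_exists2[N N0 NP] i := row_full_extend (fC i) (rM i).
have [c cP] := avoid_col hk N0.
by exists c => i; apply: NP.
Qed.

Lemma generic_triple (T : finType) (M : T -> 'M[k]_n) :
  (forall i, 2 < \rank (M i))%N ->
  exists c1 c2 c3 : 'cV_n, forall i1 i2 i3,
    row_full (row_mx (row_mx (M i1 *m c1) (M i2 *m c2)) (M i3 *m c3)).
Proof.
move=> rM.
have M0 i : M i != 0 by rewrite -mxrank_eq0 -lt0n; apply: leq_trans (rM i).
have [c1 c1P] := avoid_col hk M0.
have [i|i|c2 c2P] := @generic_extend (T * T)%type 1 (fun i => M i.1 *m c1) (fun i => M i.2).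
- by apply/row_fullP; apply: col_left_inv.
- by apply: ltnW.
have [i|i|c3 c3P] := @generic_extend (T * T * T)%type (1 + 1)
    (fun i => row_mx (M i.1.1 *m c1) (M i.1.2 *m c2)) (fun i => M i.2).
- by apply: (c2P i.1).
- by [].
by exists c1, c2, c3 => i1 i2 i3; apply: (c3P ((i1, i2), i3)).
Qed.

End GenericTriple.

Section Differentials.
Variables (k : fieldType) (hk : [pchar k] =i pred0).
Variables (gT : finGroupType) (Wt G : {group gT}) (n : nat).
Variable rV : mx_representation k Wt n.
Hypothesis rV_faithful : mx_faithful rV.
Hypothesis sGW : G \subset Wt.
Local Notation B := {mpoly k[n]}.
Variables (m c : nat) (f : m.-tuple B) (r : c.-tuple {mpoly k[m]}).
Hypothesis f_inv : forall l, invariant rV G (tnth f l).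
Hypothesis f_gen : forall b, invariant rV G b -> exists a, a \mPo f = b.
Hypothesis r_rel : forall j, tnth r j \mPo f = 0.
Hypothesis r_gen : forall a, a \mPo f = 0 ->
  exists u : 'I_c -> {mpoly k[m]}, a = \sum_(j < c) u j * tnth r j.
Hypothesis cnm : (c + n = m)%N.

Local Notation rho := (relation_mx f r).
Local Notation exact := (relation_exact hk rV_faithful sGW f_inv f_gen r_rel r_gen cnm).
Local Notation rho_free := (relation_mx_free hk rV_faithful sGW f_inv f_gen r_rel r_gen cnm).

(* The module of rows of the Jacobian has projective dimension at most 1, so it
   contains each vector which three independent linear forms multiply into it. *)
Lemma jacobian_rows_triple a1 a2 a3 (xi : 'rV[B]_n) :
  row_full (row_mx (row_mx a1 a2) a3) ->
  in_rows (jacobian f) (lf a1 *: xi) -> in_rows (jacobian f) (lf a2 *: xi) ->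
  in_rows (jacobian f) (lf a3 *: xi) -> in_rows (jacobian f) xi.
Proof.
move=> full [u1 E1] [u2 E2] [u3 E3].
have [a10 Na12] := row_full_pair (row_full_col full).
have kill s s' (u u' : 'rV_m) : s *: xi = u *m jacobian f ->
    s' *: xi = u' *m jacobian f -> (s' *: u - s *: u') *m jacobian f = 0.
  by move=> Es Es'; rewrite mulmxBl -!scalemxAl -Es -Es' !scalerA mulrC subrr.
have [b12 b12E] := exact (kill _ _ _ _ E1 E2).
have [b13 b13E] := exact (kill _ _ _ _ E1 E3).
have [b23 b23E] := exact (kill _ _ _ _ E2 E3).
have koszul : lf a3 *: b12 - lf a2 *: b13 + lf a1 *: b23 = 0.
  apply: rho_free; rewrite mulmxDl mulmxBl -!scalemxAl -b12E -b13E -b23E.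
  exact: koszul_cycle.
have /fin_all_exists[pq pqE] i : exists pq : B * B, b12 0 i = pq.1 * lf a1 + pq.2 * lf a2.
  have [|p [q ?]] := @row_full_triple k n a1 a2 a3 (b12 0 i) (- b23 0 i) (b13 0 i) full.
    have := congr1 (fun A : 'rV_c => A 0 i) koszul; rewrite !mxE.
    exact: koszul_solve.
  by exists (p, q).
(* Correcting u1 and u2 by these relations turns an equality modulo relations into the exact one lf
   a2 u1' = lf a1 u2', from which [lf a1] divides u1'. *)
pose u1' := u1 - (\row_i (pq i).2) *m rho; pose u2' := u2 + (\row_i (pq i).1) *m rho.
have rJ p (b : 'M_(p, c)) : (b *m rho) *m jacobian f = 0.
  by rewrite -mulmxA (relation_jacobian r_rel) mulmx0.
have E1' : lf a1 *: xi = u1' *m jacobian f by rewrite mulmxBl rJ subr0.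
have u12 : lf a2 *: u1' = lf a1 *: u2'.
  apply/eqP; rewrite -subr_eq0 scalerBr scalerDr opprD addrACA b12E.
  rewrite -opprD !scalemxAl -mulmxDl -mulmxBl; apply/eqP.
  rewrite [X in X *m _](_ : _ = 0) ?mul0mx //; apply/rowP=> i; rewrite !mxE pqE.
  by move: (lf a1) (lf a2) (pq i).1 (pq i).2 => x y z t; ring.
have /fin_all_exists[w wE] l : exists w, u1' 0 l = w * lf a1.
  apply: (lf_coprime a10 Na12); exists (u2' 0 l).
  by have := congr1 (fun A : 'rV_m => A 0 l) u12; rewrite !mxE => ->; rewrite mulrC.
exists (\row_l w l); have lfa0 : lf a1 != 0 by rewrite lf_eq0.
have u1w : u1' = lf a1 *: \row_l w l.
  by apply/rowP=> l; rewrite wE !mxE mulrC.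
move: E1'; rewrite u1w -scalemxAl => /rowP E; apply/rowP=> i.
by apply: (mulfI lfa0); have := E i; rewrite !mxE.
Qed.

(** Factors are removed one at a time in three nested inductions; [xi] stays general because the
    induction hypothesis is applied to its multiple by the head of the list. *)
Lemma jacobian_rows_triples (s1 s2 s3 : seq 'cV[k]_n) (xi : 'rV[B]_n) :
  (forall a1 a2 a3, a1 \in s1 -> a2 \in s2 -> a3 \in s3 ->
     row_full (row_mx (row_mx a1 a2) a3)) ->
  in_rows (jacobian f) ((\prod_(a <- s1) lf a) *: xi) ->
  in_rows (jacobian f) ((\prod_(a <- s2) lf a) *: xi) ->
  in_rows (jacobian f) ((\prod_(a <- s3) lf a) *: xi) ->
  in_rows (jacobian f) xi.
Proof.
have comm (p q : B) (x : 'rV[B]_n) : p *: (q *: x) = q *: (p *: x).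
  by rewrite !scalerA mulrC.
have IN s a (x : 'rV[B]_n) : in_rows (jacobian f) ((\prod_(b <- s) lf b) *: x) ->
    in_rows (jacobian f) ((\prod_(b <- s) lf b) *: (lf a *: x)).
  by move=> H; rewrite comm; apply: in_rowsZ.
move: s1 xi; elim=> [|a1 s1 IH1] xi full; first by rewrite big_nil scale1r.
rewrite big_cons mulrC -scalerA => H1 H2 H3.
have {IH1} H1a : in_rows (jacobian f) (lf a1 *: xi).
  apply: IH1 => //; try exact: IN.
  by move=> b1 b2 b3 b1s; apply: full; rewrite in_cons b1s orbT.
have {}full a2 a3 : a2 \in s2 -> a3 \in s3 -> row_full (row_mx (row_mx a1 a2) a3).
  by apply: full; rewrite mem_head.
move: s2 xi full H2 H3 H1a {H1}; elim=> [|a2 s2 IH2] xi full.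
  by rewrite big_nil scale1r.
rewrite big_cons mulrC -scalerA => H2 H3 H1a.
have {IH2} H2a : in_rows (jacobian f) (lf a2 *: xi).
  apply: IH2 => //; try exact: IN; last by rewrite comm; apply: in_rowsZ.
  by move=> b2 b3 b2s; apply: full; rewrite in_cons b2s orbT.
have {}full a3 : a3 \in s3 -> row_full (row_mx (row_mx a1 a2) a3).
  by apply: full; rewrite mem_head.
move: s3 xi full H3 H2a H1a {H2}; elim=> [|a3 s3 IH3] xi full.
  by rewrite big_nil scale1r.
rewrite big_cons mulrC -scalerA => H3 H2a H1a.
have H3a : in_rows (jacobian f) (lf a3 *: xi).
  apply: IH3; [|exact: H3|by rewrite comm; apply: in_rowsZ..].
  by move=> b3 b3s; apply: full; rewrite in_cons b3s orbT.
by apply: (jacobian_rows_triple (full a3 _)) => //; rewrite mem_head.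
Qed.

(* The pairs (v, w) such that sum_g (g x) w(g) + v(g) d(g x) lies in the B-span of
   the d f_l for all x form a module over the tensor square of B, where x (x) y acts
   on v by v(g) |-> x (g y) v(g). Multiplying (1, 0) by well-chosen squares concentrates it
   on the subgroup D. *)
Definition trace_pair (v : gT -> B) (w : gT -> 'rV[B]_n) : Prop := forall x : B,
  in_rows (jacobian f)
    (\sum_(g in G) (mxact (rV g) x *: w g + v g *: grad (mxact (rV g) x))).

Lemma trace_pair1 : trace_pair (fun=> 1) (fun=> 0).
Proof.
move=> x; have [a aE] : exists a, a \mPo f = \sum_(g in G) mxact (rV g) x.
  apply: f_gen => h hG; rewrite rmorph_sum [RHS](reindex_inj (mulgI h)) /=.
  apply: eq_big => [g|g gG]; first by rewrite groupMl.
  exact: (esym (act_mul rV (subsetP sGW _ hG) (subsetP sGW _ gG) x)).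
exists (map_mx (comp_mpoly f) (grad a)); rewrite -grad_comp aE raddf_sum.
by apply: eq_bigr => g _; rewrite scaler0 add0r scale1r.
Qed.

(** This is the action of x0 (x) 1 - 1 (x) y0: x0 times the condition at x, minus the condition at
    y0 x. The Leibniz rule for y0 x produces the correction of w. *)
Lemma trace_pair_step v w (x0 y0 : B) : trace_pair v w ->
  trace_pair (fun g => v g * (x0 - mxact (rV g) y0))
    (fun g => (x0 - mxact (rV g) y0) *: w g - v g *: grad (mxact (rV g) y0)).
Proof.
move=> vw x; have := in_rowsD (in_rowsZ x0 (vw x)) (in_rowsN (vw (y0 * x))).
congr in_rows; rewrite scaler_sumr -sumrB; apply: eq_bigr => g _.
rewrite rmorphM gradM; move: (grad _) (grad _) => dx dy /=.
move: (mxact _ x) (mxact _ y0) (w g) (v g) => gx gy wg vg {vw}.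
apply/rowP=> i; rewrite !mxE.
by move: (dx 0 i) (dy 0 i) (wg 0 i) => p q s; ring.
Qed.

Lemma trace_pair_list (L : seq (B * B)) : exists v w,
  [/\ trace_pair v w, forall g, v g = \prod_(p <- L) (p.1 - mxact (rV g) p.2) ^+ 2 &
      forall g, has (fun p => p.1 == mxact (rV g) p.2) L -> v g = 0 /\ w g = 0].
Proof.
elim: L => [|p L [v [w [vw vE wE]]]].
  by exists (fun=> 1), (fun=> 0); split=> // [|g]; [exact: trace_pair1 | rewrite big_nil].
have tp := trace_pair_step p.1 p.2 (trace_pair_step p.1 p.2 vw).
do 2!eexists; split; first exact: tp.
  by move=> g; rewrite big_cons -vE /= expr2 [RHS]mulrC mulrA.
move=> g /= /orP[/eqP pE|/wE vw0]; apply: square_step0; last by right.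
by left; rewrite pE subrr.
Qed.

Variable D : {group gT}.
Hypothesis sDG : D \subset G.

(** The forms g l and h l, with g outside D and h in D, give a trace pair vanishing outside D; on D
    its first component is the constant [s], since translating by an element of D permutes the
    factors. For invariant b there remains b times the sum of the w h, plus |D| s db; the case b = 1
    removes the first term. *)
Lemma grad_killed (l : 'cV[k]_n) (b : B) : invariant rV D b ->
  in_rows (jacobian f) ((\prod_(g in G :\: D) \prod_(h in D)
     lf ((rV g - rV h) *m l) ^+ 2) *: grad b).
Proof.
move=> bD; set s := \prod_(g in _) _.
pose L := [seq (lf (rV p.1 *m l), lf (rV p.2 *m l)) |
            p <- enum [set p : gT * gT | (p.1 \in G :\: D) && (p.2 \in D)]].
have [v [w [vw vE wE]]] := trace_pair_list L.
have vw0 g : g \in G :\: D -> v g = 0 /\ w g = 0.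
  move=> gGD; apply: wE; apply/hasP; exists (lf (rV g *m l), lf (rV 1%g *m l)).
    by apply/mapP; exists (g, 1%g); rewrite // mem_enum inE gGD group1.
  by rewrite /= mxact_lf repr_mx1 mul1mx.
have sumD (F : gT -> 'rV[B]_n) : {in G :\: D, forall g, F g = 0} ->
    \sum_(g in G) F g = \sum_(g in D) F g.
  move=> F0; rewrite (big_setID D) /= (setIidPr sDG) [X in _ + X]big1 ?addr0 //.
have sE h : h \in D -> v h = s.
  move=> hD; have hW := subsetP sGW _ (subsetP sDG _ hD).
  rewrite vE /L big_map big_enum /= /s pair_big /=.
  have inj : injective (fun p : gT * gT => (p.1, (h * p.2)%g)).
    by move=> [p1 p2] [q1 q2] [-> /mulgI ->].
  rewrite [RHS](reindex_inj inj); apply: eq_big => [p|p].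
    by rewrite !inE groupMl.
  rewrite inE => /andP[_ p2D]; have p2W := subsetP sGW _ (subsetP sDG _ p2D).
  by rewrite mxact_lf mulmxA -repr_mxM // -raddfB mulmxBl.
have vwb (b' : B) : invariant rV D b' -> in_rows (jacobian f)
    (b' *: (\sum_(h in D) w h) + (s *: grad b') *+ #|D|).
  move=> b'D; have := vw b'; rewrite sumD => [|g /vw0[-> ->]]; last first.
    by rewrite scaler0 scale0r addr0.
  congr in_rows; rewrite scaler_sumr -sumr_const -big_split /=.
  by apply: eq_bigr => h hD; rewrite b'D // sE.
have /(in_rowsZ (- b)) W : in_rows (jacobian f) (\sum_(h in D) w h).
  have := vwb 1; rewrite -mpolyC1 gradC scaler0 mul0rn addr0 mpolyC1 scale1r.
  by apply; rewrite -mpolyC1; apply: invariantC.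
have := in_rowsZ ((#|D|%:R^-1 : k)%:MP) (in_rowsD W (vwb b bD)).
rewrite scaleNr addrA addNr add0r -scaler_nat -mpolyC_nat [X in in_rows _ X]scalerA.
rewrite -mpolyCM mulVf ?mpolyC1 ?scale1r //.
by rewrite -(prednK (cardG_gt0 D)) natr_neq0.
Qed.

Hypothesis D_big : {in G :\: D, forall g, (2 < \rank (rV g - 1%:M)%R)%N}.

(** For g outside D and h in D, g - h has the rank of g h^-1 - 1, at least 3. Three generic columns
    therefore give products of forms in which any three factors, one from each, are independent. *)
Lemma grad_in_rows (b : B) : invariant rV D b -> in_rows (jacobian f) (grad b).
Proof.
move=> bD.
pose P := [set p : gT * gT | (p.1 \in G :\: D) && (p.2 \in D)].
have rkM (i : {p | p \in P}) : (2 < \rank (rV (val i).1 - rV (val i).2)%R)%N.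
  have := valP i; rewrite inE => /andP[gGD hD].
  set g := (val i).1 in gGD *; set h := (val i).2 in hD *.
  have hG := subsetP sDG _ hD; have hW := subsetP sGW _ hG.
  have gW : g \in Wt by apply: (subsetP sGW); case/setDP: gGD.
  have -> : rV g - rV h = (rV (g * h^-1)%g - 1%:M) *m rV h.
    by rewrite mulmxBl mul1mx -repr_mxM ?groupM ?groupV // mulgKV.
  rewrite mxrankMfree; last by rewrite row_free_unit repr_mx_unit.
  by apply: D_big; move: gGD; rewrite !inE !groupMr ?groupV.
have [c1 [c2 [c3 full]]] := generic_triple hk rkM.
(* Each form is listed twice, to match the squares of [grad_killed]. *)
pose s (l : 'cV[k]_n) : seq 'cV[k]_n := flatten [seq [:: (rV (val i).1 - rV (val i).2) *m l;
     (rV (val i).1 - rV (val i).2) *m l] | i : {p | p \in P}].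
have sP l a : a \in s l -> exists i : {p | p \in P}, a = (rV (val i).1 - rV (val i).2) *m l.
  by case/flattenP=> _ /mapP[i _ ->]; rewrite !inE orbb => /eqP ->; exists i.
have sE l : \prod_(a <- s l) lf a = \prod_(g in G :\: D) \prod_(h in D)
     lf ((rV g - rV h) *m l) ^+ 2.
  rewrite big_flatten big_map big_enum /= pair_big /=.
  rewrite [RHS](eq_bigl (fun p => p \in P)) => [|p]; last by rewrite !inE.
  rewrite [RHS]big_sub; apply: eq_bigr => i _.
  by rewrite !big_cons big_nil mulr1.
apply: (@jacobian_rows_triples (s c1) (s c2) (s c3)).
- by move=> a1 a2 a3 /sP[i1 ->] /sP[i2 ->] /sP[i3 ->].
- by rewrite sE; apply: grad_killed.
- by rewrite sE; apply: grad_killed.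
by rewrite sE; apply: grad_killed.
Qed.

End Differentials.

(** * Weighted degrees and generation of invariants *)

Lemma addr_subACA (V : zmodType) (x y z t : V) : x + y - (z + t) = (x - z) + (y - t).
Proof. by rewrite opprD addrACA. Qed.

Section Weights.
Variables (k : fieldType) (n : nat) (d : 'I_n -> nat).
Local Notation B := {mpoly k[n]}.
Implicit Types (b : B) (mon : 'X_{1..n}).

Lemma weightD mon mon' : weight d (mon + mon')%MM = (weight d mon + weight d mon')%N.
Proof. by rewrite /weight -big_split; apply: eq_bigr => i _; rewrite mnmDE mulnDl. Qed.

Definition wge N b : Prop := {in msupp b, forall mon, (N <= weight d mon)%N}.

Lemma wge0 b : wge 0 b. Proof. by []. Qed.

Lemma wge_zero N : wge N (0 : B).
Proof. by move=> mon; rewrite msupp0. Qed.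

Lemma wge_le N N' b : (N' <= N)%N -> wge N b -> wge N' b.
Proof. by move=> le H mon /H; apply: leq_trans. Qed.

Lemma wgeD N b b' : wge N b -> wge N b' -> wge N (b + b').
Proof. by move=> H H' mon /msuppD_le; rewrite mem_cat => /orP[/H|/H']. Qed.

Lemma wge_sum N (I : Type) (r : seq I) (P : pred I) (F : I -> B) :
  (forall i, P i -> wge N (F i)) -> wge N (\sum_(i <- r | P i) F i).
Proof. by move=> H; apply: big_ind => //; [exact: wge_zero | exact: wgeD]. Qed.

Lemma wgeM N N' b b' : wge N b -> wge N' b' -> wge (N + N') (b * b').
Proof.
move=> H H' mon /msuppM_le/allpairsP[[u v] /= [/H uN /H' vN ->]].
by rewrite weightD leq_add.
Qed.

Lemma wgeMl N b b' : wge N b' -> wge N (b * b').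
Proof. by move=> H; rewrite -[N]add0n; apply: wgeM. Qed.

Lemma wgeN N b : wge N b -> wge N (- b).
Proof. by rewrite -mulN1r; apply: wgeMl. Qed.

Lemma wgeB N b b' : wge N b -> wge N b' -> wge N (b - b').
Proof. by move=> H /wgeN; apply: wgeD. Qed.

Lemma wgeZ N x b : wge N b -> wge N (x *: b).
Proof. by rewrite -mul_mpolyC; apply: wgeMl. Qed.

Lemma wge_whomog e b : whomog d e b -> wge e b.
Proof. by move=> H mon /H ->. Qed.

Lemma whomogM e e' b b' : whomog d e b -> whomog d e' b' -> whomog d (e + e') (b * b').
Proof.
move=> H H' mon /msuppM_le/allpairsP[[u v] /= [/H uN /H' vN ->]].
by rewrite weightD uN vN.
Qed.

Lemma whomog1 : whomog d 0 (1 : B).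
Proof.
move=> mon; rewrite -mpolyC1 msupp1 inE => /eqP ->.
by rewrite /weight big1 // => i _; rewrite mnm0E.
Qed.

Lemma whomogX e b j : whomog d e b -> whomog d (j * e) (b ^+ j).
Proof.
move=> H; elim: j => [|j IHj]; first by rewrite mul0n expr0; apply: whomog1.
by rewrite mulSn exprS; apply: whomogM.
Qed.

Definition wtrunc N b : B := \sum_(mon <- msupp b | (weight d mon < N)%N) b@_mon *: 'X_[mon].

Lemma mcoeff_wtrunc N b mon :
  (wtrunc N b)@_mon = if (weight d mon < N)%N then b@_mon else 0.
Proof.
rewrite raddf_sum /=; have [mon_b|Nmon] := boolP (mon \in msupp b); last first.
  rewrite (memN_msupp_eq0 Nmon) if_same big_seq_cond big1 // => u /andP[ub _].
  rewrite mcoeffZ mcoeffX; case: eqP => [uE|]; last by rewrite mulr0.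
  by rewrite -uE ub in Nmon.
rewrite big_mkcond (bigD1_seq mon) ?msupp_uniq //= big1 ?addr0 => [|u ne].
  by case: ifP; rewrite // mcoeffZ mcoeffX eqxx mulr1.
by case: ifP; rewrite // mcoeffZ mcoeffX (negPf ne) mulr0.
Qed.

Lemma wtrunc_is_additive N : additive (wtrunc N).
Proof.
move=> b b'; apply/mpolyP=> mon; rewrite mcoeffB !mcoeff_wtrunc mcoeffB.
by case: ifP; rewrite ?subr0.
Qed.
HB.instance Definition _ N := GRing.isAdditive.Build B B (wtrunc N) (wtrunc_is_additive N).

Lemma wtruncZ N x b : wtrunc N (x *: b) = x *: wtrunc N b.
Proof.
apply/mpolyP=> mon; rewrite mcoeffZ !mcoeff_wtrunc mcoeffZ.
by case: ifP; rewrite ?mulr0.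
Qed.

Lemma wtrunc_wge N b : wge N b -> wtrunc N b = 0.
Proof.
move=> H; apply/mpolyP=> mon; rewrite mcoeff_wtrunc mcoeff0; case: ltnP => // lt.
by apply: memN_msupp_eq0; apply: contraL lt => /H; rewrite -leqNgt.
Qed.

Lemma wtrunc_id N b : {in msupp b, forall mon, weight d mon < N}%N -> wtrunc N b = b.
Proof.
move=> H; apply/mpolyP=> mon; rewrite mcoeff_wtrunc; case: ltnP => // le.
by apply/esym/memN_msupp_eq0; apply: contraL le => /H; rewrite ltnNge.
Qed.

Lemma wtrunc_whomog N e b : whomog d e b -> wtrunc N b = if (e < N)%N then b else 0.
Proof.
move=> H; case: ltnP => [lt|le]; [apply: wtrunc_id | apply: wtrunc_wge];
by move=> mon /H ->.
Qed.

Definition euler b : B := \sum_i (d i)%:R *: ('X_i * b^`M(i)).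

Lemma eulerX mon : euler 'X_[mon] = (weight d mon)%:R *: 'X_[mon].
Proof.
rewrite /euler /weight natr_sum scaler_suml; apply: eq_bigr => i _.
rewrite mderivX -scalerAr scalerA mulnC natrM.
have [->|mi0] := posnP (mon i); first by rewrite mulr0 !scale0r.
rewrite -mpolyXD addmC submK //; apply/mnm_lepP=> j; rewrite mnm1E.
by case: eqP => [<-|].
Qed.

Lemma euler_is_additive : additive euler.
Proof.
move=> b b'; rewrite /euler -sumrB; apply: eq_bigr => i _.
by rewrite mderivB mulrBr scalerBr.
Qed.
HB.instance Definition _ := GRing.isAdditive.Build B B euler euler_is_additive.

Lemma eulerE b : euler b = \sum_(mon <- msupp b) (b@_mon * (weight d mon)%:R) *: 'X_[mon].
Proof.
rewrite {1}(mpolyE b) raddf_sum; apply: eq_bigr => mon _.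
rewrite -scalerA -eulerX /= /euler scaler_sumr; apply: eq_bigr => i _.
by rewrite mderivZ -scalerAr !scalerA mulrC.
Qed.

Lemma euler_whomog e b : whomog d e b -> euler b = e%:R *: b.
Proof.
move=> H; rewrite eulerE {3}(mpolyE b) scaler_sumr big_seq [RHS]big_seq.
by apply: eq_bigr => mon /H ->; rewrite scalerA mulrC.
Qed.

Lemma euler_wge N b : wge N b -> wge N.+1 (euler b - N%:R *: b).
Proof.
move=> H; rewrite eulerE {3}(mpolyE b) scaler_sumr -sumrB big_seq.
apply: wge_sum => mon /H le; rewrite scalerA mulrC -scalerBl -mulrBl.
move: le; rewrite leq_eqVlt => /orP[/eqP <-|lt].
  by rewrite subrr mul0r scale0r; apply: wge_zero.
by apply: wgeZ => u; rewrite msuppX inE => /eqP ->.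
Qed.

Lemma euler_grad b :
  euler b = (grad b *m \col_i ((d i)%:R *: 'X_i)) 0 0.
Proof. by rewrite mxE; apply: eq_bigr => i _; rewrite !mxE -scalerAr mulrC. Qed.

End Weights.

Section WeightedGenerators.
Variables (k : fieldType) (n m : nat) (d : 'I_n -> nat) (e : 'I_m -> nat).
Variable f : m.-tuple {mpoly k[n]}.
Hypothesis f_homog : forall l, whomog d (e l) (tnth f l).

Lemma whomog_comp_mon mon : whomog d (weight e mon) ('X_[mon] \mPo f).
Proof.
rewrite comp_mpolyX /weight; apply: (big_ind2 (fun w b => whomog d w b)).
- exact: whomog1.
- by move=> w b w' b'; apply: whomogM.
by move=> l _; apply: whomogX.
Qed.

Lemma wtrunc_comp N a : wtrunc d N (a \mPo f) = wtrunc e N a \mPo f.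
Proof.
rewrite [in LHS]comp_mpolyEX raddf_sum [in RHS]/wtrunc [RHS]rmorph_sum [RHS]big_mkcond.
apply: eq_bigr => mon _ /=; rewrite !comp_mpolyZ wtruncZ.
rewrite (wtrunc_whomog _ (@whomog_comp_mon mon)).
by case: ifP; rewrite ?scaler0.
Qed.

Lemma wge_comp N a : wge e N a -> wge d N (a \mPo f).
Proof.
move=> H; rewrite comp_mpolyEX big_seq; apply: wge_sum => mon /H le.
apply: wgeZ.
exact: wge_le le (wge_whomog (@whomog_comp_mon mon)).
Qed.

(** Truncation by weight commutes with substitution of the homogeneous [f], so an approximation
    beyond the largest weight of b becomes exact once truncated. *)
Lemma approx_generated b :
  (forall N, exists a, wge d N (b - (a \mPo f))) -> exists a, a \mPo f = b.
Proof.
move=> approx; pose N := (\max_(mon <- msupp b) weight d mon).+1.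
have [a aP] := approx N; exists (wtrunc e N a); rewrite -wtrunc_comp.
rewrite -[RHS](@wtrunc_id _ _ d N b) => [|mon mon_b].
  by apply/eqP; rewrite eq_sym -subr_eq0 -raddfB; apply/eqP/wtrunc_wge.
by rewrite ltnS; apply: leq_bigmax_seq.
Qed.

End WeightedGenerators.

Section InvariantGenerators.
Variables (k : fieldType) (hk : [pchar k] =i pred0).
Variables (gT : finGroupType) (Wt G : {group gT}) (n : nat).
Variable rV : mx_representation k Wt n.
Local Notation B := {mpoly k[n]}.
Variables (d : 'I_n -> nat) (hd : forall i, (0 < d i)%N).
Variables (m : nat) (e : 'I_m -> nat) (f : m.-tuple B).
Hypothesis f_homog : forall l, whomog d (e l) (tnth f l).

Lemma weight_gt0 (mon : 'X_{1..n}) : mon != 0%MM -> (0 < weight d mon)%N.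
Proof.
move=> mon0; rewrite lt0n; apply: contra mon0; rewrite /weight sum_nat_eq0.
move=> /forallP H; apply/eqP/mnmP=> i; rewrite mnm0E.
by have := H i; rewrite muln_eq0 => /orP[/eqP //|]; rewrite -[d i == 0]negbK -lt0n hd.
Qed.

Lemma wge1_sub_const (b : B) : wge d 1 (b - (b@_0%MM)%:MP).
Proof.
move=> mon; rewrite mcoeff_msupp mcoeffB mcoeffC => H; apply: weight_gt0.
by apply: contraNneq H => ->; rewrite eqxx mulr1 subrr.
Qed.

(** Approximations improve by one weight at a time. The filtration by weight stands in for
    homogeneous components, whose invariance would need a separate argument. *)
Lemma approx_step (D : {group gT}) : (forall l, invariant rV D (tnth f l)) ->
  (forall N b, (0 < N)%N -> invariant rV D b -> wge d N b ->
    (forall b', invariant rV D b' -> exists a, wge d N (b' - (a \mPo f))) ->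
    exists a, wge d N.+1 (b - (a \mPo f))) ->
  forall b, invariant rV D b -> exists a, a \mPo f = b.
Proof.
move=> f_inv step b bD; apply: (approx_generated f_homog) => N.
elim: N b bD => [|N IHN] b bD; first by exists 0.
have [->|N0] := posnP N.
  by exists (b@_0%MM)%:MP; rewrite comp_mpolyC; apply: wge1_sub_const.
have [a aP] := IHN b bD.
have [|a' a'P] := step N (b - (a \mPo f)) N0 _ aP IHN.
  by apply: invariantB => //; apply: invariant_comp.
by exists (a + a'); rewrite rmorphD opprD addrA.
Qed.

(** In the difference of the products each term has a factor of weight at least 1 besides an error
    of weight at least N, which gains one weight. *)
Lemma wge_prod_approx N (u1 u2 : B) a1 a2 : (0 < N)%N ->
  wge d 1 u1 -> wge d 1 u2 -> wge d N (u1 - (a1 \mPo f)) -> wge d N (u2 - (a2 \mPo f)) ->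
  wge d N.+1 (u1 * u2 - ((a1 * a2) \mPo f)).
Proof.
move=> N0 u1P u2P a1P a2P; rewrite rmorphM mul_sub_mul.
apply: wgeD; first by rewrite -add1n; apply: wgeM.
rewrite -add1n; apply: wgeM => //; rewrite -[X in wge d 1 X](subKr u2).
by apply: wgeB => //; apply: wge_le a2P.
Qed.

(** Graded Nakayama: b is a combination of the f_l plus products of two invariants of positive
    weight, and such products are approximated one weight further than their factors. *)
Lemma splitting_generates : equivariant_splitting G rV d e f ->
  forall b, invariant rV G b -> exists a, a \mPo f = b.
Proof.
move=> hf; have f_inv l : invariant rV G (tnth f l) by have [] := splitting_inv_pos hf l.
apply: approx_step => // N b N0 bG bN IH.
have [c [s sP bE]] := splitting_span hf (conj bG (wge_le N0 bN)).
have : exists a, wge d N.+1 (\sum_(u <- s) u.1 * u.2 - (a \mPo f)).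
  elim: s sP {bE} => [_|u s IHs sP].
    by exists 0; rewrite big_nil comp_mpoly0 subrr; apply: wge_zero.
  have [|a aP] := IHs; first by move=> v vs; apply: sP; rewrite in_cons vs orbT.
  have [[u1G u1P] [u2G u2P]] := sP u (mem_head _ _).
  have [[a1 a1P] [a2 a2P]] := (IH _ u1G, IH _ u2G).
  exists (a1 * a2 + a); rewrite big_cons rmorphD addr_subACA.
  apply: wgeD; last exact: aP.
  exact: (wge_prod_approx N0 u1P u2P a1P a2P).
rewrite -bE => -[a aP]; exists (\sum_(i < m) c i *: 'X_i + a).
have -> : (\sum_(i < m) c i *: 'X_i + a) \mPo f = \sum_i c i *: tnth f i + (a \mPo f).
  rewrite rmorphD raddf_sum; congr (_ + _); apply: eq_bigr => i _.
  by rewrite /= comp_mpolyZ comp_mpolyXt.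
by rewrite opprD addrA.
Qed.

(* Euler's identity turns a relation between differentials into the statement
   that each invariant of positive degree lies in the ideal generated by the f_l. *)
Lemma grad_generates (D : {group gT}) : (forall l, invariant rV D (tnth f l)) ->
  (forall l, wge d 1 (tnth f l)) ->
  (forall b, invariant rV D b -> exists2 u : 'rV[B]_m,
     forall l, invariant rV D (u 0 l) & grad b = u *m jacobian f) ->
  forall b, invariant rV D b -> exists a, a \mPo f = b.
Proof.
move=> f_inv f_pos gradD; apply: approx_step => // N b N0 bD bN IH.
have [u uD gradE] := gradD b bD.
have /fin_all_exists[a aP] l := IH _ (uD l).
pose s := \sum_l (e l)%:R *: (a l * 'X_l).
exists ((N%:R)^-1 *: s); rewrite comp_mpolyZ.
have eulE : euler d b = \sum_l (e l)%:R *: (u 0 l * tnth f l).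
  rewrite euler_grad gradE -mulmxA mxE; apply: eq_bigr => l _.
  rewrite scalerAr -(@euler_whomog _ _ d _ _ (@f_homog l)) euler_grad; congr (_ * _).
  by rewrite !mxE; apply: eq_bigr => i _; rewrite !mxE.
have sE : s \mPo f = \sum_l (e l)%:R *: ((a l \mPo f) * tnth f l).
  rewrite raddf_sum; apply: eq_bigr => l _.
  by rewrite /= comp_mpolyZ rmorphM /= comp_mpolyXt.
have Nk : (N%:R : k) != 0 by rewrite -(prednK N0) natr_neq0.
have -> : b - N%:R^-1 *: (s \mPo f) = N%:R^-1 *: (N%:R *: b - (s \mPo f)).
  by rewrite scalerBr scalerA mulVf // scale1r.
apply: wgeZ.
have -> : N%:R *: b - (s \mPo f) = (euler d b - (s \mPo f)) - (euler d b - N%:R *: b).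
  by rewrite opprB [RHS]addrC subrKA.
apply: wgeB; last exact: euler_wge.
rewrite eulE sE -sumrB; apply: wge_sum => l _.
rewrite -scalerBr -mulrBl; apply: wgeZ; rewrite -addn1; exact: wgeM.
Qed.

End InvariantGenerators.

Section FixCodim.
Variables (k : fieldType) (gT : finGroupType) (Wt : {group gT}) (n : nat).
Variable rV : mx_representation k Wt n.

Lemma fix_codimE g : fix_codim rV g = \rank (rV g - 1%:M).
Proof. by rewrite /fix_codim /eigenspace mxrank_ker subKn // rank_leq_row. Qed.

End FixCodim.

(** * Generation of G by reflections and double reflections *)

Section DoubleReflections.
Variables (k : fieldType) (hk : [pchar k] =i pred0).
Variables (gT : finGroupType) (Wt G : {group gT}) (n : nat).
Variable rV : mx_representation k Wt n.
Hypothesis rV_faithful : mx_faithful rV.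
Hypothesis sGW : G \subset Wt.
Local Notation B := {mpoly k[n]}.
Variables (m c : nat) (f : m.-tuple B) (r : c.-tuple {mpoly k[m]}).
Hypothesis f_inv : forall l, invariant rV G (tnth f l).
Hypothesis f_gen : forall b, invariant rV G b -> exists a, a \mPo f = b.
Hypothesis r_rel : forall j, tnth r j \mPo f = 0.
Hypothesis r_gen : forall a, a \mPo f = 0 ->
  exists u : 'I_c -> {mpoly k[m]}, a = \sum_(j < c) u j * tnth r j.
Hypothesis cnm : (c + n = m)%N.
Variables (d : 'I_n -> nat) (hd : forall i, (0 < d i)%N) (e : 'I_m -> nat).
Hypothesis f_homog : forall l, whomog d (e l) (tnth f l).
Hypothesis f_pos : forall l, wge d 1 (tnth f l).

(** The gradient of an invariant and the rows of the Jacobian transform by the same matrix, so the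
    coefficients may be averaged over D. *)
Lemma grad_in_rows_inv (D : {group gT}) b : D \subset G ->
  invariant rV D b -> in_rows (jacobian f) (grad b) ->
  exists2 u : 'rV[B]_m, forall l, invariant rV D (u 0 l) & grad b = u *m jacobian f.
Proof.
move=> sDG bD [u uE]; pose N := (#|D|%:R^-1 : k).
have moved h : h \in D -> grad b = map_mx (mxact (rV h)) u *m jacobian f.
  move=> hD; have hG := subsetP sDG _ hD.
  have Jh : map_mx (mxact (rV h)) (jacobian f) *m (map_mx (@mpolyC n k) (rV h))^T = jacobian f.
    apply/row_matrixP=> l; rewrite row_mul -map_row.
    have -> : row l (jacobian f) = grad (tnth f l) by apply/rowP=> i; rewrite !mxE.
    by rewrite -grad_mxact f_inv.
  by rewrite -{1}(bD h hD) grad_mxact uE map_mxM -mulmxA Jh.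
exists (\row_l (N *: \sum_(h in D) mxact (rV h) (u 0 l))) => [l g gD|].
  rewrite mxE linearZ /=; congr (_ *: _).
  rewrite rmorph_sum [RHS](reindex_inj (mulgI g)) /=.
  apply: eq_big => [h|h hD]; first by rewrite groupMl.
  have inW := subsetP (subset_trans sDG sGW).
  exact: (esym (act_mul rV (inW _ gD) (inW _ hD) (u 0 l))).
have -> : \row_l (N *: \sum_(h in D) mxact (rV h) (u 0 l)) =
    N%:MP *: \sum_(h in D) map_mx (mxact (rV h)) u.
  apply/rowP=> l; rewrite !mxE summxE mul_mpolyC; congr (_ *: _).
  by apply: eq_bigr => h _; rewrite mxE.
rewrite -scalemxAl mulmx_suml -(eq_bigr _ moved) sumr_const -scaler_nat scalerA.
rewrite -mpolyC_nat -mpolyCM mulVf ?mpolyC1 ?scale1r //.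
by rewrite -(prednK (cardG_gt0 D)) natr_neq0.
Qed.

Theorem generated_by_double_reflections :
  <<[set g in G | reflection rV g || double_reflection rV g]>>%g = G.
Proof.
set S := [set g in G | _]; pose D := <<S>>%G.
have sDG : D \subset G by rewrite gen_subG; apply/subsetP=> g; rewrite inE => /andP[].
have D_big : {in G :\: D, forall g, (2 < \rank (rV g - 1%:M)%R)%N}.
  move=> g /setDP[gG NgD]; rewrite -fix_codimE.
  have : g \notin S by apply: contra NgD; apply: mem_gen.
  rewrite inE gG /= /reflection /double_reflection.
  have : fix_codim rV g != 0%N.
    rewrite fix_codimE mxrank_eq0 subr_eq0; apply: contraNneq NgD => g1.
    suff -> : g = 1%g by apply: group1.
    apply: (repr_inj rV_faithful); rewrite ?group1 ?(subsetP sGW) //.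
    by rewrite repr_mx1.
  by case: (fix_codim rV g) => [|[|[|j]]].
have gen b : invariant rV D b -> exists a, a \mPo f = b.
  apply: (grad_generates hk hd f_homog _ f_pos) => [l g /(subsetP sDG)|{}b bD].
    exact: f_inv.
  apply: grad_in_rows_inv => //.
  exact: (grad_in_rows hk rV_faithful sGW f_inv f_gen r_rel r_gen cnm sDG D_big).
(* Every D-invariant is now polynomial in [f], hence G-invariant; since D-invariants separate the
   orbits of D, each w in G agrees with an element of D. *)
apply/eqP; rewrite eqEsubset sDG; apply/subsetP=> w wG.
have sDW := subset_trans sDG sGW; have wW := subsetP sGW _ wG.
have [b bD v _|g gD] := @invariants_separate k hk gT Wt n rV D 1%:M w sDW wW.
  have [a aE] := gen b bD; have bG : invariant rV G b by rewrite -aE; apply: invariant_comp.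
  by rewrite -mxact_eval bG.
rewrite !mul1mx => /(repr_inj rV_faithful wW) -> //.
exact: (subsetP sDW).
Qed.

End DoubleReflections.

(** * The image of a reflection *)

Section FiniteOrderMatrices.
Variables (k : fieldType) (hk : [pchar k] =i pred0) (m : nat).

Lemma rank1_factor p q (A : 'M[k]_(p, q)) : \rank A = 1%N ->
  exists (u : 'cV[k]_p) (w : 'rV[k]_q), A = u *m w.
Proof.
move=> rk; have := mulmx_base A; move: (col_base A) (row_base A); rewrite rk.
by move=> u w <-; exists u, w.
Qed.

(* Matrices of finite order are semisimple, so 1 has no Jordan block. *)
Lemma finite_order_rank_sqr (T : 'M[k]_m) j : iter j.+1 (mulmx T) 1%:M = 1%:M ->
  (\rank (T - 1%:M)%R <= \rank ((T - 1%:M) *m (T - 1%:M))%R)%N.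
Proof.
move=> Tj; set N := T - 1%:M.
have sub : (kermx (N *m N) <= kermx N)%MS.
  apply/sub_kermxP; apply/row_matrixP=> i; rewrite row_mul row0.
  set u := row i _; pose w := u *m N.
  have wT : w *m T = w.
    have : w *m N = 0 by rewrite /w -mulmxA -row_mul mulmx_ker row0.
    by rewrite mulmxBr mulmx1 => /subr0_eq.
  have uT : u *m T = u + w by rewrite /w mulmxBr mulmx1 addrC subrK.
  have uTj l : u *m iter l (mulmx T) 1%:M = u + w *+ l.
    elim: l => [|l IHl]; first by rewrite mulmx1 mulr0n addr0.
    rewrite iterSr.
    have comm h : T *m iter h (mulmx T) 1%:M = iter h (mulmx T) 1%:M *m T.
      by elim: h => [|h IHh] /=; rewrite ?mulmx1 ?mul1mx // -mulmxA -IHh.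
    rewrite -iterSr /= comm mulmxA IHl mulmxDl uT -scaler_nat -scalemxAl wT.
    by rewrite scaler_nat -addrA -mulrS.
  have := uTj j.+1; rewrite Tj mulmx1 -[LHS]addr0 => /addrI/esym/eqP.
  by rewrite -scaler_nat scaler_eq0 (negPf (natr_neq0 hk j)) => /eqP.
have := mxrankS sub; rewrite !mxrank_ker => le.
have r1 := rank_leq_row N; have r2 := rank_leq_row (N *m N).
by rewrite -(subKn r1) -(subKn r2); apply: leq_sub2l.
Qed.

Variables (n : nat) (T : 'M[k]_m) (J : 'M[k]_(m, n)) (Y : 'M[k]_(n, m)).
Variables (i0 : 'I_n) (lam : k) (j : nat).
Hypothesis Tj : iter j.+1 (mulmx T) 1%:M = 1%:M.
Hypothesis TY : T - 1%:M = J *m Y.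
Hypothesis TJ : T *m J = J *m semi_diag i0 lam.

Lemma semi_diag_subr1 : semi_diag i0 lam - 1%:M =
  (lam - 1) *: ((delta_mx i0 0 : 'cV[k]_n) *m (delta_mx 0 i0 : 'rV[k]_n)).
Proof.
apply/matrixP=> i l; rewrite mul_delta_mx !mxE.
have [->|ni] := eqVneq i l; rewrite ?mulr1n ?mulr0n.
  by case: eqP => _; rewrite ?mulr1 // subrr mulr0.
rewrite subr0; have [iE|_] := eqVneq i i0; rewrite ?mulr0 //=.
have [lE|_] := eqVneq l i0; rewrite ?mulr0 //.
by rewrite iE lE eqxx in ni.
Qed.

Lemma subr1_J : (T - 1%:M) *m J = (lam - 1) *: (col i0 J *m delta_mx 0 i0).
Proof.
rewrite mulmxBl mul1mx TJ -[X in _ - X]mulmx1 -mulmxBr semi_diag_subr1.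
by rewrite -scalemxAr mulmxA -colE.
Qed.

Lemma subr1_eigen : (T - 1%:M) *m col i0 J = (lam - 1) *: col i0 J.
Proof.
rewrite {1}colE mulmxA subr1_J -scalemxAl -mulmxA mul_delta_mx.
by rewrite [delta_mx _ _](_ : _ = 1%:M) ?mulmx1 //; apply/matrixP=> i l; rewrite !ord1 !mxE.
Qed.

(** On the image of J, T - 1 is induced by [semi_diag i0 lam - 1%:M], of rank at most 1. With
    [finite_order_rank_sqr] this bounds the rank of T - 1 itself. *)
Lemma subr1_sqr : (T - 1%:M) *m (T - 1%:M) = (lam - 1) *: (col i0 J *m row i0 Y).
Proof. by rewrite {2}TY mulmxA subr1_J -scalemxAl -mulmxA -rowE. Qed.

Lemma eigen_trivial : lam = 1 -> T = 1%:M.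
Proof.
move=> lam1; apply/eqP; rewrite -subr_eq0 -mxrank_eq0 -leqn0.
apply: leq_trans (finite_order_rank_sqr Tj) _.
by rewrite subr1_sqr lam1 subrr scale0r mxrank0.
Qed.

(** Column [i0] of J is an eigenvector of T - 1 for lam - 1, so it spans the image of T - 1; writing
    T = 1 + u w, this eigenvalue is w u, and the determinant is 1 + w u. *)
Lemma eigen_reflection : lam != 1 -> col i0 J != 0 ->
  \rank (T - 1%:M) = 1%N /\ \det T = lam.
Proof.
move=> lam1 x0; set x := col i0 J in x0 *; have lam0 : lam - 1 != 0 by rewrite subr_eq0.
have rk : \rank (T - 1%:M) = 1%N.
  apply/eqP; rewrite eqn_leq; apply/andP; split.
    apply: leq_trans (finite_order_rank_sqr Tj) _.
    rewrite subr1_sqr; apply: leq_trans (mxrank_scale _ _) _.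
    exact: leq_trans (mxrankM_maxl _ _) (rank_leq_col _).
  rewrite lt0n mxrank_eq0; apply: contraNneq x0 => N0.
  have := subr1_eigen; rewrite N0 mul0mx => /esym/eqP.
  by rewrite scaler_eq0 (negPf lam0).
split=> //; have [u [w N_uw]] := rank1_factor rk.
have wx : x = u *m ((lam - 1)^-1 *: (w *m x)).
  by rewrite -scalemxAr mulmxA -N_uw subr1_eigen scalerA mulVf // scale1r.
rewrite -(subrK 1%:M T) addrC N_uw det_1_addMrank1.
pose z := (w *m x) 0 0.
have wxz : w *m x = z%:M by rewrite -mx11_scalar.
have xE : x = ((lam - 1)^-1 * z) *: u by rewrite {1}wx wxz scale_scalar_mx mul_mx_scalar.
have z0 : z != 0 by apply: contraNneq x0 => z0; rewrite xE z0 mulr0 scale0r.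
have : z = ((lam - 1)^-1 * z) * (w *m u) 0 0.
  by rewrite {1}/z {1}xE -scalemxAr mxE.
rewrite mulrAC -[LHS]mul1r => /(mulIf z0)/(congr1 ( *%R (lam - 1))).
by rewrite mulr1 mulrA divff // mul1r => <-; rewrite addrC subrK.
Qed.

End FiniteOrderMatrices.

Section AdaptedIndependence.
Variables (k : fieldType) (hk : [pchar k] =i pred0) (gT : finGroupType) (n : nat).
Variables (a : 'cV[k]_n) (K : 'rV[k]_n) (i0 : 'I_n) (D : {group gT}).
Hypotheses (Ka : K *m a = 1%:M) (ai0 : a i0 0 != 0).

(** After a linear change of coordinates the invariants are powers of the variables, and
    substituting powers is injective on monomials. *)
Lemma adapted_invariants_indep (P : {mpoly k[n]}) :
  P \mPo adapted_invariants a K i0 D = 0 -> P = 0.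
Proof.
pose eps i := if i == i0 then #|D| else 1%N.
pose t' := [tuple ('X_i : {mpoly k[n]}) ^+ eps i | i < n].
have -> : P \mPo adapted_invariants a K i0 D = mxact (adapted_basis a K i0) (P \mPo t').
  rewrite /mxact comp_mpolyA; apply: eq_comp_mpoly => i.
  rewrite !tnth_mktuple rmorphXn; congr (_ ^+ _).
  exact: (esym (mxactX (adapted_basis a K i0) i)).
move=> P0; have {}P0 : P \mPo t' = 0.
  by rewrite -[LHS]mxact1 -(adapted_basisK Ka ai0) mxactM P0 rmorph0.
pose sh (mon : 'X_{1..n}) : 'X_{1..n} := [multinom (eps i * mon i)%N | i < n].
have shE mon : 'X_[mon] \mPo t' = 'X_[sh mon].
  rewrite comp_mpolyX [RHS]mpolyXE_id; apply: eq_bigr => i _.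
  by rewrite tnth_mktuple mnmE exprM.
have sh_inj : injective sh.
  move=> u v /mnmP E; apply/mnmP=> i; have := E i; rewrite !mnmE => /eqP.
  by rewrite eqn_pmul2l; [move/eqP | rewrite /eps; case: eqP].
apply/mpolyP=> mon; rewrite mcoeff0; have := congr1 (mcoeff (sh mon)) P0.
rewrite mcoeff0 comp_mpolyEX raddf_sum /=.
have [mon_P|Nmon] := boolP (mon \in msupp P); last by rewrite (memN_msupp_eq0 Nmon).
rewrite (bigD1_seq mon) ?msupp_uniq //= big1 => [|u ne].
  by rewrite mcoeffZ shE mcoeffX eqxx mulr1 addr0.
by rewrite mcoeffZ shE mcoeffX (inj_eq sh_inj) (negPf ne) mulr0.
Qed.

End AdaptedIndependence.

(** * Differentials of the relations along a subspace fixed by s *)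

Section MovedRelations.
Variables (k : fieldType) (hk : [pchar k] =i pred0).
Variables (gT : finGroupType) (Wt G : {group gT}) (n : nat).
Variable rV : mx_representation k Wt n.
Local Notation B := {mpoly k[n]}.
Variables (m : nat) (f : m.-tuple B).
Variables (d : 'I_n -> nat) (e : 'I_m -> nat).
Hypothesis f_homog : forall l, whomog d (e l) (tnth f l).
Variable rW : mx_representation k (Wt / G)%g m.
Hypothesis f_equiv : induced_action rV f rW.
Hypothesis rel_act : {in (Wt / G)%g, forall x, forall a, ideal_of_image f a ->
     prod_span (positive_part e) (ideal_of_image f) (mxact (rW x) a - a)}.
Variables (s : gT) (P : 'M[k]_n).
Hypotheses (sW : s \in Wt) (Ps : P *m rV s = P).
Local Notation S := (rW (coset G s)).
Local Notation std := (fun _ : 'I_n => 1%N).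

(** The image of [P] is fixed by s, so this restricts pullbacks to a fixed subspace. Keeping a
    polynomial, instead of a value at a point, makes the order of vanishing at 0 available. *)
Definition moved_pullback (a : {mpoly k[m]}) : B := mxact P (a \mPo f).
Local Notation ev := moved_pullback.
Local Notation gam a := (map_mx moved_pullback (grad a)).

(** This is the failure of the restricted differential of a to be fixed by the image [S] of s. *)
Definition moved_grad a : 'rV[B]_m := gam a *m (map_mx (@mpolyC n k) (S - 1%:M))^T.
Local Notation del := moved_grad.

Lemma moved_grad_is_additive : additive del.
Proof.
move=> a b; rewrite /moved_grad -mulmxBl; congr (_ *m _); apply/rowP=> i.
by rewrite !mxE mderivB /moved_pullback !rmorphB.
Qed.

HB.instance Definition _ := GRing.isAdditive.Build {mpoly k[m]} 'rV[B]_m moved_grad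
  moved_grad_is_additive.

Lemma moved_grad_invariant a : mxact S a = a -> del a = 0.
Proof.
move=> Sa; have ga : gam a = gam a *m (map_mx (@mpolyC n k) S)^T.
  rewrite -{1}Sa grad_mxact; apply/rowP=> i; rewrite !mxE /moved_pullback.
  rewrite (rmorph_sum (comp_mpoly f)) rmorph_sum /=.
  apply: eq_bigr => l _; rewrite !mxE !rmorphM /= (f_equiv sW) -mxactM Ps /= comp_mpolyC.
  by rewrite mpolyC_mxact.
by rewrite /moved_grad map_mxB map_mx1 raddfB /= mulmxBr trmx1 mulmx1 -ga subrr.
Qed.

Lemma moved_grad_mul p q : q \mPo f = 0 -> del (p * q) = ev p *: del q.
Proof.
move=> q0; rewrite /moved_grad scalemxAl; congr (_ *m _); apply/rowP=> i.
rewrite !mxE mderivM /moved_pullback rmorphD !rmorphM /= q0 mulr0 add0r.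
by rewrite rmorphM.
Qed.

Lemma moved_gradC x q : del (x%:MP * q) = x%:MP *: del q.
Proof.
rewrite /moved_grad scalemxAl; congr (_ *m _); apply/rowP=> i.
rewrite !mxE mderiv_mulC /moved_pullback !rmorphM /= comp_mpolyC.
by rewrite mpolyC_mxact.
Qed.

(** The projection [P] need not respect the weights [d], so orders of vanishing are measured by
    ordinary degree, which every linear substitution preserves. *)
Lemma wge_std (b : B) : wge d 1 b -> wge std 1 b.
Proof.
move=> H mon /H; rewrite /weight; apply: contraTT; rewrite -!leqNgt !leqn0 !sum_nat_eq0.
move=> /forallP E; apply/forallP=> i; have := E i; rewrite muln1 /= => /eqP ->.
by rewrite mul0n.
Qed.

Lemma wge_mxact N (M : 'M[k]_n) (b : B) : wge std N b -> wge std N (mxact M b).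
Proof.
apply: wge_comp => l mon; rewrite tnth_mktuple => H.
have /msupp_sum_le/flattenP[_ /mapP[j _ ->]] := H.
move/msuppZ_le; rewrite msuppX inE => /eqP ->.
rewrite /weight (bigD1 j) //= mnm1E eqxx big1 // => i ij.
by rewrite mnm1E eq_sym (negPf ij).
Qed.

(* The average of a over the group is killed, and the difference lies in A_+ I, so
   an induction on the order of vanishing applies. *)
Lemma moved_grad_relation a : a \mPo f = 0 -> del a = 0.
Proof.
move=> a0; suff H N b : b \mPo f = 0 -> forall i, wge std N (del b 0 i).
  apply/rowP=> i; rewrite [RHS]mxE; apply/mpolyP=> mon; rewrite mcoeff0.
  apply: memN_msupp_eq0; apply/negP=> mon_i.
  by have := H (weight std mon).+1 a a0 i mon mon_i; rewrite ltnn.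
elim: N b => [|N IHN] b b0 i; first exact: wge0.
pose W := (Wt / G)%G; pose N1 := (#|W|%:R^-1 : k).
pose avg := \sum_(x in W) mxact (rW x) b.
have Nk : (#|W|%:R : k) != 0 by rewrite -(prednK (cardG_gt0 W)) natr_neq0.
have sW' : coset G s \in W by apply: mem_quotient.
have avgS : mxact S avg = avg.
  rewrite rmorph_sum [RHS](reindex_inj (mulgI (coset G s))) /=.
  apply: eq_big => [x|x xW]; first by rewrite groupMl.
  exact: (esym (act_mul rW sW' xW b)).
have wge_diff x : x \in W -> wge std N.+1 (del (mxact (rW x) b - b) 0 i).
  move=> xW; have [us usP ->] := rel_act xW b0.
  rewrite (raddf_sum moved_grad) summxE big_seq; apply: wge_sum => u /usP[u1 u2].
  rewrite /= moved_grad_mul // mxE -[N.+1]add1n; apply: wgeM; last exact: IHN.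
  by apply/wge_mxact/wge_std/(wge_comp f_homog).
have bE : b = N1%:MP * (avg - \sum_(x in W) (mxact (rW x) b - b)).
  rewrite sumrB opprB addrC subrK sumr_const -scaler_nat mul_mpolyC scalerA.
  by rewrite mulVf // scale1r.
have delE : del b = - (N1%:MP *: \sum_(x in W) del (mxact (rW x) b - b)).
  rewrite {1}bE moved_gradC (raddfB moved_grad) /= (moved_grad_invariant avgS).
  by rewrite (raddf_sum moved_grad) sub0r scalerN.
rewrite delE mxE mxE summxE; apply/wgeN/wgeMl/wge_sum => x xW.
exact: wge_diff.
Qed.

End MovedRelations.

Section GoodQuotient.
Variables (k : fieldType) (hk : [pchar k] =i pred0).
Variables (gT : finGroupType) (Wt G : {group gT}) (n : nat).
Variable rV : mx_representation k Wt n.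
Hypothesis rV_faithful : mx_faithful rV.
Hypothesis nGW : (G <| Wt)%g.
Local Notation B := {mpoly k[n]}.
Variables (m c : nat) (f : m.-tuple B) (r : c.-tuple {mpoly k[m]}).
Hypothesis f_inv : forall l, invariant rV G (tnth f l).
Hypothesis f_gen : forall b, invariant rV G b -> exists a, a \mPo f = b.
Hypothesis r_rel : forall j, tnth r j \mPo f = 0.
Hypothesis r_gen : forall a, a \mPo f = 0 ->
  exists u : 'I_c -> {mpoly k[m]}, a = \sum_(j < c) u j * tnth r j.
Hypothesis cnm : (c + n = m)%N.
Variables (d : 'I_n -> nat) (e : 'I_m -> nat).
Hypothesis f_homog : forall l, whomog d (e l) (tnth f l).
Variable rW : mx_representation k (Wt / G)%g m.
Hypothesis f_equiv : induced_action rV f rW.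
Hypothesis rel_act : {in (Wt / G)%g, forall x, forall a, ideal_of_image f a ->
     prod_span (positive_part e) (ideal_of_image f) (mxact (rW x) a - a)}.

Let sGW : G \subset Wt := normal_sub nGW.

Lemma quotient_faithful_elt w : w \in Wt -> rW (coset G w) = 1%:M -> w \in G.
Proof.
move=> wW w1; have [b bG v _|g gG] := @invariants_separate k hk gT Wt n rV G 1%:M w sGW wW.
  have [a aE] := f_gen bG; rewrite -mxact_eval -aE -(f_equiv wW) w1.
  by rewrite mxact1.
by rewrite !mul1mx => /(repr_inj rV_faithful wW) -> //; apply: (subsetP sGW).
Qed.

Lemma quotient_faithful : mx_faithful rW.
Proof.
apply/subsetP=> x; rewrite !inE mul1mx => /andP[/morphimP[w Nw wW ->] /eqP w1].
by rewrite /= coset_id ?eqxx //; apply: quotient_faithful_elt.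
Qed.

Lemma order_iter s : s \in Wt ->
  iter #[coset G s]%g.-1.+1 (mulmx (rW (coset G s))^T) 1%:M = 1%:M.
Proof.
move=> sW; have xW : coset G s \in (Wt / G)%g by apply: mem_quotient.
have it l : iter l (mulmx (rW (coset G s))^T) 1%:M = (rW (coset G s ^+ l)%g)^T.
  elim: l => [|l IHl]; first by rewrite expg0 repr_mx1 trmx1.
  by rewrite /= IHl -trmx_mul -repr_mxM ?groupX // -expgSr.
by rewrite it (prednK (order_gt0 _)) expg_order repr_mx1 trmx1.
Qed.

Section Hyperplane.
Variable a : 'cV[k]_n.
Hypothesis a0 : a != 0.

Definition hyper_stab : {group gT} := [group of rstab rV (kermx a)].
Local Notation E := hyper_stab.
Local Notation ram := #|G :&: E|.

Lemma hyper_stab_sub : E \subset Wt. Proof. exact: rstab_sub_Wt. Qed.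

Lemma hyper_stab_fix : {in E, forall g (v : 'rV_n), v *m a = 0 -> v *m rV g = v}.
Proof.
move=> g /rstabP[gW gU] v /sub_kermxP/submxP[x ->].
by rewrite -mulmxA gU.
Qed.

Lemma zeta_exists : exists (K : 'rV[k]_n) i0, [/\ K *m a = 1%:M, a i0 0 != 0 &
  {in E, forall g, rV g = 1%:M + (\det (rV g) - 1) *: (a *m K)}].
Proof.
have [K [zeta [Ka rVE]]] :=
  hyperplane_stab_structure hk rV_faithful a0 hyper_stab_sub hyper_stab_fix.
have [i0 ai0] : exists i0, a i0 0 != 0 by apply/cV0Pn.
exists K, i0; split=> // g gE; rewrite (zeta_det Ka rVE gE).
exact: rVE.
Qed.

Lemma hyper_det_eq1 g : g \in E -> (\det (rV g) == 1) = (g == 1%g).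
Proof.
have [K [i0 [Ka _ rVE]]] := zeta_exists => gE.
exact: (zeta_inj rV_faithful hyper_stab_sub Ka rVE gE).
Qed.

Lemma hyper_detX g j : g \in E -> \det (rV (g ^+ j)%g) = \det (rV g) ^+ j.
Proof.
have [K [i0 [Ka _ rVE]]] := zeta_exists => gE.
exact: (zetaX hyper_stab_sub Ka rVE j gE).
Qed.

Lemma hyper_stab_sub_cyclic : cyclic E.
Proof.
have [K [i0 [Ka _ rVE]]] := zeta_exists.
exact: (hyperplane_stab_cyclic rV_faithful hyper_stab_sub Ka rVE (subxx E)).
Qed.

(** In the coordinates adapted to [G :&: E], s acts by the single scalar [lam]. In the last clause
    the point v certifies that [lf a] does not divide q, so that the exponent is the exact
    multiplicity. *)
Theorem hyperplane_image s : s \in E ->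
  let S := rW (coset G s) in let lam := \det (rV s) ^+ ram in
  if lam == 1 then coset G s = 1%g else
  [/\ \rank (S - 1%:M) = 1%N, \det S = lam &
      forall u u' : 'cV[k]_m, u != 0 -> u = (S - 1%:M) *m u' ->
      exists (v : 'rV[k]_n) q, [/\ v *m a = 0, q.@[v 0] != 0 &
        lf u \mPo f = q * lf a ^+ ram]].
Proof.
move=> sE S lam; have [K [i0 [Ka ai0 rVE]]] := zeta_exists.
have sW : s \in Wt := subsetP hyper_stab_sub _ sE.
have EU g : (g \in E) = (g \in rstab rV (kermx a)) by [].
have [v [F [q [X [M [va fF qv eqq]]]]]] :=
  adapted_key hk rV_faithful sGW f_inv f_gen r_rel r_gen a0 Ka ai0 hyper_stab_sub rVE EU.
set t := adapted_invariants a K i0 _ in fF eqq.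
pose L := semi_diag i0 lam; pose J := mx_at v (partial_mx t F).
pose FF u := lf u \mPo F.
have FFt u : FF u \mPo t = lf u \mPo f.
  by rewrite /FF comp_mpolyA; apply: eq_comp_mpoly => l; rewrite tnth_mktuple fF.
have act_t (P : B) : mxact (rV s) (P \mPo t) = mxact L P \mPo t.
  transitivity (P \mPo [tuple mxact (rV s) (tnth t i) | i < n]); first exact: comp_mpolyA.
  rewrite [in RHS]/mxact [RHS]comp_mpolyA; apply: eq_comp_mpoly => i.
  rewrite [LHS]tnth_mktuple (act_adapted_invariants Ka rVE) // ![in RHS]tnth_mktuple.
  rewrite (raddf_sum (comp_mpoly t)) (bigD1 i) //= big1 => [|j ji].
    by rewrite addr0 comp_mpolyZ comp_mpolyXt !mxE eqxx mulr1n.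
  by rewrite !mxE (negPf ji) mulr0n scale0r comp_mpoly0.
(* Equivariance is known after substitution of [t]; algebraic independence of [t] lifts it to the
   polynomials [F]. *)
have FFS u : FF (S *m u) = mxact L (FF u).
  apply/eqP; rewrite -subr_eq0; apply/eqP.
  apply: (@adapted_invariants_indep k gT n a K i0 (G :&: E)%G Ka ai0).
  by rewrite rmorphB /= -/t -act_t !FFt -(f_equiv sW) mxact_lf subrr.
(* [tau] is the image of v in the quotient by [G :&: E]. As v lies on the hyperplane, its coordinate
   [i0] is 0, so it is fixed by [L]. *)
pose tau : 'rV[k]_n := \row_i (tnth t i).@[v 0].
have ev_t (b : B) : (b \mPo t).@[v 0] = b.@[tau 0].
  by rewrite comp_mpoly_meval; apply: meval_eq => i; rewrite mxE.
have tau_i0 : tau 0 i0 = 0.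
  rewrite mxE tnth_mktuple eqxx rmorphXn /= lf_eval col_adapted_i0 va mxE.
  by rewrite -(prednK (cardG_gt0 (G :&: E)%G)) expr0n.
have tauL : tau *m L = tau.
  apply/rowP=> i; rewrite mul_mx_diag !mxE; case: eqP => [->|_]; last by rewrite mulr1.
  by have := tau_i0; rewrite mxE => ->; rewrite mul0r.
have J_FF u : map_mx (meval (tau 0)) (grad (FF u)) = u^T *m J.
  rewrite /FF grad_comp grad_lf !map_mxM /=; congr (_ *m _).
    by apply/rowP=> l; rewrite !mxE /= comp_mpolyC mevalC.
  by apply/matrixP=> l i; rewrite !mxE ev_t.
have TJ : S^T *m J = J *m L.
  apply/row_matrixP=> l; rewrite !row_mul; pose u : 'cV[k]_m := delta_mx l 0.
  have uT : u^T = delta_mx 0 l by rewrite trmx_delta.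
  have := J_FF (S *m u); rewrite FFS grad_mxact map_mxM trmx_mul uT -rowE => <-.
  have -> : map_mx (meval (tau 0)) (map_mx (mxact L) (grad (FF u))) = row l J.
    rewrite rowE -uT -J_FF; apply/rowP=> i; rewrite !mxE.
    by rewrite mxact_eval tauL.
  congr (_ *m _); apply/matrixP=> i j; rewrite !mxE /= mevalC.
  by have [->|_] := eqVneq i j.
have Ps : (1%:M - a *m K) *m rV s = 1%:M - a *m K.
  rewrite rVE // mulmxDr mulmx1 -scalemxAr mulmxBl mul1mx mulmxA -(mulmxA a) Ka.
  by rewrite mulmx1 subrr scaler0 addr0.
have rho_fixed : mx_at v (relation_mx f r) *m (S - 1%:M)^T = 0.
  apply/row_matrixP=> j; rewrite row_mul row0.
  have := moved_grad_relation hk f_homog f_equiv rel_act sW Ps (r_rel j).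
  rewrite /moved_grad => /(congr1 (mx_at v)); rewrite /mx_at map_mxM map_mx0 => <-.
  congr (_ *m _).
    apply/rowP=> l; rewrite !mxE /= /moved_pullback mxact_eval mulmxBr mulmx1 mulmxA.
    by rewrite va mul0mx subr0.
  by apply/matrixP=> i l; rewrite !mxE /= mevalC.
(* The term containing the relation matrix is killed by [rho_fixed], so S^T - 1 factors through
   J. *)
have TY : S^T - 1%:M = J *m ((q.@[v 0])^-1 *: (mx_at v X *m (S - 1%:M)^T)).
  have := congr1 (fun A => mx_at v A *m (S - 1%:M)^T) eqq.
  rewrite /mx_at map_scalar_mx /= map_mxD !map_mxM /= mulmxDl -!mulmxA.
  rewrite rho_fixed mulmx0 addr0 mul_scalar_mx => E1.
  rewrite -scalemxAr -E1 scalerA mulVf // scale1r linearB /= trmx1.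
  by [].
(* At v the relation matrix has rank at most c, so the identity and c + n = m force J to have rank
   n. *)
have J0 : col i0 J != 0.
  have rkJ : (n <= \rank J)%N.
    rewrite -(leq_add2l c) cnm; apply: leq_trans (key_rank eqq qv) _.
    by rewrite addnC leq_add2r rank_leq_row.
  have /row_fullP[N NJ] : row_full J.
    by rewrite /row_full eqn_leq rank_leq_col.
  apply: contraTneq isT => J0; have := congr1 (fun A : 'M_n => A i0 i0) NJ.
  rewrite !mxE eqxx big1 => [/esym/eqP|l _]; first by rewrite oner_eq0.
  by have /colP/(_ l) := J0; rewrite [LHS]mxE [RHS]mxE => ->; rewrite mulr0.
have Tj := order_iter sW.
case: eqP => [lam1|/eqP lam1].
  have := eigen_trivial hk Tj TY TJ lam1 => /(congr1 trmx); rewrite trmxK trmx1 => S1.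
  by apply: coset_id; apply: quotient_faithful_elt.
have [rk detT] := eigen_reflection hk Tj TY TJ lam1 J0.
have trS : S - 1%:M = (S^T - 1%:M)^T by rewrite linearB /= trmxK trmx1.
split; [by rewrite trS mxrank_tr | by rewrite -det_tr |].
move=> u u' u0 uE.
(* Since u lies in the image of S - 1, [FF u] is a difference L x - x, and [L] changes only the
   variable ['X_i0]. *)
have [F' FE] : exists F', FF u = F' * 'X_i0.
  have -> : FF u = mxact L (FF u') - FF u'.
    by rewrite -FFS -rmorphB -raddfB uE mulmxBl mul1mx.
  rewrite -[X in _ - X]comp_mpoly_id; apply: (comp_mpoly_congr (J := dvdmp 'X_i0)).
  - by move=> x y; apply: dvdmpD.
  - by move=> b x; apply: dvdmp_mull.
  - exact: dvdmp0.
  move=> i; rewrite !tnth_mktuple (bigD1 i) //= big1 => [|j ji]; last first.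
    by rewrite !mxE (negPf ji) mulr0n scale0r.
  rewrite addr0 -[X in _ - X]scale1r -scalerBl !mxE eqxx mulr1n.
  case: eqP => [->|_]; last by rewrite subrr scale0r; apply: dvdmp0.
  by exists (lam - 1)%:MP; rewrite mul_mpolyC.
exists v, (F' \mPo t); split=> //; last first.
  by rewrite -FFt FE rmorphM /= comp_mpolyXt tnth_mktuple eqxx col_adapted_i0.
have F'E : F'.@[tau 0] = (u^T *m col i0 J) 0 0.
  have := congr1 (fun A : 'rV_n => A 0 i0) (J_FF u).
  rewrite FE !mxE mderivM mevalD !mevalM mevalXU tau_i0 mulr0 add0r.
  rewrite mderivX mnm1E eqxx -[X in (X - _)%MM]add0m addmK mpolyX0 scale1r meval1 mulr1 => ->.
  by apply: eq_bigr => l _; rewrite !mxE.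
(* The column u spans the image of S - 1. If its transpose killed column [i0] of J, so would S^T -
   1, although that column is an eigenvector for lam - 1, which is nonzero. *)
rewrite ev_t F'E; apply: contraNneq J0 => uJ0.
have /rank1_factor[u1 [w SE]] : \rank (S - 1%:M) = 1%N by rewrite trS mxrank_tr.
have uu1 : u = (w *m u') 0 0 *: u1.
  by rewrite uE SE -mulmxA {1}[w *m u']mx11_scalar mul_mx_scalar.
have z0 : (w *m u') 0 0 != 0 by apply: contraNneq u0 => z0; rewrite uu1 z0 scale0r.
have u1J : u1^T *m col i0 J = 0.
  apply/matrixP=> i j; rewrite !ord1 [RHS]mxE; apply: (mulfI z0).
  by rewrite mulr0 -uJ0 uu1 linearZ /= -scalemxAl [RHS]mxE.
have := subr1_eigen TJ; have -> : S^T - 1%:M = (u1 *m w)^T.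
  by rewrite -SE linearB /= trmx1.
rewrite trmx_mul -mulmxA u1J mulmx0 => /esym/eqP.
by rewrite scaler_eq0 subr_eq0 (negPf lam1).
Qed.

End Hyperplane.
End GoodQuotient.

(** * Linear forms and reflecting hyperplanes *)

Section LinearForms.
Variables (k : fieldType) (n : nat).
Local Notation B := {mpoly k[n]}.

Lemma lf_homog (a : 'cV[k]_n) : lf a \is 1.-homog.
Proof.
by apply: rpred_sum => i _; apply: dhomogZ; rewrite dhomogX /= mdeg1.
Qed.

Definition linear_coefs (b : B) : 'cV[k]_n := \col_i b@_U_(i).

Lemma homog1_lf (b : B) : b \is 1.-homog -> b = lf (linear_coefs b).
Proof.
move=> b1; apply/mpolyP=> mon; rewrite raddf_sum /=.
have [/mdeg1P[i /eqP ->]|Nmon] := boolP (mdeg mon == 1%N).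
  rewrite (bigD1 i) //= big1 => [|j ji]; rewrite mcoeffZ mcoeffXU ?mxE.
    by rewrite eqxx mulr1 addr0.
  by rewrite (negPf ji) mulr0.
rewrite (dhomog_nemf_coeff b1 Nmon) big1 // => i _; rewrite mcoeffZ mcoeffX.
by case: eqP => [E|_]; rewrite ?mulr0 //; rewrite -E mdeg1 in Nmon.
Qed.

Definition is_form (U : 'M[k]_n) (a : 'cV[k]_n) : Prop :=
  forall v : 'rV_n, (v <= U)%MS = (v *m a == 0).

Lemma rV1_eq0 (A : 'M[k]_1) : (A == 0) = (A 0 0 == 0).
Proof.
apply/eqP/eqP=> [->|A0]; first by rewrite mxE.
by apply/matrixP=> i j; rewrite !ord1 A0 mxE.
Qed.

Lemma defining_form (U : 'M[k]_n) (b : B) :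
  linform_defining U b -> b = lf (linear_coefs b) /\ is_form U (linear_coefs b).
Proof.
case=> /homog1_lf E H; split=> // v.
by rewrite H E lf_eval -rV1_eq0 -E.
Qed.

Lemma form_defining (U : 'M[k]_n) a : is_form U a -> linform_defining U (lf a).
Proof. by move=> H; split=> [|v]; rewrite ?lf_homog // H lf_eval rV1_eq0. Qed.

Lemma form_vanishing (U : 'M[k]_n) a : is_form U a -> linform_vanishing U (lf a).
Proof.
by move=> H; split=> [|v]; rewrite ?lf_homog // H lf_eval rV1_eq0 => /eqP.
Qed.

Lemma vanishing_form (U : 'M[k]_n) (b : B) : linform_vanishing U b ->
  exists2 a, b = lf a & forall v : 'rV_n, (v <= U)%MS -> v *m a = 0.
Proof.
case=> /homog1_lf -> H; exists (linear_coefs b) => // v /H.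
by rewrite lf_eval => /eqP; rewrite -rV1_eq0 => /eqP.
Qed.

Lemma form_unique (U : 'M[k]_n) a a' : a != 0 -> is_form U a ->
  (forall v : 'rV_n, (v <= U)%MS -> v *m a' = 0) -> exists z, a' = z *: a.
Proof.
move=> /col_left_inv[K Ka] Ua Ua'; exists ((K *m a') 0 0).
have P0 : (1%:M - a *m K) *m a' = 0.
  apply/row_matrixP=> i; rewrite row_mul row0; apply: Ua'.
  by rewrite Ua -row_mul mulmxBl mul1mx -mulmxA Ka mulmx1 subrr row0.
move/eqP: P0; rewrite mulmxBl mul1mx subr_eq0 => /eqP {1}->.
by rewrite -mulmxA {1}[K *m a']mx11_scalar mul_mx_scalar.
Qed.

Lemma col_span_of_ker p (A : 'M[k]_(n, p)) (u : 'cV[k]_n) :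
  (forall v : 'rV_n, v *m A = 0 -> v *m u = 0) -> exists u', u = A *m u'.
Proof.
move=> H; have : (u^T <= A^T)%MS.
  rewrite submxE; apply/eqP; apply: trmx_inj; rewrite trmx_mul trmxK trmx0.
  apply/row_matrixP=> i; rewrite row_mul row0; apply: H.
  by rewrite -row_mul -[X in _ *m X]trmxK -trmx_mul mulmx_coker trmx0 row0.
by case/submxP=> D DE; exists D^T; apply: trmx_inj; rewrite trmx_mul trmxK.
Qed.

End LinearForms.

Section Arrangement.
Variables (k : fieldType) (gT : finGroupType) (Wt : {group gT}) (n : nat).
Variable rV : mx_representation k Wt n.

Lemma arrangementP H : reflect
  (exists s, [/\ s \in Wt, reflection rV s & H = fix_space rV s]) (H \in arrangement rV).
Proof.
rewrite mem_undup; apply: (iffP mapP) => [[s]|[s [sW rs ->]]].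
  by rewrite mem_filter mem_enum => /andP[rs sW] ->; exists s.
by exists s; rewrite // mem_filter rs mem_enum.
Qed.

Lemma sub_fix_space s (v : 'rV[k]_n) : (v <= fix_space rV s)%MS = (v *m rV s == v).
Proof.
rewrite genmxE; apply/eigenspaceP/eqP => [->|->]; by rewrite scale1r.
Qed.

Lemma reflectionE s : reflection rV s = (\rank (rV s - 1%:M) == 1%N).
Proof. by rewrite /reflection fix_codimE. Qed.

Lemma fix_space_eq s s' :
  (forall v : 'rV_n, (v *m rV s == v) = (v *m rV s' == v)) -> fix_space rV s = fix_space rV s'.
Proof.
move=> E; have E' (v : 'rV_n) :
    (v <= eigenspace (rV s) 1)%MS = (v <= eigenspace (rV s') 1)%MS.
  by have := E v; rewrite -!sub_fix_space !genmxE.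
by apply/genmxP/andP; split; apply/rV_subP=> v; rewrite E'.
Qed.

Lemma reflection_form s : reflection rV s ->
  exists a w, [/\ a != 0, w != 0, rV s - 1%:M = a *m w & is_form (fix_space rV s) a].
Proof.
rewrite reflectionE => /eqP rk; have [a [w E]] := rank1_factor rk.
have N0 : rV s - 1%:M != 0 by rewrite -mxrank_eq0 rk.
have a0 : a != 0 by apply: contraNneq N0 => a0; rewrite E a0 mul0mx.
have w0 : w != 0 by apply: contraNneq N0 => w0; rewrite E w0 mulmx0.
exists a, w; split=> // v; rewrite sub_fix_space -subr_eq0 -{2}[v]mulmx1 -mulmxBr E mulmxA.
apply/eqP/eqP=> [H|->]; last by rewrite mul0mx.
have /cV0Pn[i wi] : w^T != 0 by rewrite trmx_eq0.
apply/eqP; rewrite rV1_eq0; have := congr1 (fun A : 'rV_n => A 0 i) H.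
rewrite [v *m a]mx11_scalar mul_scalar_mx !mxE eqxx mulr1n => /eqP.
by rewrite mulf_eq0 mxE in wi *; rewrite (negPf wi) orbF.
Qed.

Lemma arrangement_form_eq H H' a : H \in arrangement rV -> H' \in arrangement rV ->
  is_form H a -> is_form H' a -> H = H'.
Proof.
case/arrangementP=> s [_ _ ->] /arrangementP[s' [_ _ ->]] Ha H'a.
by apply: fix_space_eq => v; rewrite -!sub_fix_space Ha H'a.
Qed.

Lemma arrangement_form_neq0 H a : H \in arrangement rV -> is_form H a -> a != 0.
Proof.
case/arrangementP=> s [_ rs ->] Ha; apply: contraTneq rs => a0.
rewrite reflectionE (_ : rV s - 1%:M = 0) ?mxrank0 //.
apply/row_matrixP=> i; rewrite row0 linearB /= rowE row1.
have := Ha (delta_mx 0 i); rewrite a0 mulmx0 eqxx sub_fix_space => /eqP ->.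
by rewrite subrr.
Qed.

Lemma rstab_form U a : is_form U a -> rstab rV U = rstab rV (kermx a).
Proof.
move=> Ua; have E (U' : 'M_n) g : is_form U' a ->
    (U' *m rV g == U') <-> (forall v : 'rV_n, v *m a = 0 -> v *m rV g = v).
  move=> U'a; split=> [/eqP U'g v va|H].
    have /submxP[x ->] : (v <= U')%MS by rewrite U'a va.
    by rewrite -mulmxA U'g.
  apply/eqP/row_matrixP=> i; rewrite row_mul H //.
  by apply/eqP; rewrite -U'a row_sub.
have ka : is_form (kermx a) a by move=> v; apply/sub_kermxP/eqP.
apply/setP=> g; rewrite !inE; congr (_ && _); apply/idP/idP => /E.
  by move=> /(_ Ua)/(E _ g ka).
by move=> /(_ ka)/(E _ g Ua).
Qed.

End Arrangement.

(** * Divisors of products of linear forms *)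

Lemma rmorph_horner_sub (R : comNzRingType) (sigma : {rmorphism R -> R}) (p : {poly R}) y :
  p.[sigma y] - sigma p.[y] = \sum_(i < size p) (p`_i - sigma p`_i) * sigma y ^+ i.
Proof.
rewrite !horner_coef rmorph_sum -sumrB; apply: eq_bigr => i _.
by rewrite rmorphM rmorphXn mulrBl.
Qed.

Section ConjugateProduct.
Variables (R : comNzRingType) (gT : finGroupType) (D : {group gT}).
Variable a : gT -> {rmorphism R -> R}.
Hypothesis a1 : a 1%g =1 id.
Hypothesis aM : {in D &, forall g g' b, a (g * g')%g b = a g (a g' b)}.

(* The polynomial with roots the conjugates of [y] has invariant coefficients: evaluate it
   at [sigma y]. *)
Lemma prod_conjugates_congr (sigma : {rmorphism R -> R}) h y :
  (forall b, {in D, forall g, a g b = b} -> exists q, sigma b - b = q * h) ->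
  exists q, \prod_(g in D) (sigma y - a g y) = q * h.
Proof.
move=> Hh; pose p : {poly R} := \prod_(g in D) ('X - (a g y)%:P).
have p_inv i : {in D, forall g, a g p`_i = p`_i}.
  move=> g gD; rewrite -[LHS](coef_map (a g)) (_ : map_poly _ p = p) // /p.
  rewrite rmorph_prod [in RHS](reindex_inj (mulgI g)) /=.
  apply: eq_big => [b|b bD]; first by rewrite groupMl.
  by rewrite map_polyXsubC -aM.
have -> : \prod_(g in D) (sigma y - a g y) = p.[sigma y] - sigma p.[y].
  have -> : p.[y] = 0 by rewrite horner_prod (bigD1 1%g) //= hornerXsubC a1 subrr mul0r.
  by rewrite rmorph0 subr0 horner_prod; apply: eq_bigr => g _; rewrite hornerXsubC.
rewrite rmorph_horner_sub; elim/big_ind: _ => [|x x' [q ->] [q' ->]|i _].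
- by exists 0; rewrite mul0r.
- by exists (q + q'); rewrite mulrDl.
have [q E] := Hh _ (p_inv i); exists (- (q * sigma y ^+ i)).
by rewrite -opprB E mulNr mulNr mulrAC.
Qed.

End ConjugateProduct.

Section LinearFactors.
Variables (k : fieldType) (n : nat).
Local Notation B := {mpoly k[n]}.
Implicit Types (a c : 'cV[k]_n) (h q : B).

Lemma lf_neq0 a : a != 0 -> lf a != 0 :> B.
Proof. by rewrite lf_eq0. Qed.

Lemma mpoly_mul_eq1 h q : h * q = 1 -> exists C : k, h = C%:MP.
Proof.
by rewrite mulrC => /mpoly_intro_unit/andP[/eqP -> _]; exists h@_0%MM.
Qed.

Lemma divisor_of_forms (s : seq 'cV[k]_n) h q : {in s, forall a, a != 0} ->
  h * q = \prod_(a <- s) lf a ->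
  exists (C : k) s', {subset s' <= s} /\ h = C%:MP * \prod_(a <- s') lf a.
Proof.
elim: s h q => [|a s IHs] h q s0.
  rewrite big_nil => /mpoly_mul_eq1[C ->].
  by exists C, [::]; split=> //; rewrite big_nil mulr1.
rewrite big_cons => hq; have a0 : a != 0 by apply: s0; rewrite mem_head.
have s0' : {in s, forall a, a != 0} by move=> b bs; apply: s0; rewrite inE bs orbT.
have : dvdmp (lf a) (h * q) by exists (\prod_(j <- s) lf j); rewrite hq mulrC.
case/(lf_prime a0) => -[p pE]; rewrite pE in hq *.
  have [|C [s' [sub ->]]] := IHs p q s0'.
    apply: (mulfI (lf_neq0 a0)); rewrite -hq; ring.
  exists C, (a :: s'); split; last by rewrite big_cons; ring.
  by move=> b; rewrite !inE => /orP[->|/sub ->] //; rewrite orbT.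
have [|C [s' [sub ->]]] := IHs h p s0'.
  apply: (mulfI (lf_neq0 a0)); rewrite -hq; ring.
by exists C, s'; split=> // b /sub; rewrite inE orbC => ->.
Qed.

Lemma multiplicity_unique a q q' i j : a != 0 ->
  ~ dvdmp (lf a) q -> ~ dvdmp (lf a) q' -> q * lf a ^+ i = q' * lf a ^+ j -> i = j.
Proof.
move=> a0; wlog le_ij : i j q q' / (i <= j)%N => [H Nq Nq' E|].
  case/orP: (leq_total i j) => le; first exact: H le Nq Nq' E.
  exact/esym/(H _ _ _ _ le Nq' Nq (esym E)).
move=> Nq _; rewrite -{1}(subnK le_ij) exprD mulrA => E.
have {E} : q = q' * lf a ^+ (j - i).
  by apply: mulIf E; rewrite expf_neq0 ?lf_neq0.
case: (posnP (j - i)) => [/eqP|/prednK <- E].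
  by rewrite subn_eq0 => le _; apply/eqP; rewrite eqn_leq le_ij.
by case: Nq; exists (q' * lf a ^+ (j - i).-1); rewrite E exprSr mulrA.
Qed.

Lemma collect_forms (T : eqType) (F : seq T) (al : T -> 'cV[k]_n) (s : seq 'cV[k]_n) :
  uniq F -> {in s, forall a, exists2 H, H \in F & exists t, a = t *: al H} ->
  exists (C : k) (c : T -> nat), \prod_(a <- s) lf a =
    C%:MP * \prod_(H <- F) lf (al H) ^+ c H.
Proof.
move=> uF; elim: s => [|a s IHs] Hs.
  by exists 1, (fun=> 0%N); rewrite big_nil mpolyC1 mul1r big1.
have [H HF [t aE]] : exists2 H, H \in F & exists t, a = t *: al H by apply: Hs; rewrite mem_head.
have [b bs|C [c E]] := IHs; first by apply: Hs; rewrite inE bs orbT.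
exists (t * C), (fun H' => (H' == H) + c H')%N.
rewrite big_cons E aE linearZ /= -mul_mpolyC mpolyCM.
rewrite (big_rem H) //= [in RHS](big_rem H) //= eqxx add1n exprS.
have -> : \prod_(y <- rem H F) lf (al y) ^+ ((y == H) + c y) =
    \prod_(y <- rem H F) lf (al y) ^+ c y.
  apply: eq_big_seq => y; rewrite (mem_rem_uniq H uF) inE => /andP[/negPf -> _].
  by [].
ring.
Qed.

End LinearFactors.

Section PrimeIdeals.
Variables (k : fieldType) (n : nat).
Local Notation B := {mpoly k[n]}.
Implicit Types (P : prime_idealr B) (a : 'cV[k]_n) (U : 'M[k]_n).

Lemma prime_dvdmp P x y : dvdmp x y -> x \in P -> y \in P.
Proof. by case=> q -> xP; apply: idealMr. Qed.

Lemma prime_const P (C : k) : C != 0 -> C%:MP \in P = false.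
Proof.
move=> C0; apply/negP=> CP; have := idealr1 P; rewrite -mpolyC1 -(mulVf C0) mpolyCM.
by rewrite idealMr.
Qed.

Lemma prime_prod P (I : eqType) (s : seq I) (F : I -> B) :
  \prod_(i <- s) F i \in P -> exists2 i, i \in s & F i \in P.
Proof.
elim: s => [|i s IHs]; first by rewrite big_nil idealr1.
rewrite big_cons prime_idealrM => /orP[Fi|/IHs[j js Fj]].
  by exists i => //; rewrite mem_head.
by exists j => //; rewrite inE js orbT.
Qed.

Lemma prime_exp P x j : x ^+ j \in P -> x \in P.
Proof.
by elim: j => [|j IHj]; rewrite ?expr0 ?idealr1 // exprS prime_idealrM => /orP[].
Qed.

Lemma linear_locusE U a P : a != 0 -> is_form U a -> linear_locus U P <-> lf a \in P.
Proof.
move=> a0 Ua; split=> [H|aP b /vanishing_form[a' -> Ha']].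
  exact/H/form_vanishing.
have [z ->] := form_unique a0 Ua Ha'.
by rewrite linearZ /= -mul_mpolyC idealMr.
Qed.

Section GenericPoint.
Variables (a : 'cV[k]_n) (K : 'rV[k]_n).
Hypothesis Ka : K *m a = 1%:M.

(** The multiples of [lf a], given as the kernel of restriction to the hyperplane: membership is
    boolean, and primality comes from the target being a domain. *)
Definition hyperplane_ideal of K *m a = 1%:M : B -> bool :=
  fun b => mxact (1%:M - a *m K) b == 0.
Local Notation I := (hyperplane_ideal Ka).

Fact hyperplane_idealE b : (b \in I) = (mxact (1%:M - a *m K) b == 0).
Proof. by []. Qed.

Fact hyperplane_idealr_closed : idealr_closed I.
Proof.
split=> [||x y z]; rewrite !hyperplane_idealE ?rmorph0 ?rmorph1 ?oner_eq0 //.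
by move=> /eqP y0 /eqP z0; rewrite rmorphD rmorphM /= y0 z0 mulr0 addr0.
Qed.

Fact hyperplane_ideal_prime : prime_idealr_closed I.
Proof. by move=> x y; rewrite !hyperplane_idealE rmorphM mulf_eq0. Qed.

HB.instance Definition _ := isIdealr.Build B I hyperplane_idealr_closed.
HB.instance Definition _ := isPrimeIdealrClosed.Build B I hyperplane_ideal_prime.

Definition hyperplane_point : prime_idealr B := I.

End GenericPoint.

Lemma generic_prime a : a != 0 ->
  exists P0 : prime_idealr B, forall b, b \in P0 <-> dvdmp (lf a) b.
Proof.
move=> /col_left_inv[K Ka]; exists (hyperplane_point Ka) => b.
by rewrite (dvd_lfP _ Ka); split=> /eqP.
Qed.

(** The multiples of [lf a] form a generic point: a closed set containing it contains the whole
    locus. *)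
Lemma locus_irreducible a T : a != 0 -> (forall P, T P <-> lf a \in P) ->
  zariski_irreducible T.
Proof.
move=> a0 TE; have [P0 P0E] := generic_prime a0.
have TP0 : T P0 by apply/TE/P0E; exists 1; rewrite mul1r.
split; first by exists P0.
have sub T1 : zariski_closed T1 -> T1 P0 -> forall P, T P -> T1 P.
  move=> [S SE] /SE H P /TE aP; apply/SE=> b /H/P0E dv.
  exact: prime_dvdmp dv aP.
by move=> T1 T2 c1 c2 /(_ _ TP0)[]; [left|right]; apply: sub.
Qed.

Lemma principal_closed (b : B) : zariski_closed (fun P => b \in P).
Proof. by exists (fun b' => b' = b) => P; split=> [bP _ ->|]; [|apply]. Qed.

Lemma irreducible_sub_union (I : eqType) (s : seq I) (F : I -> B) T :
  zariski_irreducible T -> (forall P, T P -> exists2 i, i \in s & F i \in P) ->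
  exists2 i, i \in s & forall P, T P -> F i \in P.
Proof.
move=> Tirr; elim: s => [|i s IHs] H.
  by have [[P /H[]]] := Tirr.
have [|||Hi|Hs] := Tirr.2 (fun P => F i \in P) (fun P => \prod_(j <- s) F j \in P).
- exact: principal_closed.
- exact: principal_closed.
- move=> P /H[j]; rewrite inE => /predU1P[->|js] FP; [by left|right].
  by rewrite (big_rem j js) /= mulrC idealMr.
- by exists i; rewrite ?mem_head.
have [|j js jT] := IHs; first by move=> P /Hs /prime_prod.
by exists j; rewrite // inE js orbT.
Qed.

End PrimeIdeals.

(** * Hyperplanes of the quotient *)

Section ReflectionQuotient.
Variables (k : fieldType) (hk : [pchar k] =i pred0).
Variables (gT : finGroupType) (Wt G : {group gT}) (n : nat).
Variable rV : mx_representation k Wt n.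
Hypothesis rV_faithful : mx_faithful rV.
Hypothesis nGW : (G <| Wt)%g.
Local Notation B := {mpoly k[n]}.
Variables (m c : nat) (f : m.-tuple B) (r : c.-tuple {mpoly k[m]}).
Hypothesis f_inv : forall l, invariant rV G (tnth f l).
Hypothesis f_gen : forall b, invariant rV G b -> exists a, a \mPo f = b.
Hypothesis r_rel : forall j, tnth r j \mPo f = 0.
Hypothesis r_gen : forall a, a \mPo f = 0 ->
  exists u : 'I_c -> {mpoly k[m]}, a = \sum_(j < c) u j * tnth r j.
Hypothesis cnm : (c + n = m)%N.
Variables (d : 'I_n -> nat) (e : 'I_m -> nat).
Hypothesis f_homog : forall l, whomog d (e l) (tnth f l).
Hypothesis f_pos : forall l, wge d 1 (tnth f l).
Hypothesis f_free : forall u : 'cV[k]_m, lf u \mPo f = 0 -> u = 0.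
Variable rW : mx_representation k (Wt / G)%g m.
Hypothesis f_equiv : induced_action rV f rW.
Hypothesis rel_act : {in (Wt / G)%g, forall x, forall a, ideal_of_image f a ->
     prod_span (positive_part e) (ideal_of_image f) (mxact (rW x) a - a)}.

Let sGW : G \subset Wt := normal_sub nGW.

Local Notation image := (hyperplane_image hk rV_faithful nGW f_inv f_gen r_rel r_gen cnm
  f_homog f_equiv rel_act).

Lemma fix_in_stab s : s \in Wt -> s \in rstab rV (fix_space rV s).
Proof.
move=> sW; apply/rstabP; split=> //; apply/row_matrixP=> i; rewrite row_mul.
by apply/eqP; rewrite -sub_fix_space row_sub.
Qed.

Lemma coset_eq1 s : s \in Wt -> (coset G s == 1%g) = (s \in G).
Proof.
move=> sW; apply/eqP/idP => [|/coset_id //].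
by apply: coset_idr; apply: (subsetP (normal_norm nGW)).
Qed.

Section OneHyperplane.
Variables (a : 'cV[k]_n) (a0 : a != 0).
Local Notation E := (hyper_stab rV a).
Local Notation ram := #|G :&: E|.

(** The stabilizer E is cyclic, so a cyclic subgroup whose order divides that of [G :&: E] is
    contained in it. *)
Lemma hyper_stab_pow s : s \in E -> ((s ^+ ram)%g == 1%g) = (s \in G).
Proof.
move=> sE; have sW := subsetP (hyper_stab_sub rV a) _ sE.
apply/idP/idP => [/eqP s1|sG]; last first.
  rewrite -order_dvdn; apply: order_dvdG.
  by apply/setIP.
have dv : (#|<[s]>%g| %| #|(G :&: E)%G|)%N by rewrite -orderE order_dvdn s1.
have sub : <[s]>%g \subset (G :&: E)%G.
  rewrite -(cardSg_cyclic (hyper_stab_sub_cyclic hk rV_faithful a0)) ?cycle_subG //.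
  exact: subsetIr.
by move: sub; rewrite cycle_subG => /setIP[].
Qed.

Lemma hyper_image_refl s : s \in E -> s \notin G ->
  let S := rW (coset G s) in
  [/\ \rank (S - 1%:M) = 1%N, \det S = \det (rV s) ^+ ram &
      forall u u' : 'cV[k]_m, u != 0 -> u = (S - 1%:M) *m u' ->
      exists (v : 'rV[k]_n) q, [/\ v *m a = 0, q.@[v 0] != 0 &
        lf u \mPo f = q * lf a ^+ ram]].
Proof.
move=> sE NsG S; have := image a0 sE; rewrite /= -/S.
case: ifP => [/eqP lam1 _|_ //]; have := hyper_stab_pow sE; rewrite (negPf NsG).
rewrite -(hyper_det_eq1 hk rV_faithful a0) ?groupX //.
by rewrite (hyper_detX hk rV_faithful a0 _ sE) lam1 eqxx.
Qed.

Lemma hyper_order s : s \in E -> #[coset G s]%g = (#[s]%g %/ gcdn #[s]%g ram)%N.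
Proof.
move=> sE; have sW := subsetP (hyper_stab_sub rV a) _ sE.
have coset1 j : ((coset G s ^+ j)%g == 1%g) = (((s ^+ ram) ^+ j)%g == 1%g).
  have sjW : (s ^+ j)%g \in Wt by apply: groupX.
  rewrite -morphX ?(subsetP (normal_norm nGW)) //= (coset_eq1 sjW).
  by rewrite -(hyper_stab_pow (groupX j sE)) -!expgM mulnC.
rewrite -orderXgcd; apply/eqP; rewrite eqn_dvd !order_dvdn.
by apply/andP; split; [rewrite coset1 | rewrite -coset1]; rewrite expg_order.
Qed.

End OneHyperplane.

Lemma reflection_data s : s \in Wt -> reflection rV s ->
  exists a, [/\ a != 0, is_form (fix_space rV s) a, s \in hyper_stab rV a &
    ram_index G rV (fix_space rV s) = #|G :&: hyper_stab rV a|].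
Proof.
move=> sW rs; have [a [w [a0 w0 E Ha]]] := reflection_form rs.
exists a; split=> //; first by rewrite /= -(rstab_form _ Ha) fix_in_stab.
by rewrite /ram_index (rstab_form _ Ha).
Qed.

Lemma reflection_image s : s \in Wt -> reflection rV s ->
  let eH := ram_index G rV (fix_space rV s) in
  ~~ (#[s]%g %| eH)%N ->
  [/\ reflection rW (coset G s), #[coset G s]%g = (#[s]%g %/ gcdn #[s]%g eH)%N &
      \det (rW (coset G s)) = \det (rV s) ^+ eH].
Proof.
move=> sW rs eH; have [a [a0 Ha sE ramE]] := reflection_data sW rs.
rewrite /eH ramE order_dvdn (hyper_stab_pow a0 sE) => NsG.
have [rk dt _] := hyper_image_refl a0 sE NsG.
by split; rewrite ?reflectionE ?rk // (hyper_order a0 sE).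
Qed.

Lemma reflection_or_trivial s : s \in Wt -> reflection rV s ->
  coset G s = 1%g \/ reflection rW (coset G s).
Proof.
move=> sW rs; have [sG|NsG] := boolP (s \in G); [by left; apply: coset_id | right].
have [a [a0 Ha sE ramE]] := reflection_data sW rs.
by have [rk _ _] := hyper_image_refl a0 sE NsG; rewrite reflectionE rk.
Qed.

Lemma quotient_reflection_group : reflection_group rV -> reflection_group rW.
Proof.
case=> _ genW; split; first exact: (quotient_faithful hk rV_faithful nGW f_gen f_equiv).
apply/eqP; rewrite eqEsubset gen_subG; apply/andP; split.
  by apply/subsetP=> x; rewrite inE => /andP[].
rewrite /= -[in X in X \subset _]genW quotient_gen; last first.
  apply: subset_trans (normal_norm nGW).
  by apply/subsetP=> x; rewrite inE => /andP[].
rewrite gen_subG; apply/subsetP=> _ /morphimP[s _ + ->] /=.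
rewrite inE => /andP[sW rs]; case: (reflection_or_trivial sW rs) => [->|rWs].
  exact: group1.
by apply: mem_gen; rewrite inE mem_quotient.
Qed.

Lemma quotient_reflection_morphism : reflection_group rV ->
  reflection_morphism rV rW (coset G).
Proof.
move=> rgV; split=> //.
- exact: quotient_reflection_group.
- by move=> x xW; apply: mem_quotient.
- move=> x y xW yW; apply: morphM; exact: (subsetP (normal_norm nGW)).
by move=> s sW; apply: reflection_or_trivial.
Qed.

(** If p sends the hyperplane of a into H and x fixes H pointwise, then any lift w of x preserves
    the values of G-invariants on the hyperplane. By [invariants_separate], w agrees there with some
    g in G, and w g^-1 is the lift sought. *)
Lemma lift_to_stab (a : 'cV[k]_n) (H : 'M[k]_m) x : a != 0 -> x \in (Wt / G)%g ->
  (forall u : 'cV_m, (forall v : 'rV_m, (v <= H)%MS -> v *m u = 0) ->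
     dvdmp (lf a) (lf u \mPo f)) ->
  (forall v : 'rV_m, (v <= H)%MS -> v *m rW x = v) ->
  exists2 s, s \in hyper_stab rV a & coset G s = x.
Proof.
move=> a0 /morphimP[w Nw wW ->] Ha Hx.
have [K Ka] := col_left_inv a0.
have [b bG v /sub_kermxP va|g gG gU] :=
    @invariants_separate k hk gT Wt n rV G (kermx a) w sGW wW.
  have [A <-] := f_gen bG; rewrite -mxact_eval -(f_equiv wW).
  apply/eqP; rewrite -subr_eq0 -mevalB -rmorphB.
  have : dvdmp (lf a) ((mxact (rW (coset G w)) A - A) \mPo f).
    rewrite -[X in _ - X]comp_mpoly_id.
    apply: (@comp_mpoly_congr _ _ _ (fun y => dvdmp (lf a) (y \mPo f))).
    - by move=> p q Hp Hq; rewrite rmorphD; apply: dvdmpD.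
    - by move=> p q Hq; rewrite rmorphM; apply: dvdmp_mull.
    - by rewrite comp_mpoly0; apply: dvdmp0.
    move=> l; rewrite -!comp_mpolyXt.
    have -> : ('X_l \mPo [tuple \sum_(j < m) rW (coset G w) j i *: 'X_j | i < m]) -
        ('X_l \mPo [tuple 'X_i | i < m]) =
        lf ((rW (coset G w) - 1%:M) *m delta_mx l 0) :> {mpoly k[m]}.
      rewrite mulmxBl mul1mx -colE raddfB; congr (_ - _).
        exact: (mxactX (rW (coset G w)) l).
      by rewrite comp_mpoly_id -[LHS]mxact1 mxactX colE mul1mx.
    apply: Ha => u uH; rewrite mulmxA mulmxBr mulmx1 Hx // subrr mul0mx //.
  by move/dvd_lf_eval/(_ va) => ->; rewrite eqxx.
have gW := subsetP sGW _ gG; exists (w * g^-1)%g.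
  apply/rstabP; split; first by rewrite groupM ?groupV.
  by rewrite repr_mxM ?groupV // mulmxA gU -mulmxA -repr_mxM ?groupV // mulgV repr_mx1 mulmx1.
rewrite morphM ?groupV ?(subsetP (normal_norm nGW) _ gW) //=.
by rewrite [X in (_ * X)%g]coset_id ?groupV // mulg1.
Qed.

(** The choice of s is immaterial by [fix_space_stab]. The default 1 occurs only when the stabilizer
    lies in G, hence never on [arrangement']. *)
Definition lifted_hyperplane (Ht : 'M[k]_n) : 'M[k]_m :=
  fix_space rW (coset G (odflt 1%g [pick s in rstab rV Ht | s \notin G])).
Local Notation phi := lifted_hyperplane.

Lemma arrangement'P Ht : reflect
  (Ht \in arrangement rV /\ exists2 s, s \in rstab rV Ht & s \notin G)
  (Ht \in arrangement' G rV).
Proof.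
rewrite mem_filter; apply: (iffP andP) => -[A B]; split=> //.
  apply/exists_inP; rewrite -negb_forall_in; apply: contra A => /forall_inP sub.
  by rewrite eqEsubset subsetIr andbT subsetI subxx andbT; apply/subsetP.
case: B => s sH NsG; apply: contraNneq NsG => E.
by move: sH; rewrite E => /setIP[].
Qed.

(** The stabilizer has a generator s0. The image of a power of s0 fixes whatever the image of s0
    fixes, and outside G both fixed spaces are hyperplanes. *)
Lemma fix_space_stab a s s' : a != 0 ->
  s \in hyper_stab rV a -> s \notin G -> s' \in hyper_stab rV a -> s' \notin G ->
  fix_space rW (coset G s) = fix_space rW (coset G s').
Proof.
move=> a0 sE NsG s'E Ns'G.
have /cyclicP[s0 Es0] := hyper_stab_sub_cyclic hk rV_faithful a0.
have s0E : s0 \in hyper_stab rV a by rewrite /= Es0 cycle_id.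
suff H t : t \in hyper_stab rV a -> t \notin G ->
    fix_space rW (coset G s0) = fix_space rW (coset G t) by rewrite -!H.
move=> tE NtG; move: (tE); rewrite /= Es0 => /cycleP[j tj].
have s0W := subsetP (hyper_stab_sub rV a) _ s0E.
have cs0 : coset G s0 \in (Wt / G)%g by apply: mem_quotient.
have Ns0G : s0 \notin G by apply: contra NtG => s0G; rewrite tj groupX.
have [rk0 _ _] := hyper_image_refl a0 s0E Ns0G; have [rkt _ _] := hyper_image_refl a0 tE NtG.
have sub : (eigenspace (rW (coset G s0)) 1 <= eigenspace (rW (coset G t)) 1)%MS.
  apply/rV_subP=> v /eigenspaceP; rewrite scale1r => v0; apply/eigenspaceP; rewrite scale1r.
  rewrite tj morphX ?(subsetP (normal_norm nGW)) //=.
  elim: j {tj} => [|j IHj]; first by rewrite expg0 repr_mx1 mulmx1.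
  by rewrite expgS repr_mxM ?groupX // mulmxA v0.
apply/genmxP; have := mxrank_leqif_sup sub; rewrite /eigenspace !mxrank_ker rk0 rkt.
by move=> [_ /esym]; rewrite eqxx sub.
Qed.

Lemma phi_fix_space Ht a s : is_form Ht a -> a != 0 -> s \in rstab rV Ht -> s \notin G ->
  phi Ht = fix_space rW (coset G s).
Proof.
move=> Ha a0 sH NsG; rewrite /phi; case: pickP => [t /andP[tH NtG]|/(_ s)]; last first.
  by rewrite sH NsG.
by apply: (fix_space_stab a0) => //=; rewrite -(rstab_form _ Ha).
Qed.

Lemma hyperplane_of_stab a s : a != 0 -> s \in hyper_stab rV a -> s \notin G ->
  [/\ is_form (fix_space rV s) a, fix_space rV s \in arrangement' G rV &
      phi (fix_space rV s) = fix_space rW (coset G s)].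
Proof.
move=> a0 sE NsG; have [K [i0 [Ka _ rVE]]] := zeta_exists hk rV_faithful a0.
have sW := subsetP (hyper_stab_sub rV a) _ sE.
have z1 : \det (rV s) - 1 != 0.
  rewrite subr_eq0 (hyper_det_eq1 hk rV_faithful a0 sE).
  by apply: contraNneq NsG => ->; apply: group1.
have rE : rV s - 1%:M = a *m ((\det (rV s) - 1) *: K).
  by rewrite {1}rVE // addrC addKr scalemxAr.
have K0 : K != 0.
  by apply/eqP=> K0; move/eqP: Ka; rewrite K0 mul0mx eq_sym oner_eq0.
have rs : reflection rV s.
  rewrite reflectionE eqn_leq rE; apply/andP; split.
    exact: leq_trans (mxrankM_maxl _ _) (rank_leq_col _).
  rewrite lt0n mxrank_eq0; apply: contraNneq K0 => aK0.
  have := congr1 (mulmx K) aK0; rewrite mulmxA Ka mul1mx mulmx0 => /eqP.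
  by rewrite scaler_eq0 (negPf z1).
have Ha : is_form (fix_space rV s) a.
  move=> v; rewrite sub_fix_space -subr_eq0 -{2}[v]mulmx1 -mulmxBr rE mulmxA.
  rewrite [v *m a]mx11_scalar mul_scalar_mx scaler_eq0 scaler_eq0 (negPf z1) (negPf K0) !orbF.
  by rewrite -rV1_eq0 -mx11_scalar.
have sF : s \in rstab rV (fix_space rV s) by apply: fix_in_stab.
split=> //; last exact: phi_fix_space Ha a0 sF NsG.
apply/arrangement'P; split; last by exists s.
by apply/arrangementP; exists s.
Qed.

Lemma arrangement'_data Ht : Ht \in arrangement' G rV ->
  exists a s, [/\ a != 0, is_form Ht a, s \in hyper_stab rV a, s \notin G &
    phi Ht = fix_space rW (coset G s)].
Proof.
case/arrangement'P=> HtA [s sH NsG].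
have [s0 [s0W rs0 HE]] := arrangementP _ _ HtA.
have [a [w [a0 _ _ Ha]]] := reflection_form rs0; rewrite -HE in Ha.
exists a, s; split=> //; first by rewrite /= -(rstab_form _ Ha).
exact: phi_fix_space Ha a0 sH NsG.
Qed.

Lemma phi_arrangement Ht : Ht \in arrangement' G rV -> phi Ht \in arrangement rW.
Proof.
case/arrangement'_data=> a [s [a0 Ha sE NsG ->]].
have sW := subsetP (hyper_stab_sub rV a) _ sE.
apply/arrangementP; exists (coset G s); split; rewrite ?mem_quotient //.
by have [rk _ _] := hyper_image_refl a0 sE NsG; rewrite reflectionE rk.
Qed.

Lemma vanishing_phi s (u : 'cV[k]_m) :
  (forall v : 'rV_m, (v <= fix_space rW (coset G s))%MS -> v *m u = 0) ->
  exists u', u = (rW (coset G s) - 1%:M) *m u'.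
Proof.
move=> H; apply: col_span_of_ker => v v0; apply: H; rewrite sub_fix_space.
by move/eqP: v0; rewrite mulmxBr mulmx1 subr_eq0.
Qed.

Lemma phi_divides Ht a (u : 'cV[k]_m) : Ht \in arrangement' G rV -> is_form Ht a ->
  (forall v : 'rV_m, (v <= phi Ht)%MS -> v *m u = 0) ->
  u != 0 -> exists (v : 'rV[k]_n) q, [/\ v *m a = 0, q.@[v 0] != 0 &
        lf u \mPo f = q * lf a ^+ #|G :&: rstab rV Ht|].
Proof.
move=> HtA Ha uH u0; have /arrangement'P[HtA0 [s sH NsG]] := HtA.
have a0 := arrangement_form_neq0 HtA0 Ha.
rewrite (phi_fix_space Ha a0 sH NsG) in uH.
have [u' uE] := vanishing_phi uH; rewrite (rstab_form _ Ha) in sH *.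
have [_ _ H] := hyper_image_refl a0 sH NsG.
exact: H u0 uE.
Qed.

Lemma phi_dvdmp Ht a (u : 'cV[k]_m) : Ht \in arrangement' G rV -> is_form Ht a ->
  (forall v : 'rV_m, (v <= phi Ht)%MS -> v *m u = 0) -> dvdmp (lf a) (lf u \mPo f).
Proof.
move=> HtA Ha uH; have [->|u0] := eqVneq u 0.
  by rewrite linear0 comp_mpoly0; apply: dvdmp0.
have [v [q [_ _ ->]]] := phi_divides HtA Ha uH u0.
rewrite -(prednK (cardG_gt0 (G :&: rstab rV Ht)%G)) exprSr mulrA.
by exists (q * lf a ^+ #|G :&: rstab rV Ht|.-1).
Qed.

(** A reflection with hyperplane H lifts by [lift_to_stab] to the stabilizer of [Ht]; the lift is
    not in G, so it can be used to compute [phi Ht]. *)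
Lemma hyperplane_unique Ht a H : Ht \in arrangement' G rV -> is_form Ht a ->
  H \in arrangement rW ->
  (forall u : 'cV_m, (forall v : 'rV_m, (v <= H)%MS -> v *m u = 0) ->
     dvdmp (lf a) (lf u \mPo f)) -> H = phi Ht.
Proof.
move=> HtA Ha /arrangementP[x [xW rx HE]] uH.
have /arrangement'P[HtA0 _] := HtA; have a0 := arrangement_form_neq0 HtA0 Ha.
have [|s sE sx] := lift_to_stab a0 xW uH.
  by move=> v; rewrite HE sub_fix_space => /eqP.
have NsG : s \notin G.
  apply: contraTN rx => /coset_id sG; rewrite -sx sG reflectionE repr_mx1 subrr.
  by rewrite mxrank0.
by rewrite (phi_fix_space Ha a0 _ NsG) ?sx // (rstab_form _ Ha).
Qed.

(** The image of the stabilizer is the full pointwise stabilizer of [phi Ht], so it depends only on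
    [phi Ht]; this is what [hyp_equiv_phi] needs. *)
Lemma stab_image Ht : Ht \in arrangement' G rV ->
  (rstab rV Ht / G)%g = [set x in (Wt / G)%g | phi Ht *m rW x == phi Ht].
Proof.
move=> HtA; have [a [s [a0 Ha sE NsG phiE]]] := arrangement'_data HtA.
apply/setP=> x; rewrite inE; apply/idP/andP => [/morphimP[t Nt tH ->]|[xW /eqP xP]].
  have tW : t \in Wt by case/rstabP: tH.
  split; first exact: mem_quotient.
  have [tG|NtG] := boolP (t \in G); first by rewrite /= coset_id // repr_mx1 mulmx1.
  rewrite (phi_fix_space Ha a0 tH NtG); apply/eqP/row_matrixP=> i; rewrite row_mul.
  by apply/eqP; rewrite -sub_fix_space row_sub.
have [u uH|v /submxP[D ->]|t tE tx] := lift_to_stab (H := phi Ht) a0 xW.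
- exact: (phi_dvdmp HtA Ha uH).
- by rewrite -mulmxA xP.
have tW := subsetP (hyper_stab_sub rV a) _ tE.
by rewrite (rstab_form _ Ha) -tx; apply: mem_quotient.
Qed.

Lemma hyp_equiv_phi H1 H2 : H1 \in arrangement' G rV -> H2 \in arrangement' G rV ->
  hyp_equiv G rV H1 H2 <-> phi H1 = phi H2.
Proof.
move=> H1A H2A; split=> [E|E]; last by rewrite /hyp_equiv (stab_image H1A) (stab_image H2A) E.
have [a1 [s1 [a10 Ha1 s1E Ns1G ->]]] := arrangement'_data H1A.
have [a2 [_ [a20 Ha2 _ _ _]]] := arrangement'_data H2A.
have s1W := subsetP (hyper_stab_sub rV a1) _ s1E.
have : coset G s1 \in (rstab rV H1 / G)%g.
  by apply: mem_quotient; move: s1E; rewrite /= -(rstab_form _ Ha1).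
rewrite E => /morphimP[s2 _ s2H2 s12]; have s2W : s2 \in Wt by case/rstabP: s2H2.
rewrite s12 (phi_fix_space Ha2 a20 s2H2); first by [].
by rewrite -(coset_eq1 s2W) -s12 (coset_eq1 s1W).
Qed.

Lemma orbit_congruence w h y : w \in Wt ->
  (forall b, invariant rV G b -> dvdmp h (mxact (rV w) b - b)) ->
  dvdmp h (\prod_(g in G) (mxact (rV w) y - mxact (rV g) y)).
Proof.
move=> wW Hh; apply: (@prod_conjugates_congr B gT G (act rV) (act_id rV) _ (act rV w) h y) => //.
by move=> g g' gG g'G b; apply: act_mul; apply: (subsetP sGW).
Qed.

(** Modulo the equation u of its fixed hyperplane, the image of w acts trivially on the coordinates
    of V, hence on all of A. *)
Lemma moved_invariant w u b : w \in Wt -> u != 0 -> is_form (fix_space rW (coset G w)) u ->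
  invariant rV G b -> dvdmp (lf u \mPo f) (mxact (rV w) b - b).
Proof.
move=> wW u0 Hu /f_gen[A <-]; rewrite -(f_equiv wW) -rmorphB.
rewrite -[X in _ - X]comp_mpoly_id.
apply: (@comp_mpoly_congr _ _ _ (fun y => dvdmp (lf u \mPo f) (y \mPo f))).
- by move=> p q Hp Hq; rewrite rmorphD; apply: dvdmpD.
- by move=> p q Hq; rewrite rmorphM; apply: dvdmp_mull.
- by rewrite comp_mpoly0; apply: dvdmp0.
move=> l; rewrite -!comp_mpolyXt.
have -> : ('X_l \mPo [tuple \sum_(j < m) rW (coset G w) j i *: 'X_j | i < m]) -
    ('X_l \mPo [tuple 'X_i | i < m]) =
    lf ((rW (coset G w) - 1%:M) *m delta_mx l 0) :> {mpoly k[m]}.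
  rewrite mulmxBl mul1mx -colE raddfB; congr (_ - _).
    exact: (mxactX (rW (coset G w)) l).
  by rewrite comp_mpoly_id -[LHS]mxact1 mxactX colE mul1mx.
have [|z ->] := form_unique (a' := (rW (coset G w) - 1%:M) *m delta_mx l 0) u0 Hu.
  move=> v; rewrite sub_fix_space => /eqP vw.
  by rewrite mulmxA mulmxBr mulmx1 vw subrr mul0mx.
by rewrite linearZ /= comp_mpolyZ -mul_mpolyC; exists z%:MP.
Qed.

Lemma pullback_factor x u : x \in (Wt / G)%g -> reflection rW x -> u != 0 ->
  is_form (fix_space rW x) u ->
  exists (C : k) s, {in s, forall a : 'cV_n, a != 0} /\
    lf u \mPo f = C%:MP * \prod_(a <- s) lf a.
Proof.
move=> /morphimP[w Nw wW xE] rx u0; have {}xE : x = coset G w by [].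
have NwG : w \notin G.
  apply: contraTN rx => /coset_id wG.
  by rewrite xE wG reflectionE repr_mx1 subrr mxrank0.
rewrite xE => Hu.
(* The avoidance lemma runs over the whole finite type; elements outside G repeat the condition for
   1. *)
pose N g := rV w - rV (if g \in G then g else 1%g).
have [|c0 Hc0] := @avoid_col k hk n gT (fun=> n) N.
  move=> g; rewrite /N subr_eq0; set g' := if _ then _ else _.
  have g'G : g' \in G by rewrite /g'; case: ifP.
  apply: contra NwG => /eqP/(repr_inj rV_faithful wW) -> //.
  exact: (subsetP sGW).
have [q qE] := orbit_congruence (lf c0) wW (fun b => @moved_invariant w u b wW u0 Hu).
pose s := [seq (rV w - rV g) *m c0 | g <- enum G].
have s0 : {in s, forall a, a != 0}.
  move=> _ /mapP[g gG ->]; have := Hc0 g; rewrite /N.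
  by rewrite mem_enum in gG; rewrite gG.
have [|C [s' [sub E]]] := divisor_of_forms (h := lf u \mPo f) (q := q) s0.
  rewrite mulrC -qE /s big_map big_enum_cond /=; apply: eq_big => [g|g _]; rewrite ?andbT //.
  by rewrite !mxact_lf -raddfB -mulmxBl.
by exists C, s'; split=> // a /sub/s0.
Qed.

Lemma pullback_lf0 u : (lf u \mPo f)@_0%MM = 0.
Proof.
rewrite /lf (raddf_sum (comp_mpoly f)) raddf_sum big1 //= => l _.
rewrite comp_mpolyZ mcoeffZ comp_mpolyXt memN_msupp_eq0 ?mulr0 //.
apply/negP=> /f_pos; rewrite /weight big1 // => i _.
by rewrite mnm0E.
Qed.

Lemma factor_in_fiber H u a : H \in arrangement rW -> u != 0 -> is_form H u -> a != 0 ->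
  dvdmp (lf a) (lf u \mPo f) ->
  exists2 Ht, Ht \in arrangement' G rV & phi Ht = H /\ is_form Ht a.
Proof.
move=> /arrangementP[x [xW rx HE]] u0 Hu a0 dv.
have [||s sE sx] := lift_to_stab (H := H) a0 xW.
- move=> u' /(form_unique u0 Hu)[z ->]; rewrite linearZ /= comp_mpolyZ -mul_mpolyC.
  exact: dvdmp_mull.
- by move=> v; rewrite HE sub_fix_space => /eqP.
have NsG : s \notin G.
  apply: contraTN rx => /coset_id sG; rewrite -sx sG reflectionE repr_mx1 subrr.
  by rewrite mxrank0.
have [Ha HtA pE] := hyperplane_of_stab a0 sE NsG.
by exists (fix_space rV s) => //; split=> //; rewrite pE sx.
Qed.

(** * Generation of the G-invariants by equations of hyperplanes and averages *)

Section Generation.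
Hypothesis rgW : reflection_group rW.
Variables (N : nat) (U : 'I_N -> 'cV[k]_m).
Hypothesis U_forms : forall x, x \in (Wt / G)%g -> reflection rW x ->
  exists i, U i != 0 /\ is_form (fix_space rW x) (U i).

Let U_mx : 'M[k]_(N, m) := \matrix_i (U i)^T.

(** The condition defines a subgroup, because xy - 1 = (x - 1)(y - 1) + (x - 1) + (y - 1), and this
    subgroup contains all reflections. *)
Lemma group_moves_in_forms : {in (Wt / G)%g, forall x, ((rW x - 1%:M)^T <= U_mx)%MS}.
Proof.
pose D := [set x in (Wt / G)%g | ((rW x - 1%:M)^T <= U_mx)%MS].
have gD : group_set D.
  apply/group_setP; split=> [|x y]; first by rewrite inE group1 repr_mx1 subrr trmx0 sub0mx.
  rewrite !inE => /andP[xW Dx] /andP[yW Dy]; rewrite groupM //= repr_mxM //.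
  have -> : rW x *m rW y - 1%:M =
      (rW x - 1%:M) *m (rW y - 1%:M) + (rW x - 1%:M) + (rW y - 1%:M).
    by rewrite mulmxBr mulmx1 subrK mulmxBl mul1mx addrA subrK.
  rewrite linearD /= (linearD (@trmx _ _ _)) /= trmx_mul !addmx_sub //.
  exact: submx_trans (submxMl _ _) Dx.
have sD : <<[set x in (Wt / G)%g | reflection rW x]>>%g \subset Group gD.
  rewrite gen_subG; apply/subsetP=> x; rewrite !inE => /andP[xW rx]; rewrite xW /=.
  have [a [w [a0 w0 E Ha]]] := reflection_form rx; have [i [U0 Hi]] := U_forms xW rx.
  have [|t aE] := form_unique U0 Hi (a' := a); first by move=> v; rewrite Ha => /eqP.
  rewrite E trmx_mul aE linearZ /= -scalemxAr scalemx_sub //.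
  apply: submx_trans (submxMl _ _) _.
  by rewrite (_ : (U i)^T = row i U_mx) ?row_sub // rowK.
by move=> x xW; move: sD; rewrite rgW.2 => /subsetP/(_ x xW); rewrite inE => /andP[].
Qed.

Definition average (a : {mpoly k[m]}) : {mpoly k[m]} :=
  #|(Wt / G)%g|%:R^-1 *: \sum_(x in (Wt / G)%g) mxact (rW x) a.

Lemma average_inv a : invariant rV Wt (average a \mPo f).
Proof.
move=> w wW; rewrite -(f_equiv wW); congr (_ \mPo f).
have cW : coset G w \in (Wt / G)%g by apply: mem_quotient.
rewrite /average linearZ /= rmorph_sum; congr (_ *: _).
rewrite [RHS](reindex_inj (mulgI (coset G w))) /=.
apply: eq_big => [x|x xW]; first by rewrite groupMl.
exact: (esym (act_mul rW cW xW a)).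
Qed.

Lemma variable_decomposition l : exists z : 'I_N -> k,
  'X_l = average 'X_l + \sum_i z i *: lf (U i) :> {mpoly k[m]}.
Proof.
pose W := (Wt / G)%g; have cW0 : #|W|%:R != 0 :> k.
  by rewrite -(prednK (cardG_gt0 _)) natr_neq0.
pose v : 'cV[k]_m := \sum_(x in W) - (#|W|%:R^-1 *: ((rW x - 1%:M) *m delta_mx l 0)).
have : (v^T <= U_mx)%MS.
  rewrite /v raddf_sum; apply: summx_sub => x xW.
  rewrite -scaleNr /= linearZ /= trmx_mul scalemx_sub // (submx_trans (submxMl _ _)) //.
  exact: group_moves_in_forms.
case/submxP=> D DE; exists (fun i => D 0 i).
have -> : \sum_i D 0 i *: lf (U i) = lf v :> {mpoly k[m]}.
  rewrite -[v]trmxK DE mulmx_sum_row !raddf_sum /=; apply: eq_bigr => i _.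
  by rewrite rowK !linearZ /= trmxK.
have X1 x : x \in W -> lf (- (#|W|%:R^-1 *: ((rW x - 1%:M) *m delta_mx l 0))) =
    #|W|%:R^-1 *: ('X_l : {mpoly k[m]}) - #|W|%:R^-1 *: mxact (rW x) 'X_l.
  move=> xW; rewrite -scalerBr mxactX -scalerN linearZ /=; congr (_ *: _).
  rewrite -mulNmx opprB mulmxBl mul1mx -colE raddfB; congr (_ - _).
  by rewrite -[RHS]mxact1 mxactX colE mul1mx.
rewrite /v raddf_sum (eq_bigr _ X1) sumrB addrC -/W.
rewrite -scaler_suml sumr_const -[X in X *: 'X_l]mulr_natr (mulVf cW0).
by rewrite scale1r -scaler_sumr subrK.
Qed.

Lemma generation_of_invariants (S : B -> Prop) b :
  (forall i, S (lf (U i) \mPo f)) -> (forall c, invariant rV Wt c -> S c) ->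
  invariant rV G b -> in_generated_algebra S b.
Proof.
move=> SU SW /f_gen[A <-].
have /fin_all_exists[z zE] l := variable_decomposition l.
pose t : (N + m).-tuple B := [tuple match split i with
  | inl j => lf (U j) \mPo f | inr l => average 'X_l \mPo f end | i < N + m].
pose q : m.-tuple {mpoly k[N + m]} :=
  [tuple 'X_(rshift N l) + \sum_i z l i *: 'X_(lshift m i) | l < m].
exists (N + m)%N, t, (A \mPo q); split.
  by move=> i; rewrite tnth_mktuple; case: (split i) => j; [|apply/SW/average_inv].
rewrite comp_mpolyA; apply: eq_comp_mpoly => l; rewrite !tnth_mktuple.
rewrite -comp_mpolyXt [in LHS]zE !rmorphD /= !(raddf_sum (comp_mpoly _)).
have tE i : tnth t (unsplit i) = match i with
    | inl j => lf (U j) \mPo f | inr l => average 'X_l \mPo f end.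
  by rewrite tnth_mktuple unsplitK.
rewrite comp_mpolyXt (tE (inr l)); congr (_ + _); apply: eq_bigr => i _.
by rewrite /= !comp_mpolyZ comp_mpolyXt (tE (inl i)).
Qed.

End Generation.

Lemma coset_eq_div s1 s2 :
  s1 \in Wt -> s2 \in Wt -> coset G s1 = coset G s2 -> (s1 * s2^-1)%g \in G.
Proof.
move=> s1W s2W E; have N := subsetP (normal_norm nGW).
apply: coset_idr; first by rewrite groupM ?groupV ?N.
by rewrite morphM ?groupV ?N //= morphV ?N //= E mulgV.
Qed.

Lemma hyper_stab_moves a s b : a != 0 -> s \in hyper_stab rV a ->
  dvdmp (lf a) (mxact (rV s) b - b).
Proof.
move=> a0 sE; have [K [i0 [Ka _ rVE]]] := zeta_exists hk rV_faithful a0.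
apply/(dvd_lfP _ Ka); rewrite raddfB /= -mxactM rVE // mulmxDr mulmx1 -scalemxAr mulmxBl mul1mx.
by rewrite mulmxA -(mulmxA a) Ka mulmx1 subrr scaler0 addr0 subrr.
Qed.

(** * Pullbacks of reflecting hyperplanes and their irreducible components *)

Section Fiber.
Variable al : 'M[k]_n -> 'cV[k]_n.
Hypothesis al_form : {in arrangement rV, forall Ht, is_form Ht (al Ht)}.
Local Notation fiber H := [seq Ht <- arrangement' G rV | phi Ht == H].

Lemma fiberP H Ht : reflect (Ht \in arrangement' G rV /\ phi Ht = H) (Ht \in fiber H).
Proof.
have -> : (Ht \in fiber H) = (phi Ht == H) && (Ht \in arrangement' G rV).
  exact: mem_filter.
apply: (iffP andP) => [[/eqP pE HtA]|[HtA pE]]; split=> //.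
exact/eqP.
Qed.

Lemma arrangement'_sub Ht : Ht \in arrangement' G rV -> Ht \in arrangement rV.
Proof. by case/arrangement'P. Qed.

Lemma arrangement'_form Ht : Ht \in arrangement' G rV -> al Ht != 0.
Proof.
by move/arrangement'_sub=> HtA; apply: arrangement_form_neq0 (HtA) (al_form HtA).
Qed.

Lemma fiber_uniq H : uniq (fiber H).
Proof. by rewrite !filter_uniq // undup_uniq. Qed.

Lemma form_dvd_eq Ht Ht' : Ht \in arrangement' G rV -> Ht' \in arrangement' G rV ->
  dvdmp (lf (al Ht)) (lf (al Ht')) -> Ht = Ht'.
Proof.
move=> HtA Ht'A dv; have [t E] := dvd_lf_lf (arrangement'_form HtA) dv.
have t0 : t != 0.
  by apply: contraNneq (arrangement'_form Ht'A) => t0; rewrite E t0 scale0r.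
have [HtA0 Ht'A0] := (arrangement'_sub HtA, arrangement'_sub Ht'A).
apply: arrangement_form_eq (HtA0) (Ht'A0) (al_form HtA0) _ => v.
by rewrite (al_form Ht'A0) E -scalemxAr scaler_eq0 (negPf t0).
Qed.

Lemma pullback_form H u : H \in arrangement rW -> u != 0 -> is_form H u ->
  (exists2 Ht, Ht \in arrangement' G rV & phi Ht = H) /\
  exists2 C : k, C != 0 &
    lf u \mPo f = C%:MP * \prod_(Ht <- fiber H) lf (al Ht) ^+ ram_index G rV Ht.
Proof.
move=> HA u0 Hu; have /arrangementP[x [xW rx HE]] := HA.
have h0 : lf u \mPo f != 0 by apply: contraNneq u0 => /f_free ->.
have [C [s [s0 hE]]] : exists (C : k) s, {in s, forall a : 'cV_n, a != 0} /\
    lf u \mPo f = C%:MP * \prod_(a <- s) lf a.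
  by apply: (pullback_factor xW rx u0); rewrite -HE.
have sF : {in s, forall a, exists2 Ht, Ht \in fiber H & exists t, a = t *: al Ht}.
  move=> a as_; have a0 := s0 a as_.
  have dv : dvdmp (lf a) (lf u \mPo f).
    rewrite hE (big_rem a as_) /= mulrCA.
    exists (C%:MP * \prod_(y <- rem a s) lf y); exact: mulrC.
  have [Ht HtA [pE Ha]] := factor_in_fiber HA u0 Hu a0 dv.
  exists Ht; first by apply/fiberP.
  apply: form_unique (arrangement'_form HtA) (al_form (arrangement'_sub HtA)) _ => v.
  by rewrite Ha => /eqP.
split.
  (* With no linear factor the pullback would be constant; it has no constant term, so it would
     vanish, against [f_free]. *)
  have : s != [::].
    apply: contraNneq h0 => sE; rewrite hE sE big_nil mulr1.
    have := pullback_lf0 u; rewrite hE sE big_nil mulr1 mcoeffC eqxx mulr1 => ->.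
    by rewrite mpolyC0.
  case: s sF {s0 hE} => // a s sF _.
  have [|Ht /fiberP[HtA pE] _] := sF a; first exact: mem_head.
  by exists Ht.
have [C' [cnt cE]] := collect_forms (fiber_uniq H) sF.
have {}hE : lf u \mPo f = (C * C')%:MP * \prod_(Ht <- fiber H) lf (al Ht) ^+ cnt Ht.
  by rewrite hE cE mulrA mpolyCM.
have CC0 : C * C' != 0.
  by apply: contraNneq h0 => E; rewrite hE E mpolyC0 mul0r.
exists (C * C') => //; rewrite hE; congr (_ * _); apply: eq_big_seq => Ht HtF.
have [HtA pE] := fiberP _ _ HtF; congr (_ ^+ _).
have a0 := arrangement'_form HtA; have Ha := al_form (arrangement'_sub HtA).
have uH (v : 'rV_m) : (v <= phi Ht)%MS -> v *m u = 0 by rewrite pE Hu => /eqP.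
have [v [q [va qv qE]]] := phi_divides HtA Ha uH u0.
(* Two expressions of the pullback are compared, each a power of the form of [Ht] times a cofactor
   it does not divide; the exponent in the second is the ramification index. *)
apply: (multiplicity_unique a0
  (q := (C * C')%:MP * \prod_(y <- rem Ht (fiber H)) lf (al y) ^+ cnt y) (q' := q)).
- case/(lf_prime a0) => [dv|].
    have := dvd_lf_eval dv va; rewrite mevalC => E.
    by rewrite E eqxx in CC0.
  case/(lf_prime_prod a0) => Ht'; rewrite (mem_rem_uniq Ht (fiber_uniq H)) inE.
  case/andP=> /= NE /fiberP[Ht'A _] dv; case/negP: NE; apply/eqP/esym.
  apply: form_dvd_eq => //; move: dv; elim: (cnt Ht') => [|j IHj]; rewrite ?exprS.
    by move/dvd_lf_eval/(_ va); rewrite meval1 => /eqP; rewrite oner_eq0.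
  by case/(lf_prime a0).
- by move/dvd_lf_eval/(_ va)/eqP; rewrite (negPf qv).
by rewrite /ram_index -qE hE (big_rem Ht HtF) /=; ring.
Qed.

Let al_form' Ht (HtA : Ht \in arrangement' G rV) := al_form (arrangement'_sub HtA).
Let al_neq0 Ht (HtA : Ht \in arrangement' G rV) := arrangement'_form HtA.

Lemma linear_locus_al Ht P : Ht \in arrangement' G rV ->
  linear_locus Ht P <-> lf (al Ht) \in P.
Proof. by move=> HtA; apply: linear_locusE (al_neq0 HtA) (al_form' HtA). Qed.

Lemma phi_maps_into Ht : Ht \in arrangement' G rV -> maps_into f Ht (phi Ht).
Proof.
move=> HtA P /(linear_locus_al _ HtA) aP b /vanishing_form[u -> Hu].
rewrite comapE; apply: prime_dvdmp aP.
exact: (phi_dvdmp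
  HtA (al_form' HtA)).
Qed.

Lemma phi_unique Ht H : Ht \in arrangement' G rV -> H \in arrangement rW ->
  maps_into f Ht H -> H = phi Ht.
Proof.
move=> HtA HA into; apply: (hyperplane_unique HtA (al_form' HtA) HA) => u Hu.
have [P0 P0E] := generic_prime (al_neq0 HtA); apply/P0E.
have : linear_locus H (spec_map f P0).
  by apply: into; apply/linear_locus_al/P0E => //; exists 1; rewrite mul1r.
apply; split=> [|v /Hu vu]; first exact: lf_homog.
by rewrite lf_eval vu mxE.
Qed.

Lemma arrangement_form H : H \in arrangement rW -> exists2 u, u != 0 & is_form H u.
Proof.
case/arrangementP=> x [_ rx ->]; have [u [_ [u0 _ _ Hu]]] := reflection_form rx.
by exists u.
Qed.

Lemma phi_surjective H : H \in arrangement rW ->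
  exists2 Ht, Ht \in arrangement' G rV & phi Ht = H.
Proof.
move=> HA; have [u u0 Hu] := arrangement_form HA.
by have [] := pullback_form HA u0 Hu.
Qed.

Lemma preim_hyperplaneP H P : H \in arrangement rW ->
  preim_hyperplane f H P <-> exists2 Ht, Ht \in fiber H & lf (al Ht) \in P.
Proof.
move=> HA; have [u u0 Hu] := arrangement_form HA.
have [_ [C C0 hE]] := pullback_form HA u0 Hu.
split=> [[/(linear_locusE _ u0 Hu)]|[Ht HtF aP]].
  rewrite comapE hE prime_idealrM prime_const //= => /prime_prod[Ht HtF /prime_exp aP] _.
  by exists Ht.
have /fiberP[HtA <-] := HtF.
split; first exact/phi_maps_into/linear_locus_al.
by move=> A A0; rewrite comapE A0 rpred0.
Qed.

(** Distinct hyperplanes of the fiber have non-proportional forms, so no locus contains another and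
    each is maximal. *)
Lemma component_of_preimage H T : H \in arrangement rW ->
  irreducible_component (preim_hyperplane f H) T <->
  exists2 Ht, Ht \in fiber H & forall P, T P <-> lf (al Ht) \in P.
Proof.
move=> HA; split=> [[Tirr TX Tmax]|[Ht HtF TE]].
  have [|Ht HtF THt] := irreducible_sub_union (s := fiber H) (F := fun Ht => lf (al Ht)) Tirr.
    by move=> P /TX/(preim_hyperplaneP _ HA).
  have /fiberP[HtA _] := HtF; exists Ht => // P; split; first exact: THt.
  apply: (Tmax (fun P => lf (al Ht) \in P)) => //.
    exact: locus_irreducible (al_neq0 HtA) _.
  by move=> Q aQ; apply/preim_hyperplaneP => //; exists Ht.
have /fiberP[HtA _] := HtF; split; first exact: locus_irreducible (al_neq0 HtA) TE.
  by move=> P /TE aP; apply/preim_hyperplaneP => //; exists Ht.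
move=> T' T'irr T'X TT'.
have [|Ht' Ht'F T'Ht'] := irreducible_sub_union (s := fiber H) (F := fun Ht => lf (al Ht)) T'irr.
  by move=> P /T'X/(preim_hyperplaneP _ HA).
have /fiberP[Ht'A _] := Ht'F; have [P0 P0E] := generic_prime (al_neq0 HtA).
have /T'Ht'/P0E dv : T' P0 by apply/TT'/TE/P0E; exists 1; rewrite mul1r.
by move=> P /T'Ht'; rewrite -(form_dvd_eq HtA Ht'A dv) => /TE.
Qed.

Lemma ramified_on_intersection H1 H2 (P : prime_idealr B) : H1 \in arrangement' G rV ->
  H2 \in arrangement' G rV -> phi H1 = phi H2 -> H1 != H2 ->
  lf (al H1) \in P -> lf (al H2) \in P -> ramified G rV P.
Proof.
move=> H1A H2A E12 NE a1P a2P.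
have /(hyp_equiv_phi
  H1A H2A) E := E12.
have /arrangement'P[_ [s1 s1H1 Ns1G]] := H1A.
have [a10 a20] := (al_neq0 H1A, al_neq0 H2A).
have s1W : s1 \in Wt by case/rstabP: s1H1.
have : coset G s1 \in (rstab rV H1 / G)%g by apply: mem_quotient.
rewrite E => /morphimP[s2 Ns2 s2H2 /= s12]; have s2W : s2 \in Wt by case/rstabP: s2H2.
have s1E : s1 \in hyper_stab rV (al H1) by move: s1H1; rewrite (rstab_form _ (al_form' H1A)).
have s2E : s2 \in hyper_stab rV (al H2) by move: s2H2; rewrite (rstab_form _ (al_form' H2A)).
exists (s1 * s2^-1)%g.
  exact: coset_eq_div s1W s2W s12.
split=> [|b].
  (* If the quotient were 1, the common element s1 = s2 would lie in both stabilizers, and its fixed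
     hyperplane would be both H1 and H2. *)
  apply: contraNneq NE => /(canRL (mulgKV _)); rewrite mul1g => s1s2.
  rewrite -s1s2 in s2E.
  have hyp := hyperplane_of_stab.
  have [F1 FA _] := hyp _ _ a10 s1E Ns1G; have [F2 _ _] := hyp _ _ a20 s2E Ns1G.
  have FA0 := arrangement'_sub FA; apply/eqP.
  rewrite -(arrangement_form_eq FA0 (arrangement'_sub H1A) F1 (al_form' H1A)).
  exact: arrangement_form_eq FA0 (arrangement'_sub H2A) F2 (al_form' H2A).
have VW : s2^-1%g \in Wt by rewrite groupV.
rewrite (repr_mxM rV s1W VW) mxactM.
rewrite -(subrK (mxact (rV s2^-1%g) b) (mxact (rV s1) _)) -addrA; apply: rpredD.
  exact: prime_dvdmp (hyper_stab_moves _ a10 s1E) a1P.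
exact: prime_dvdmp (hyper_stab_moves b a20 (groupVr s2E)) a2P.
Qed.

End Fiber.

End ReflectionQuotient.

Theorem mainTheorem5
  (k : fieldType) (hk : [pchar k] =i pred0)
  (gT : finGroupType) (Wt G : {group gT})
  (n : nat) (d : 'I_n -> nat) (hd : forall i, (0 < d i)%N)
  (rV : mx_representation k Wt n)
  (hgr : {in Wt, forall w, in_GLgrad d (rV w)})
  (hWt : reflection_group rV)
  (hG : (G <| Wt)%g)
  (m : nat) (e : 'I_m -> nat) (f : m.-tuple {mpoly k[n]})
  (hf : equivariant_splitting G rV d e f)
  (rW : mx_representation k (Wt / G)%g m)
  (hrW : induced_action rV f rW)
  (hgood : good e f rW)
  (alpha : 'M[k]_n -> {mpoly k[n]})
  (halpha : {in arrangement rV, forall H, linform_defining H (alpha H)}) :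
  (* (i) *)
  <<[set g in G | reflection rV g || double_reflection rV g]>>%g = G
  (* (ii) *)
  /\ (reflection_morphism rV rW (coset G)
      /\ {in Wt, forall s, reflection rV s ->
            let eH := ram_index G rV (fix_space rV s) in
            ~~ (#[s]%g %| eH)%N ->
            [/\ reflection rW (coset G s),
                #[coset G s]%g = (#[s]%g %/ gcdn #[s]%g eH)%N &
                \det (rW (coset G s)) = \det (rV s) ^+ eH]})
  /\ (exists phi : 'M[k]_n -> 'M[k]_m,
      (* (iii) *)
      [/\ {in arrangement' G rV, forall Ht,
             [/\ phi Ht \in arrangement rW, maps_into f Ht (phi Ht) &
                 {in arrangement rW, forall H, maps_into f Ht H -> H = phi Ht}]},
          {in arrangement' G rV &, forall H1 H2,
             hyp_equiv G rV H1 H2 <-> phi H1 = phi H2},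
          {in arrangement rW, forall H,
             exists2 Ht, Ht \in arrangement' G rV & phi Ht = H} &
          {in arrangement rW, forall H,
             forall T, irreducible_component (preim_hyperplane f H) T <->
               exists2 Ht, Ht \in arrangement' G rV &
                 phi Ht = H /\ (forall P, T P <-> linear_locus Ht P)}]
      (* (iv) *)
      /\ (let alpha_fiber H :=
            alpha_prod G rV alpha [seq Ht <- arrangement' G rV | phi Ht == H] in
          {in arrangement rW, forall H,
             exists2 a, linform_defining H a & a \mPo f = alpha_fiber H}
          /\ forall b, invariant rV G b <->
               in_generated_algebra
                 (fun c => (exists2 H, H \in arrangement rW & c = alpha_fiber H)
                           \/ invariant rV Wt c) b))
  (* (v) *)
  /\ {in arrangement rW, forall H,
        forall T1 T2, irreducible_component (preim_hyperplane f H) T1 ->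
          irreducible_component (preim_hyperplane f H) T2 ->
          ~ (forall P, T1 P <-> T2 P) ->
          forall P, T1 P -> T2 P -> ramified G rV P}.
Proof.
have [rV_faithful gen_Wt] := hWt.
have [[c [[r r_gens] _] cnm] rel_act] := hgood.
have r_rel j : tnth r j \mPo f = 0.
  apply/r_gens; exists (fun i => (i == j)%:R); rewrite (bigD1 j) //= eqxx mul1r big1 ?addr0 //.
  by move=> i /negPf ->; rewrite mul0r.
have r_gen a : a \mPo f = 0 ->
    exists u : 'I_c -> {mpoly k[m]}, a = \sum_(j < c) u j * tnth r j.
  by move/r_gens.
have f_inv l : invariant rV G (tnth f l) by have [] := splitting_inv_pos hf l.
have f_pos l : wge d 1 (tnth f l) by have [] := splitting_inv_pos hf l.
have f_homog := splitting_homog hf.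
have f_gen := splitting_generates hd f_homog hf.
have f_free (u : 'cV[k]_m) : lf u \mPo f = 0 -> u = 0.
  move=> u0; apply/colP=> l; rewrite mxE.
  (* A vanishing combination is an empty sum of products, so freeness modulo the square of the ideal
     applies. *)
  apply: (splitting_free hf (c := fun i => u i 0)); exists [::] => //.
  rewrite big_nil -[RHS]u0 [in RHS]/lf [RHS](raddf_sum (comp_mpoly f)); apply: eq_bigr => i _.
  by rewrite /= comp_mpolyZ comp_mpolyXt.
pose al Ht := linear_coefs (alpha Ht).
have alE : {in arrangement rV, forall Ht, alpha Ht = lf (al Ht)}.
  by move=> Ht /halpha/defining_form[].
have al_form : {in arrangement rV, forall Ht, is_form Ht (al Ht)}.
  by move=> Ht /halpha/defining_form[].
pose phi := lifted_hyperplane (G := G) rV rW.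
pose alpha_fiber H := alpha_prod G rV alpha [seq Ht <- arrangement' G rV | phi Ht == H].
have fiberE H : alpha_fiber H = \prod_(Ht <- [seq Ht <- arrangement' G rV | phi Ht == H])
    lf (al Ht) ^+ ram_index G rV Ht.
  by apply: eq_big_seq => Ht /fiberP[/arrangement'_sub/alE -> _].
have forms H : H \in arrangement rW ->
    exists u, [/\ u != 0, is_form H u & lf u \mPo f = alpha_fiber H].
  move=> HA; have [u u0 Hu] := arrangement_form HA.
  have [_ [C C0 hE]] := pullback_form hk rV_faithful hG f_inv f_gen r_rel r_gen cnm f_homog
    f_pos f_free hrW rel_act al_form HA u0 Hu.
  (* Rescaling u absorbs the constant of [pullback_form], so that the pullback is exactly
     [alpha_fiber H]. *)
  exists (C^-1 *: u); split; first by rewrite scaler_eq0 negb_or invr_eq0 C0.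
    by move=> v; rewrite Hu -scalemxAr scaler_eq0 invr_eq0 (negPf C0).
  rewrite linearZ /= comp_mpolyZ hE fiberE mul_mpolyC scalerA mulVf // scale1r //.
split; first exact: (generated_by_double_reflections hk rV_faithful (normal_sub hG) f_inv f_gen
  r_rel r_gen cnm hd f_homog f_pos).
have rgW : reflection_group rW := quotient_reflection_group hk rV_faithful hG f_inv f_gen
  r_rel r_gen cnm f_homog hrW rel_act hWt.
split; first split.
- exact: (quotient_reflection_morphism hk rV_faithful hG f_inv f_gen r_rel r_gen cnm
    f_homog hrW rel_act).
- move=> s sW rs; exact: (reflection_image hk rV_faithful hG f_inv f_gen r_rel r_gen cnm
    f_homog hrW rel_act sW rs).
have components H T HA := component_of_preimage hk rV_faithful hG f_inv f_gen r_rel r_gen cnm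
  f_homog f_pos f_free hrW rel_act al_form (H := H) T HA.
split.
  exists phi; split; first split.
  - move=> Ht HtA; split.
    + exact: (phi_arrangement hk rV_faithful hG f_inv f_gen r_rel r_gen cnm f_homog hrW rel_act).
    + exact: (phi_maps_into hk rV_faithful hG f_inv f_gen r_rel r_gen cnm f_homog hrW rel_act
        al_form HtA).
    + move=> H HA; exact: (phi_unique hk rV_faithful hG f_inv f_gen r_rel r_gen cnm f_homog
        hrW rel_act al_form HtA HA).
  - exact: (hyp_equiv_phi hk rV_faithful hG f_inv f_gen r_rel r_gen cnm f_homog hrW rel_act).
  - move=> H HA; exact: (phi_surjective hk rV_faithful hG f_inv f_gen r_rel r_gen cnm f_homog
      f_pos f_free hrW rel_act al_form HA).
  - move=> H HA T; split=> [/(components _ _ HA)|] [Ht].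
      case/fiberP=> HtA pE TE; exists Ht => //; split=> // P.
      exact: iff_trans (TE P) (iff_sym (linear_locus_al al_form P HtA)).
    move=> HtA [pE TE]; apply/(components _ _ HA); exists Ht; first exact/fiberP.
    by move=> P; apply: iff_trans (TE P) (linear_locus_al al_form P HtA).
  split.
    move=> H HA; have [u [u0 Hu uE]] := forms H HA; exists (lf u) => //.
    exact: form_defining.
  move=> b; split=> [bG|[N [t [q [St ->]]]]]; last first.
    apply: invariant_comp => i; have [[H HA tE]|tW] := St i.
      have [u [_ _ uE]] := forms H HA; have -> : tnth t i = lf u \mPo f by rewrite uE.
      exact: invariant_comp.
    by move=> g gG; apply: tW; apply: (subsetP (normal_sub hG)).
  have /fin_all_exists[U UP] (i : 'I_(size (arrangement rW))) : exists u,
      [/\ u != 0, is_form (nth 0 (arrangement rW) i) u &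
          lf u \mPo f = alpha_fiber (nth 0 (arrangement rW) i)].
    exact/forms/mem_nth.
  apply: (generation_of_invariants hk f_gen hrW rgW (U := U) _ _ _ bG) => [x xW rx|i|a aW].
  - have xA : fix_space rW x \in arrangement rW by apply/arrangementP; exists x.
    have lt_i : (index (fix_space rW x) (arrangement rW) < size (arrangement rW))%N.
      by rewrite index_mem.
    exists (Ordinal lt_i); have [U0 UH _] := UP (Ordinal lt_i); split=> //.
    by move: UH; rewrite /= nth_index.
  - left; exists (nth 0 (arrangement rW) i); first exact: mem_nth.
    by have [_ _ ->] := UP i.
  by right.
move=> H HA T1 T2 /(components _ _ HA)[H1 /fiberP[H1A p1] T1E].
move=> /(components _ _ HA)[H2 /fiberP[H2A p2] T2E] NE P /T1E a1P /T2E a2P.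
apply: (ramified_on_intersection hk rV_faithful hG f_inv f_gen r_rel r_gen cnm f_homog hrW
  rel_act al_form H1A H2A _ _ a1P a2P); first by rewrite p1 p2.
apply/eqP=> E; case: NE => Q; rewrite E in T1E.
exact: iff_trans (T1E Q) (iff_sym (T2E Q)).
Qed.
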